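(* Let $k>2$ be an even integer, $N\ge1$ an integer, $M>1$, and let $a_m$ ($m\le M$) be complex numbers. Let $1/2<\alpha<1$ and $n=e^{k/(k-3)}$, and suppose $Nk^{\alpha}\ge 2\pi Mn$. Then $$\sum_{f\in H_k^*(N)}\omega_f\Big|\sum_{\substack{m\le M\\ m\nmid N}}a_m\lambda_f(m)\Big|^2\ll\Big(1+\frac{M}{Nk^{\eta}}\Big)\|a\|^2,$$ where $\eta=k(1-\alpha)-k^{2\alpha-1}/2$ and $\|a\|^2=\sum_{m\le M}|a_m|^2$. In the case $k=2$ the same holds with $n=1$ (i.e. under $Nk^\alpha\ge 2\pi M$) and with an extra factor $\log M$ on the second term, i.e. the bound is $\big(1+\frac{M\log M}{Nk^{\eta}}\big)\|a\|^2$. The implied constant is absolute.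
   Context: $H_k^*(N)$ is the set of newforms of even weight $k$ for $\Gamma_0(N)$ with trivial character, normalised so that $f(z)=\sum_{n\ge1}\lambda_f(n)n^{(k-1)/2}e(nz)$ with $\lambda_f(1)=1$. The harmonic weight is $\omega_f=\dfrac{\Gamma(k-1)}{(4\pi)^{k-1}\langle f,f\rangle}$, where $\langle\cdot,\cdot\rangle$ is the Petersson inner product on $S_k(\Gamma_0(N))$. *)

(* Defs.v *)
From HB Require Import structures.
From mathcomp Require Import all_boot all_order all_algebra complex.
From mathcomp Require Import all_classical all_reals all_analysis.

Set Implicit Arguments.
Unset Strict Implicit.
Unset Printing Implicit Defensive.

Import Order.TTheory GRing.Theory Num.Theory.
Import numFieldNormedType.Exports.

Local Open Scope classical_set_scope.
Local Open Scope ring_scope.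
Local Open Scope complex_scope.

Section ModularForms.
Variable R : realType.

Definition cabs (z : R[i]) : R := ComplexField.Normc.normc z.

Definition upper : set R[i] := [set z | 0 < complex.Im z].

(* e(z) = exp(2 pi i z) *)
Definition e2pi (z : R[i]) : R[i] :=
  (expR (- (2 * pi * complex.Im z)))%:C *
    (cos (2 * pi * complex.Re z) +i* sin (2 * pi * complex.Re z)).

Definition SL2Z : set 'M[int]_2 := [set g | \det g = 1].

Definition Gamma0 (N : nat) : set 'M[int]_2 :=
  [set g | SL2Z g /\ (N%:Z %| (g 1 0)%R)%Z].

Definition autj (g : 'M[int]_2) (z : R[i]) : R[i] :=
  (g 1 0)%:~R * z + (g 1 1)%:~R.

Definition moebius (g : 'M[int]_2) (z : R[i]) : R[i] :=
  ((g 0 0)%:~R * z + (g 0 1)%:~R) / autj g z.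

Definition slash (k : nat) (f : R[i] -> R[i]) (g : 'M[int]_2) (z : R[i]) :=
  autj g z ^- k * f (moebius g z).

(* S_k(Gamma_0(N)).  A function on the upper half-plane is represented by its
   extension by 0 to the complex plane, so that equality of functions on the
   half-plane is equality in [R[i] -> R[i]].  For g in SL_2(Z), f|_k g is
   invariant under z |-> z + N, so it expands in powers of e(z / N); the form
   is cuspidal when these expansions have no constant term. *)
Definition cusp_form (k N : nat) : set (R[i] -> R[i]) :=
  [set f | [/\ forall z, ~ upper z -> f z = 0,
    forall z, upper z -> derivable (f : R[i]^o -> R[i]^o) z 1,
    forall g z, Gamma0 N g -> upper z -> slash k f g z = f z
  & forall g, SL2Z g -> exists b : nat -> R[i], forall z, upper z ->
      series (fun n => b n.+1 * e2pi (n.+1%:R * z / N%:R)) @ \oo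
        --> (slash k f g z : R[i]^o)]].

(* The points at which Im is maximal on the Gamma_0(N)-orbit, cut down to the
   strip |Re z| <= 1/2: the Ford fundamental domain of Gamma_0(N), given by
   |Re z| <= 1/2 and |c z + d| >= 1 for all (c, d) = 1 with N | c.  Its
   distinct translates overlap in null sets only. *)
Definition fund_domain (N : nat) : set (R * R) :=
  [set p | [/\ 0 < p.2, `|p.1| <= 2^-1
    & forall g, Gamma0 N g -> complex.Im (moebius g (p.1 +i* p.2)) <= p.2]].

Definition area := (@lebesgue_measure R \x @lebesgue_measure R)%E.

Definition petersson (k N : nat) (f g : R[i] -> R[i]) : R[i] :=
  let F (p : R * R) : R[i] :=
    f (p.1 +i* p.2) * (g (p.1 +i* p.2))^* * (p.2 ^+ k / p.2 ^+ 2)%:C in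
  (\int[area]_(p in fund_domain N) complex.Re (F p)) +i*
  (\int[area]_(p in fund_domain N) complex.Im (F p)).

(* The span of the forms z |-> g(d z), g in S_k(Gamma_0(L)), L d | N, L < N. *)
Definition old_form (k N : nat) : set (R[i] -> R[i]) :=
  [set f | exists (r : nat) (c : 'I_r -> R[i]) (L d : 'I_r -> nat)
    (g : 'I_r -> R[i] -> R[i]),
    (forall j, [/\ (L j * d j %| N)%N, (L j < N)%N & cusp_form k (L j) (g j)])
    /\ f = (fun z => \sum_(j < r) c j * g j ((d j)%:R * z))].

Definition new_space (k N : nat) : set (R[i] -> R[i]) :=
  [set f | cusp_form k N f /\ forall h, old_form k N h -> petersson k N f h = 0].

(* T_n f(z) = n^-1 sum_{a d = n, (a, N) = 1} a^k sum_{b mod d} f((a z + b) / d);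
   on Fourier coefficients with respect to e(m z), b_m becomes
   sum_{a | (m, n), (a, N) = 1} a^(k-1) b_(m n / a^2). *)
Definition hecke (k N n : nat) (f : R[i] -> R[i]) (z : R[i]) : R[i] :=
  n%:R^-1 * \sum_(a <- divisors n | coprime a N)
    a%:R ^+ k * \sum_(b < n %/ a) f ((a%:R * z + b%:R) / (n %/ a)%:R).

(* f(z) = sum_{n >= 1} lam(n) n^((k-1)/2) e(n z) *)
Definition fourier_expansion (k : nat) (f : R[i] -> R[i]) (lam : nat -> R[i]) :=
  forall z, upper z ->
    series (fun n => lam n.+1 *
        (n.+1%:R `^ ((k%:R - 1) / 2))%:C * e2pi (n.+1%:R * z)) @ \oo
      --> (f z : R[i]^o).

Definition lambda (k : nat) (f : R[i] -> R[i]) : nat -> R[i] :=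
  xget (fun=> 0) [set lam | fourier_expansion k f lam].

(* H_k^*(N): the normalised eigenforms of all Hecke operators in the new
   subspace. *)
Definition newforms (k N : nat) : set (R[i] -> R[i]) :=
  [set f | [/\ new_space k N f,
    forall n, (0 < n)%N -> exists t : R[i], forall z, upper z ->
      hecke k N n f z = t * f z
  & lambda k f 1 = 1]].

Definition Gamma (s : R) : R :=
  \int[@lebesgue_measure R]_(t in `]0, +oo[) (t `^ (s - 1) * expR (- t)).

Definition omega (k N : nat) (f : R[i] -> R[i]) : R :=
  Gamma (k%:R - 1) / ((4 * pi) ^+ (k - 1) * complex.Re (petersson k N f f)).

(* The left-hand side as an extended real: the terms are nonnegative, so the
   sum makes sense without appeal to the finiteness of H_k^*(N). *)
Definition newform_sum (k N : nat) (M : R) (a : nat -> R[i]) : \bar R :=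
  \esum_(f in newforms k N)
    (omega k N f *
      cabs (\sum_(1 <= m < (Num.truncn M).+1 | ~~ (m %| N)%N)
              a m * lambda k f m) ^+ 2)%:E.

Definition normsq (M : R) (a : nat -> R[i]) : R :=
  \sum_(1 <= m < (Num.truncn M).+1) cabs (a m) ^+ 2.

Definition eta (k : nat) (alpha : R) : R :=
  k%:R * (1 - alpha) - k%:R `^ (2 * alpha - 1) / 2.

End ModularForms.

(* Main.v *)
(* Drop the second term of the bound: sum_f omega_f |L(f)|^2 <= C ||a||^2 holds
   outright.  By duality it suffices to bound sum_{m <= M} |lam_F(m)|^2 by <F, F>
   for F = sum_f omega_f conj(L(f)) f, and <F, F> = kappa sum_f omega_f |L(f)|^2
   because distinct newforms are orthogonal.  The half-strip |x| <= 1/2, y >= 1/N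
   lies in the Ford domain, as |c z + d| >= N y >= 1 there when c <> 0; Bessel's
   inequality in x then bounds <F, F> below by
   sum_m |lam_F(m)|^2 (4 pi)^(1-k) Gamma(k-1, 4 pi m / N), and the hypothesis on
   N k^alpha puts 4 pi m / N at most 8 (k-2) / 9, where the incomplete Gamma
   function is at least Gamma(k-1) / 9.

   Orthogonality: the Hecke operators T_n with (n, N) = 1 are self-adjoint.  For
   p | N the trace of a newform f to level N / p vanishes almost everywhere, since
   its norm is the product of f with an old form; this makes U_p zero when p^2 | N
   and minus an Atkin-Lehner involution otherwise, self-adjoint in both cases.
   The eigenvalues determine the Fourier coefficients.  Adjointness comes from
   unfolding integrals of squares |f|g + h|^2, all nonnegative, and polarizing;
   forms whose norm is infinite have omega_f = 0, as [fine +oo = 0] and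
   [x / 0 = 0]. *)

From HB Require Import structures.
From mathcomp Require Import ring lra zify measurable_realfun.
Require Import Defs.
From mathcomp Require Import all_boot all_order all_algebra complex.
From mathcomp Require Import all_classical all_reals all_analysis.

Set Implicit Arguments.
Unset Strict Implicit.
Unset Printing Implicit Defensive.

Import Order.TTheory GRing.Theory Num.Theory.
Import numFieldNormedType.Exports.

Local Open Scope classical_set_scope.
Local Open Scope ring_scope.
Local Open Scope complex_scope.

(** * Integration on the hyperbolic plane *)

Section Density.
Local Open Scope ereal_scope.
Context d (T : measurableType d) (R : realType).
Import HBNNSimple.

(** Two newforms are told apart here by all their coefficients, hence also by the eigenvalues of U_p
    with p | N, and U_p is in general not normal on the whole space of cusp forms. Newness enters
    exactly there: vanishing of the trace expresses U_p through an operator whose set of integer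
    matrices is stable under the adjugate. That stability is also the whole reason for the
    self-adjointness of T_n.

    Every integral identity is first proved for nonnegative integrands with values in [0, +oo],
    where Tonelli and unfolding are unconditional. Finiteness comes afterwards: the unfolded
    identity with one of the two forms equal to 0 bounds the norms of the slashed forms by the norm
    of the original one.

    The two summands of the constant 9 + e^4 belong to k >= 4 and to k = 2. In weight 2 the interval
    [x, k - 2] carries no mass to compare with, but the density is e^(-t) and the hypothesis gives x
    <= 4. *)

Lemma ge0_integral_density (mu nu : {measure set T -> \bar R}) (D : set T)
    (g : T -> R) :
  measurable D -> measurable_fun D g -> (forall x, D x -> 0 <= g x)%R ->
  (forall A, measurable A -> nu A = \int[mu]_(x in D `&` A) (g x)%:E) ->
  forall f : T -> \bar R, measurable_fun setT f -> (forall x, 0 <= f x) ->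
  \int[nu]_x f x = \int[mu]_(x in D) (f x * (g x)%:E).
Proof.
move=> mD mg g0 nuE f mf f0.
pose f_ := nnsfun_approx measurableT mf.
have mfD n : measurable_fun D (fun x => (f_ n x)%:E * (g x)%:E).
  apply: emeasurable_funM => //; apply/measurable_EFinP => //.
  exact: measurable_funTS.
transitivity (limn (fun n => \int[nu]_x (f_ n x)%:E)).
  rewrite -monotone_convergence//.
  - apply: eq_integral => y _; apply/esym/cvg_lim => //.
    by apply: cvg_nnsfun_approx => // *.
  - by move=> n; exact/measurable_EFinP/measurable_funP.
  - by move=> n y _; rewrite lee_fin.
  - by move=> y _ m n mn; rewrite lee_fin; exact/lefP/nd_nnsfun_approx.
rewrite [X in limn X](_ : _ = (fun n => \int[mu]_(x in D) ((f_ n x)%:E * (g x)%:E))).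
  rewrite -monotone_convergence//; last 2 first.
  - by move=> n x Dx; rewrite mule_ge0// lee_fin// g0.
  - move=> x Dx m n mn; rewrite lee_wpmul2r// ?lee_fin ?g0//.
    exact/lefP/nd_nnsfun_approx.
  apply: eq_integral => x _.
  apply/cvg_lim => //; apply: cvgeZr => //.
  by apply: cvg_nnsfun_approx => // *.
apply/funext => n.
have mI (k : R) : measurable_fun D (fun x => (\1_(f_ n @^-1` [set k]) x)%:E * (g x)%:E).
  apply: emeasurable_funM => //; apply/measurable_EFinP => //.
have kI (k : R) x : (0 <= k * \1_(f_ n @^-1` [set k]) x)%R.
  exact: nnfun_muleindic_ge0.
transitivity (\sum_(k \in range (f_ n))
    \int[mu]_(x in D) ((k * \1_(f_ n @^-1` [set k]) x)%:E * (g x)%:E)); last first.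
  rewrite -ge0_integral_fsum//; last 2 first.
  - by move=> ?; apply: emeasurable_funM; apply/measurable_EFinP => //; exact: measurable_funM.
  - by move=> ? x Dx; rewrite mule_ge0// lee_fin ?g0.
  apply: eq_integral => x /[!inE] Dx.
  by rewrite fimfunE -fsumEFin// ge0_mule_fsuml// => i; rewrite lee_fin.
transitivity (\sum_(k \in range (f_ n)) \int[nu]_x (k * \1_(f_ n @^-1` [set k]) x)%:E).
  under eq_integral do rewrite fimfunE -fsumEFin//.
  rewrite ge0_integral_fsum//.
  - by move=> y; exact/measurable_EFinP/measurable_funM.
  - by move=> y x _; rewrite lee_fin.
apply: eq_fsbigr => r _.
rewrite (integralZl_indic _ (fun r => f_ n @^-1` [set r]))//; last first.
  by move=> r0; rewrite preimage_nnfun0.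
rewrite integral_indic// setIT nuE//.
have [r0|r0] := leP 0%R r; last first.
  rewrite preimage_nnfun0// setI0 integral_set0 mule0.
  by rewrite integral0_eq// => x _; rewrite indicE in_set0 mulr0 mul0e.
under [RHS]eq_integral do rewrite EFinM -muleA.
rewrite ge0_integralZl_EFin//; last by move=> x Dx; rewrite mule_ge0// lee_fin// g0.
congr (_ * _); rewrite integral_mkcondr; apply: eq_integral => x _.
rewrite patchE indicE; case: ifPn; rewrite ?mul1e ?mul0e//.
Qed.
End Density.

(** * Affine and exponential substitutions on the line *)

Section OneDim.
Context {R : realType}.
Notation mu := (@lebesgue_measure R).
Local Open Scope ereal_scope.

Lemma ge0_integral_lebesgueD (f : R -> \bar R) (a : R) :
  measurable_fun setT f -> (forall x, 0 <= f x) ->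
  \int[mu]_x f (x + a)%R = \int[mu]_x f x.
Proof.
move=> mf f0; pose phi := fun x : measurableTypeR R => (x + a)%R : measurableTypeR R.
have mphi : measurable_fun setT phi by exact: measurable_funD.
transitivity (\int[pushforward mu phi]_x f x).
  by rewrite ge0_integral_pushforward.
apply: eq_measure_integral => //= A mA _; apply/esym.
apply: (lebesgue_measure_unique (mu := pushforward mu phi)) => // _ [[b c] _ <-].
change (mu `]b, c] = mu (phi @^-1` `]b, c]%classic)).
rewrite (_ : phi @^-1` _ = [set` `](b - a)%R, (c - a)%R]]); last first.
  by apply/seteqP; split => x /=; rewrite !in_itv/= ltrBlDr lerBrDr.
by rewrite !lebesgue_measure_itv/= !lte_fin ltrD2r -!EFinB; case: ifP => // _; congr (_%:E); lra.
Qed.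

Lemma ge0_integral_lebesgueN (f : R -> \bar R) :
  measurable_fun setT f -> (forall x, 0 <= f x) ->
  \int[mu]_x f (- x)%R = \int[mu]_x f x.
Proof.
move=> mf f0.
transitivity (\int[pushforward mu (-%R : measurableTypeR R -> measurableTypeR R)]_x f x).
  by rewrite ge0_integral_pushforward.
by apply: eq_measure_integral => //= A mA _; rewrite lebesgue_measureN.
Qed.

Lemma ge0_integral_lebesgueM (f : R -> \bar R) (a : R) : (0 < a)%R ->
  measurable_fun setT f -> (forall x, 0 <= f x) ->
  \int[mu]_x f x = a%:E * \int[mu]_x f (a * x)%R.
Proof.
move=> a0 mf f0; pose phi := fun x : measurableTypeR R => (a * x)%R : measurableTypeR R.
have mphi : measurable_fun setT phi by exact: measurable_funM.
pose nu := measure_function_pushforward__canonical__measure_function_Measure mu mphi.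
transitivity (\int[mscale (NngNum (ltW a0)) nu]_x f x); last first.
  by rewrite ge0_integral_mscale// ge0_integral_pushforward.
apply: eq_measure_integral => //= A mA _.
apply: (lebesgue_measure_unique (mu := mscale (NngNum (ltW a0)) nu)) => // _ [[b c] _ <-].
change (mu `]b, c] = a%:E * mu (phi @^-1` `]b, c]%classic)).
rewrite (_ : phi @^-1` _ = [set` `](b / a)%R, (c / a)%R]]); last first.
  by apply/seteqP; split => x /=; rewrite !in_itv/= ltr_pdivrMr// ler_pdivlMr// ![(x * a)%R]mulrC.
rewrite !lebesgue_measure_itv/= !lte_fin ltr_pM2r ?invr_gt0// -!EFinB; case: ifP => // _; last by rewrite mule0.
by rewrite -EFinM; congr (_%:E); field; rewrite gt_eqF.
Qed.

Lemma measurable_invr : measurable_fun [set: R] (fun y : R => y^-1)%R.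
Proof.
rewrite (_ : [set: R] = [set 0%R] `|` [set~ 0%R]); last by rewrite setUv.
apply/measurable_funU => //; first exact: measurableC.
split; first exact: measurable_fun_set1.
apply: open_continuous_measurable_fun; first exact: closed_openC.
by move=> x; rewrite inE/= => /eqP x0; exact: cvgV.
Qed.

(** The image under [ln] of the measure dy / y. It is Lebesgue measure because the integral of 1 / y
    over ]e^a, e^b] is b - a and half-open intervals determine the measure; this justifies the
    substitution y = e^t. *)
Let lnmass (A : set (measurableTypeR R)) : \bar R := \int[mu]_(y in `]0%R, +oo[ `&` (@ln R) @^-1` A) (y^-1)%:E.

Let mlnA (A : set (measurableTypeR R)) : measurable A ->
  measurable (`]0%R, +oo[ `&` (@ln R) @^-1` A : set (measurableTypeR R)).
Proof.
move=> mA; apply: measurableI => //; rewrite -[X in measurable X]setTI.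
exact (measurable_ln (R:=R) measurableT mA).
Qed.

Let minv : measurable_fun (`]0%R, +oo[%classic : set R) (fun y : R => y^-1)%R.
Proof. exact: (measurable_funS measurableT (@subsetT _ _) measurable_invr). Qed.

Let lnmass0 : lnmass set0 = 0.
Proof. by rewrite /lnmass preimage_set0 setI0 integral_set0. Qed.

Let lnmass_ge0 A : 0 <= lnmass A.
Proof.
by apply: integral_ge0 => y [/=]; rewrite in_itv/= andbT => y0 _; rewrite lee_fin invr_ge0 ltW.
Qed.

Let lnmass_sigma_additive : semi_sigma_additive lnmass.
Proof.
move=> F mF tF mUF; rewrite /lnmass; apply: cvg_toP.
  apply: ereal_nondecreasing_is_cvgn => m n mn.
  by apply: lee_sum_nneg_natr => // k _ _; exact: lnmass_ge0.
rewrite preimage_bigcup setI_bigcupr ge0_integral_bigcup//=.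
- by move=> k; apply: mlnA; exact: mF.
- apply/measurable_EFinP; apply: measurable_funS minv => //.
  by move=> x [i _ []].
- move=> x [i _ [/=]]; rewrite in_itv/= andbT => y0 _; rewrite lee_fin invr_ge0 ltW//.
- move=> i j _ _ [x [[_ Fi] [_ Fj]]]; apply: (tF i j) => //.
  by exists (ln x).
Qed.

Let lnmass_measure := isMeasure.Build _ _ _ lnmass lnmass0 lnmass_ge0 lnmass_sigma_additive.
Let lnmassM : {measure set (measurableTypeR R) -> \bar R} := HB.pack lnmass lnmass_measure.

Let lnmassE A : measurable A -> mu A = lnmass A.
Proof.
move=> mA; apply: (lebesgue_measure_unique (mu := lnmassM)) => // _ [[a b] _ <-] /=.
rewrite /lnmass (_ : _ `&` _ = [set` `]expR a, expR b]]); last first.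
  apply/seteqP; split => x /=; rewrite !in_itv/= andbT.
    by move=> [x0 /andP[ax xb]]; rewrite -[x]lnK// ltr_expR ler_expR ax.
  move=> /andP[ax xb]; have x0 : (0 < x)%R by apply: lt_trans ax; exact: expR_gt0.
  by split=> //; rewrite -ltr_expR -ler_expR lnK// ax.
rewrite lebesgue_measure_itv/= lte_fin; case: ltP => ab; last first.
  by rewrite set_itv_ge ?integral_set0// bnd_simp -leNgt ler_expR.
rewrite integral_itv_obnd_cbnd; last first.
  apply/measurable_EFinP; apply: measurable_funS minv => // x /=.
  by rewrite !in_itv/= andbT => /andP[+ _]; apply: lt_trans; exact: expR_gt0.
rewrite (@continuous_FTC2 _ _ (@ln R))//.
- by rewrite !expRK.
- by rewrite ltr_expR.
- apply: continuous_in_subspaceT => x; rewrite inE/= in_itv/= => /andP[ax _].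
  by apply: cvgV => //; rewrite gt_eqF// (lt_le_trans _ ax)// expR_gt0.
- split.
  + move=> x; rewrite in_itv/= => /andP[ax _]; apply: ex_derive.
    by apply: is_derive1_ln; rewrite (lt_trans _ ax)// expR_gt0.
  + by apply: cvg_at_right_filter; apply: continuous_ln; exact: expR_gt0.
  + by apply: cvg_at_left_filter; apply: continuous_ln; exact: expR_gt0.
- move=> x; rewrite in_itv/= => /andP[ax _]; rewrite derive1E.
  have x0 : (0 < x)%R by rewrite (lt_trans _ ax)// expR_gt0.
  by have [_ ->] := is_derive1_ln x0.
Qed.

Lemma ge0_integral_expR (h : R -> \bar R) :
  measurable_fun setT h -> (forall x, 0 <= h x) ->
  \int[mu]_(y in `]0%R, +oo[) (h y * (y^-1)%:E) = \int[mu]_t h (expR t).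
Proof.
move=> mh h0.
have me : measurable_fun setT (expR : measurableTypeR R -> measurableTypeR R) by exact: measurable_expR.
pose nu := measure_function_pushforward__canonical__measure_function_Measure mu me.
transitivity (\int[nu]_x h x); last first.
  by rewrite ge0_integral_pushforward.
apply/esym/ge0_integral_density => //.
- by move=> x /=; rewrite in_itv/= andbT invr_ge0 => /ltW.
- move=> A mA; rewrite /nu /= /pushforward lnmassE; last by rewrite -[X in measurable X]setTI; apply (me measurableT).
  rewrite /lnmass (_ : _ `&` _ = `]0%R, +oo[ `&` A)//.
  apply/seteqP; split => x /=; rewrite in_itv/= andbT => -[x0]; rewrite lnK//.
Qed.
End OneDim.

(** * The invariant measure dx dy / y^2 *)

Section Hyperbolic.
Context {R : realType}.
Notation mu := (@lebesgue_measure R).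

Definition uhp : set (R * R) := [set p | 0 < p.2].

Lemma measurable_uhp : measurable uhp.
Proof.
rewrite (_ : uhp = setT `&` snd @^-1` `]0, +oo[); last first.
  by apply/seteqP; split => p /=; rewrite in_itv/= andbT// => -[].
exact: measurable_snd.
Qed.

Definition hyp (phi : R * R -> \bar R) : \bar R :=
  (\int[@area R]_(p in uhp) (phi p * (p.2 ^- 2)%:E))%E.

(* In the coordinates (t, u) |-> (u e^t, e^t) the measure dx dy / y^2 is dt du,
   and z |-> -1/z is (t, u) |-> (- t - ln (1 + u^2), - u): invariance only
   needs affine substitutions in one variable at a time. *)
Definition hypc (p : R * R) : R * R := (p.2 * expR p.1, expR p.1).

Lemma uhp_hypc p : uhp (hypc p). Proof. exact: expR_gt0. Qed.

Lemma measurable_hypc : measurable_fun setT hypc.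
Proof.
apply/measurable_fun_pair => //=.
  by apply: measurable_funM => //; apply: measurableT_comp => //; exact: measurable_expR.
by apply: measurableT_comp => //; exact: measurable_expR.
Qed.

Lemma measurable_comp_hypc (phi : R * R -> \bar R) : measurable_fun uhp phi ->
  measurable_fun setT (phi \o hypc).
Proof.
move=> mphi; apply: (measurable_comp measurable_uhp) => //.
- by move=> _ [p _ <-]; exact: uhp_hypc.
- exact: measurable_hypc.
Qed.

Local Open Scope ereal_scope.

Lemma hyp_coord (phi : R * R -> \bar R) : measurable_fun uhp phi ->
  (forall p, 0 <= phi p) ->
  hyp phi = \int[mu]_t \int[mu]_u phi (hypc (t, u)).
Proof.
move=> mphi phi0.
pose psi := phi \_ uhp.
have mpsi : measurable_fun setT psi.
  by apply/(measurable_restrictT _ measurable_uhp).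
have psi0 p : 0 <= psi p by rewrite /psi patchE; case: ifP.
pose K y := \int[mu]_u psi (u * y, y)%R.
have mK2 : measurable_fun setT (fun p : R * R => psi (p.1 * p.2, p.2)%R).
  apply: (measurableT_comp mpsi); apply/measurable_fun_pair => //=.
  exact: measurable_funM.
have mK : measurable_fun setT K.
  by have := measurable_fun_fubini_tonelli_G (m1 := mu) _ mK2; apply.
have K0 y : 0 <= K y by apply: integral_ge0.
transitivity (\int[mu]_(y in `]0%R, +oo[) (K y * (y^-1)%:E)); last first.
  rewrite ge0_integral_expR//; apply: eq_integral => t _; apply: eq_integral => u _.
  by rewrite /psi patchE mem_set// /uhp/= expR_gt0.
rewrite /hyp integral_mkcond /area.
have min2 : measurable_fun uhp (fun p : R * R => (p.2 ^- 2)%R).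
  apply: measurable_funTS.
  apply: (measurableT_comp (f := fun y : R => (y ^- 2)%R)) => //.
  apply: (measurableT_comp measurable_invr); exact: measurable_funX.
rewrite fubini_tonelli2//; last 2 first.
- apply/(measurable_restrictT _ measurable_uhp).
  by apply: emeasurable_funM => //; apply/measurable_EFinP.
- move=> p; rewrite patchE; case: ifPn => // /[!inE] p0.
  by rewrite mule_ge0// lee_fin invr_ge0 sqr_ge0.
rewrite [RHS]integral_mkcond; apply: eq_integral => y _.
rewrite /fubini_G patchE; case: ifPn => [|/negP]; rewrite inE/= in_itv/= andbT; last first.
  move=> y0; rewrite integral0_eq// => x _; rewrite patchE ifF//.
  by apply/negbTE/negP; rewrite inE.
move=> y0.
transitivity (\int[mu]_x (psi (x, y) * (y ^- 2)%:E)).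
  by apply: eq_integral => x _; rewrite /psi !patchE mem_set.
have mx : measurable_fun setT (fun x => psi (x, y)).
  by apply: (measurableT_comp mpsi); exact/measurable_fun_pair.
rewrite ge0_integralZr//; last by rewrite lee_fin invr_ge0 sqr_ge0.
(* Substituting x = u y produces a factor y, which turns y^-2 into the y^-1 that the substitution y
   = e^t absorbs. *)
rewrite (ge0_integral_lebesgueM y0)//.
under [X in _ * X * _]eq_integral do rewrite mulrC.
rewrite -/(K y) [_ * K y]muleC -muleA -EFinM; congr (_ * _%:E).
by field; rewrite gt_eqF.
Qed.

Definition trH (b : R) (p : R * R) : R * R := (p.1 + b, p.2)%R.
Definition scH (l : R) (p : R * R) : R * R := (l * p.1, l * p.2)%R.
Definition invH (p : R * R) : R * R :=
  (- p.1 / (p.1 ^+ 2 + p.2 ^+ 2), p.2 / (p.1 ^+ 2 + p.2 ^+ 2))%R.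

Lemma measurable_trH b : measurable_fun setT (trH b).
Proof. by apply/measurable_fun_pair => //=; exact: measurable_funD. Qed.

Lemma measurable_scH l : measurable_fun setT (scH l).
Proof. by apply/measurable_fun_pair => //=; exact: measurable_funM. Qed.

Lemma measurable_invH : measurable_fun setT invH.
Proof.
have mi : measurable_fun [set: R * R] (fun p : R * R => ((p.1 ^+ 2 + p.2 ^+ 2)^-1)%R).
  apply: (measurableT_comp measurable_invr).
  by apply: measurable_funD; apply: measurable_funX.
apply/measurable_fun_pair => /=; apply: measurable_funM => //.
exact: measurableT_comp.
Qed.

Lemma trH_uhp b p : uhp p -> uhp (trH b p). Proof. by []. Qed.
Lemma scH_uhp l p : (0 < l)%R -> uhp p -> uhp (scH l p).
Proof. by move=> l0 p0; exact: mulr_gt0. Qed.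
Lemma invH_uhp p : uhp p -> uhp (invH p).
Proof.
by move=> p0; apply: divr_gt0 => //; rewrite ltr_wpDl ?sqr_ge0// exprn_gt0.
Qed.

Lemma measurable_comp_uhp (phi : R * R -> \bar R) (m : R * R -> R * R) :
  measurable_fun setT m -> (forall p, uhp p -> uhp (m p)) ->
  measurable_fun uhp phi -> measurable_fun uhp (phi \o m).
Proof.
move=> mm um mphi; apply: (measurable_comp measurable_uhp) => //.
- by move=> _ [p p0 <-]; exact: um.
- exact: measurable_funTS.
Qed.

Section invariance.
Variable phi : R * R -> \bar R.
Hypothesis mphi : measurable_fun uhp phi.
Hypothesis phi0 : forall p, 0 <= phi p.

Lemma hyp_trH b : hyp (phi \o trH b) = hyp phi.
Proof.
have mt := measurable_comp_uhp (measurable_trH b) (@trH_uhp b) mphi.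
rewrite (hyp_coord mt) => [|p]; last exact: phi0.
rewrite (hyp_coord mphi phi0).
apply: eq_integral => t _.
rewrite -(ge0_integral_lebesgueD (f := fun u => phi (hypc (t, u))) (b * expR (- t)%R))//.
  apply: eq_integral => u _; rewrite /= /trH /hypc /=; congr (phi (_, _)).
  by rewrite mulrDl -mulrA -expRD addNr expR0 mulr1.
apply: (measurableT_comp (measurable_comp_hypc mphi)).
exact/measurable_fun_pair.
Qed.

Lemma hyp_scH l : (0 < l)%R -> hyp (phi \o scH l) = hyp phi.
Proof.
move=> l0; have ms := measurable_comp_uhp (measurable_scH l) (fun p => @scH_uhp l p l0) mphi.
rewrite (hyp_coord ms) => [|p]; last exact: phi0.
rewrite (hyp_coord mphi phi0).
rewrite -(ge0_integral_lebesgueD (f := fun t => \int[mu]_u phi (hypc (t, u))) (ln l))//.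
- apply: eq_integral => t _; apply: eq_integral => u _.
  rewrite /= /scH /hypc /=; congr (phi (_, _)); rewrite expRD lnK//; ring.
- by apply: (measurable_fun_fubini_tonelli_F (m2 := mu) _ (measurable_comp_hypc mphi)) => p; exact: phi0.
- by move=> t; exact: integral_ge0.
Qed.

Lemma hyp_invH : hyp (phi \o invH) = hyp phi.
Proof.
have minv := measurable_comp_uhp measurable_invH invH_uhp mphi.
rewrite (hyp_coord minv) => [|p]; last exact: phi0.
rewrite (hyp_coord mphi phi0).
transitivity (\int[mu]_u \int[mu]_t phi (invH (hypc (t, u)))).
  apply: (fubini_tonelli (m1 := mu) (m2 := mu) (fun p => phi (invH (hypc p)))) => //.
  exact: (measurable_comp_hypc minv).
transitivity (\int[mu]_u \int[mu]_t phi (hypc (t, u))); last first.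
  apply/esym/(fubini_tonelli (m1 := mu) (m2 := mu) (fun p => phi (hypc p))) => //.
  exact: measurable_comp_hypc.
rewrite -(ge0_integral_lebesgueN (f := fun u => \int[mu]_t phi (hypc (t, u))))//; last 2 first.
- by apply: (measurable_fun_fubini_tonelli_G (m1 := mu) _ (measurable_comp_hypc mphi)) => p; exact: phi0.
- by move=> u; exact: integral_ge0.
apply: eq_integral => u _.
have mt : measurable_fun setT (fun t => phi (hypc (t, - u)%R)).
  apply: (measurableT_comp (measurable_comp_hypc mphi)).
  exact/measurable_fun_pair.
rewrite -(ge0_integral_lebesgueN (f := fun t => phi (hypc (t, - u)%R)))//.
rewrite -(ge0_integral_lebesgueD (f := fun t => phi (hypc (- t, - u)%R)) (ln (1 + u ^+ 2)%R))//; last first.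
  by apply: (measurableT_comp mt).
apply: eq_integral => t _; rewrite /invH /hypc /=.
have u0 : (0 < 1 + u ^+ 2)%R by rewrite ltr_pwDl// sqr_ge0.
have t0 := expR_gt0 t.
have -> : (expR (- (t + ln (1 + u ^+ 2))) = (expR t)^-1 / (1 + u ^+ 2))%R.
  by rewrite expRN expRD lnK// invfM.
congr (phi (_, _)); field; rewrite !gt_eqF//= ltr_wpDl ?exprn_gt0 ?sqr_ge0//.
Qed.
End invariance.

End Hyperbolic.

(** * Integer matrices acting on the half-plane *)

Section Mat2.
Variable T : comRingType.

Definition mx2 (a b c d : T) : 'M[T]_2 :=
  \matrix_(i, j) if i == 0 then (if j == 0 then a else b) else (if j == 0 then c else d).

Lemma mx2E a b c d : (mx2 a b c d 0 0 = a) * (mx2 a b c d 0 1 = b) *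
  (mx2 a b c d 1 0 = c) * (mx2 a b c d 1 1 = d).
Proof. by rewrite !mxE. Qed.

Lemma ord2P (P : 'I_2 -> Prop) : P 0 -> P 1 -> forall i, P i.
Proof.
by move=> P0 P1; case=> [[|[|//]] ltm]; [move: P0|move: P1]; congr P; exact/val_inj.
Qed.

Lemma mx2_eq (A B : 'M[T]_2) :
  A 0 0 = B 0 0 -> A 0 1 = B 0 1 -> A 1 0 = B 1 0 -> A 1 1 = B 1 1 -> A = B.
Proof.
move=> h00 h01 h10 h11; apply/matrixP => i j.
by elim/ord2P: i; elim/ord2P: j.
Qed.

Lemma mx2_eta (A : 'M[T]_2) : A = mx2 (A 0 0) (A 0 1) (A 1 0) (A 1 1).
Proof. by apply: mx2_eq; rewrite mx2E. Qed.

Lemma mulmx2 (A B : 'M[T]_2) i j : (A *m B) i j = A i 0 * B 0 j + A i 1 * B 1 j.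
Proof.
rewrite mxE !big_ord_recl big_ord0 addr0.
by rewrite (_ : lift ord0 ord0 = 1 :> 'I_2)//; exact/val_inj.
Qed.

Lemma det2 (A : 'M[T]_2) : \det A = A 0 0 * A 1 1 - A 0 1 * A 1 0.
Proof.
rewrite (expand_det_row _ 0) !big_ord_recl big_ord0 addr0 /cofactor.
rewrite !det_mx11 !mxE /= expr0 expr1 mul1r mulN1r mulrN.
by congr (_ * A _ _ - A _ _ * A _ _); exact/val_inj.
Qed.

(** The adjugate is an integral stand-in for the inverse: when the determinant is positive both act
    alike on the half-plane. *)
Definition adj2 (A : 'M[T]_2) := mx2 (A 1 1) (- A 0 1) (- A 1 0) (A 0 0).

Lemma adj2K : involutive adj2.
Proof. by move=> A; apply: mx2_eq; rewrite !mx2E ?opprK. Qed.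

Lemma det_adj2 A : \det (adj2 A) = \det A.
Proof. by rewrite !det2 !mx2E; ring. Qed.

Lemma mul_adj2 A : A *m adj2 A = (\det A)%:M.
Proof.
by apply: mx2_eq; rewrite mulmx2 det2 !mx2E mxE /=; ring.
Qed.

Lemma mul_adj2l A : adj2 A *m A = (\det A)%:M.
Proof.
by apply: mx2_eq; rewrite mulmx2 det2 !mx2E mxE /=; ring.
Qed.

End Mat2.

Section Moebius.
Variable R : realType.
Implicit Types (z : R[i]) (g h : 'M[int]_2) (p : R * R).

Definition toC p : R[i] := p.1 +i* p.2.
Definition ofC z : R * R := (complex.Re z, complex.Im z).

Lemma ofCK z : toC (ofC z) = z. Proof. by case: z. Qed.
Lemma toCK p : ofC (toC p) = p. Proof. by case: p. Qed.

(** The squared modulus, kept as a polynomial in the two parts so that no square root appears in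
    norms and [ring] and [nra] apply. *)
Definition sqC z : R := complex.Re z ^+ 2 + complex.Im z ^+ 2.

Lemma sqCE z : cabs z ^+ 2 = sqC z.
Proof. by case: z => x y; rewrite /cabs /sqC /= sqr_sqrtr// addr_ge0 ?sqr_ge0. Qed.

Lemma sqC_ge0 z : 0 <= sqC z.
Proof. by rewrite /sqC addr_ge0 ?sqr_ge0. Qed.

Lemma sqC0 : sqC 0 = 0. Proof. by rewrite /sqC /= expr0n addr0. Qed.

Lemma sqCM z w : sqC (z * w) = sqC z * sqC w.
Proof. by case: z w => a b [c d]; rewrite /sqC /=; ring. Qed.

Lemma sqCX z n : sqC (z ^+ n) = sqC z ^+ n.
Proof.
elim: n => [|n IH]; first by rewrite !expr0 /sqC /=; ring.
by rewrite !exprS sqCM IH.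
Qed.

Lemma sqC_real (x : R) : sqC x%:C = x ^+ 2.
Proof. by rewrite /sqC /= expr0n addr0. Qed.

Lemma sqC_eq0 z : (sqC z == 0) = (z == 0).
Proof.
case: z => a b; rewrite /sqC /= paddr_eq0 ?sqr_ge0// !sqrf_eq0.
by rewrite eq_complex.
Qed.

Lemma sqC_gt0 z : (0 < sqC z) = (z != 0).
Proof. by rewrite lt_neqAle sqC_ge0 andbT eq_sym sqC_eq0. Qed.

Lemma sqCV z : sqC z^-1 = (sqC z)^-1.
Proof.
have [->|z0] := eqVneq z 0; first by rewrite invr0 sqC0 invr0.
apply: (mulfI (x := sqC z)); first by rewrite sqC_eq0.
by rewrite -sqCM divff// divff ?sqC_eq0// /sqC /=; ring.
Qed.

Lemma intC (m : int) : (m%:~R : R[i]) = (m%:~R : R)%:C.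
Proof. by rewrite rmorph_int. Qed.

Lemma natC (m : nat) : (m%:R : R[i]) = (m%:R : R)%:C.
Proof. by rewrite rmorph_nat. Qed.

Lemma divC (x y : R) : (x / y)%:C = x%:C / y%:C.
Proof. by rewrite rmorphM fmorphV. Qed.

Lemma expC (x : R) n : (x ^+ n)%:C = x%:C ^+ n.
Proof. exact: rmorphXn. Qed.

Lemma upper_neq0 z : upper z -> z != 0.
Proof.
by rewrite /upper/= => z0; apply/eqP => zE; move: z0; rewrite zE ltxx.
Qed.

Lemma Im_realM (x : R) z : complex.Im (x%:C * z) = x * complex.Im z.
Proof. by case: z => a b /=; ring. Qed.

Lemma Re_realM (x : R) z : complex.Re (x%:C * z) = x * complex.Re z.
Proof. by case: z => a b /=; ring. Qed.

Lemma Im_autj g z : complex.Im (autj g z) = (g 1 0)%:~R * complex.Im z.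
Proof. by rewrite /autj !intC; case: z => x y /=; ring. Qed.

Lemma autj_neq0 g z : \det g != 0 -> upper z -> autj g z != 0.
Proof.
rewrite /upper/= => dg z0; apply/eqP => jz.
have : complex.Im (autj g z) = 0 by rewrite jz.
rewrite Im_autj => /eqP; rewrite mulf_eq0 (gt_eqF z0) orbF intr_eq0 => /eqP c0.
move: jz; rewrite /autj c0 mulr0z mul0r add0r => /eqP; rewrite intr_eq0 => /eqP d0.
by move: dg; rewrite det2 c0 d0 !mulr0 subrr eqxx.
Qed.

Lemma Im_moebius g z : \det g != 0 -> upper z ->
  complex.Im (moebius g z) = (\det g)%:~R * complex.Im z / sqC (autj g z).
Proof.
move=> dg z0; have := autj_neq0 dg z0.
rewrite -sqC_eq0 /moebius det2 /autj /sqC !intC rmorphB !rmorphM /=.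
case: z z0 => x y /= y0; rewrite !(mul0r, subr0, addr0) => n0.
by field.
Qed.

Lemma upper_moebius g z : 0 < \det g -> upper z -> upper (moebius g z).
Proof.
move=> dg z0; rewrite /upper/= Im_moebius ?gt_eqF//.
by rewrite !mulr_gt0// ?ltr0z// invr_gt0 sqC_gt0 autj_neq0// gt_eqF.
Qed.

Lemma autjM g h z : \det h != 0 -> upper z ->
  autj (g *m h) z = autj g (moebius h z) * autj h z.
Proof.
move=> dh z0; have j0 := autj_neq0 dh z0.
rewrite [in RHS]/autj -/(autj h z) mulrDl /moebius mulrA divfK//.
by rewrite /autj !mulmx2 !rmorphD !rmorphM /=; ring.
Qed.

Lemma moebiusM g h z : 0 < \det h -> \det g != 0 -> upper z ->
  moebius (g *m h) z = moebius g (moebius h z).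
Proof.
move=> dh dg z0; have j0 := autj_neq0 (lt0r_neq0 dh) z0.
have j1 := autj_neq0 dg (upper_moebius dh z0).
rewrite /moebius autjM ?lt0r_neq0// -/(moebius h z).
apply: (mulIf (x := autj g (moebius h z) * autj h z)); first exact: mulf_neq0.
rewrite divfK ?mulf_neq0// mulrA divfK// mulrDl /moebius mulrA divfK//.
by rewrite /autj !mulmx2 !rmorphD !rmorphM /=; ring.
Qed.

Lemma slashM k (f : R[i] -> R[i]) g h z : 0 < \det h -> \det g != 0 -> upper z ->
  slash k (slash k f g) h z = slash k f (g *m h) z.
Proof.
move=> dh dg z0.
by rewrite /slash moebiusM// autjM ?lt0r_neq0// exprMn invfM mulrA [X in X * _]mulrC.
Qed.

Lemma moebius_scalar (n : int) z : n != 0 -> moebius n%:M z = z.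
Proof.
move=> n0; rewrite /moebius /autj !mxE /= mulr0z mul0r add0r addr0 mulrAC divff ?mul1r//.
by rewrite intr_eq0.
Qed.

Lemma slash_scalar k (f : R[i] -> R[i]) (n : int) z : n != 0 ->
  slash k f n%:M z = n%:~R ^- k * f z.
Proof.
by move=> n0; rewrite /slash moebius_scalar// /autj !mxE /= mulr0z mul0r add0r.
Qed.

Definition act g p : R * R := ofC (moebius g (toC p)).

Lemma act_uhp g p : 0 < \det g -> uhp p -> uhp (act g p).
Proof. by move=> dg p0; exact: (upper_moebius (z := toC p)). Qed.

Lemma toC_trH b p : toC (trH b p) = toC p + b%:C.
Proof. by rewrite /toC /=; apply/eqP; rewrite eq_complex /= addr0 !eqxx. Qed.

Lemma toC_scH l p : toC (scH l p) = l%:C * toC p.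
Proof. by apply/eqP; rewrite eq_complex /= !mul0r subr0 addr0 !eqxx. Qed.

Lemma toC_invH p : uhp p -> toC (invH p) = - (toC p)^-1.
Proof.
move=> p0; have z0 : toC p != 0 by exact: (upper_neq0 (z := toC p)).
have s0 : sqC (toC p) != 0 by rewrite sqC_eq0.
apply: (mulIf z0); rewrite mulNr mulVf//.
apply/eqP; rewrite eq_complex /=; move: s0; rewrite /sqC /= => s0.
by apply/andP; split; apply/eqP; field.
Qed.

Lemma act_c0 g p : 0 < \det g -> uhp p -> g 1 0 = 0 ->
  0 < (g 0 0)%:~R / (g 1 1)%:~R :> R /\
  act g p = trH ((g 0 1)%:~R / (g 1 1)%:~R) (scH ((g 0 0)%:~R / (g 1 1)%:~R) p).
Proof.
rewrite det2 => + p0 c0; rewrite c0 mulr0 subr0 => ad.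
have d0 : g 1 1 != 0 by apply: contraTneq ad => ->; rewrite mulr0.
have d0R : (g 1 1)%:~R != 0 :> R by rewrite intr_eq0.
split.
  rewrite -(pmulr_lgt0 _ (x := (g 1 1)%:~R ^+ 2)); last by rewrite exprn_even_gt0.
  have -> : (g 0 0)%:~R / (g 1 1)%:~R * (g 1 1)%:~R ^+ 2 = (g 0 0)%:~R * (g 1 1)%:~R :> R by field.
  by rewrite -rmorphM ltr0z.
rewrite -[RHS]toCK toC_trH toC_scH /act; congr ofC.
rewrite /moebius /autj c0 mulr0z mul0r add0r !divC -!intC.
by field; rewrite intr_eq0.
Qed.

(** Bruhat decomposition: (a z + b) / (c z + d) = a / c - (det / c^2) / (z + d / c). Invariance of
    [hyp] under [act g] thus reduces to translations, scalings and z |-> -1/z. *)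
Lemma act_cN0 g p : 0 < \det g -> uhp p -> g 1 0 != 0 ->
  act g p = trH ((g 0 0)%:~R / (g 1 0)%:~R)
    (scH ((\det g)%:~R / (g 1 0)%:~R ^+ 2) (invH (trH ((g 1 1)%:~R / (g 1 0)%:~R) p))).
Proof.
move=> dg p0 c0; have j0 := autj_neq0 (lt0r_neq0 dg) (p0 : upper (toC p)).
rewrite -[RHS]toCK toC_trH toC_scH toC_invH; last exact: trH_uhp.
rewrite toC_trH /act; congr ofC; move: j0; rewrite /moebius /autj.
rewrite !divC expC -!intC => j0.
have c0C : (g 1 0)%:~R != 0 :> R[i] by rewrite intr_eq0.
rewrite det2 rmorphB !rmorphM /=; field.
by rewrite c0C mulrC.
Qed.

Section act_invariance.
Local Open Scope ereal_scope.
Variable g : 'M[int]_2.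
Hypothesis dg : (0 < \det g)%R.

Lemma eq_hyp (phi psi : R * R -> \bar R) : (forall p, uhp p -> phi p = psi p) ->
  hyp phi = hyp psi.
Proof. by move=> h; apply: eq_integral => p /[!inE] p0; rewrite h. Qed.

Lemma measurable_act : measurable_fun uhp (act g).
Proof.
have [c0|c0] := eqVneq (g 1 0)%R 0%R.
  apply: (eq_measurable_fun (trH ((g 0 1)%:~R / (g 1 1)%:~R)%R \o scH ((g 0 0)%:~R / (g 1 1)%:~R)%R)).
    by move=> p /[!inE] p0; have [_ ->] := act_c0 dg p0 c0.
  apply: measurable_funTS; apply: measurableT_comp; first exact: measurable_trH.
  exact: measurable_scH.
apply: (eq_measurable_fun (trH ((g 0 0)%:~R / (g 1 0)%:~R)%R \o
    (scH ((\det g)%:~R / (g 1 0)%:~R ^+ 2)%R \o (invH \o (trH ((g 1 1)%:~R / (g 1 0)%:~R)%R))))).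
  by move=> p /[!inE] p0; rewrite act_cN0.
apply: measurable_funTS; apply: measurableT_comp; first exact: measurable_trH.
apply: measurableT_comp; first exact: measurable_scH.
apply: measurableT_comp; first exact: measurable_invH.
exact: measurable_trH.
Qed.

Lemma measurable_comp_act (phi : R * R -> \bar R) : measurable_fun uhp phi ->
  measurable_fun uhp (phi \o act g).
Proof.
move=> mphi; apply: (measurable_comp measurable_uhp) => //.
- by move=> _ [p p0 <-]; exact: act_uhp.
- exact: measurable_act.
Qed.

Lemma hyp_act (phi : R * R -> \bar R) : measurable_fun uhp phi ->
  (forall p, 0 <= phi p) -> hyp (phi \o act g) = hyp phi.
Proof.
move=> mphi phi0; have [c0|c0] := eqVneq (g 1 0)%R 0%R.
  have p1 : @uhp R (0, 1)%R by rewrite /uhp/=.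
  have [l0 _] := act_c0 dg p1 c0.
  set l := ((g 0 0)%:~R / (g 1 1)%:~R)%R in l0.
  set b := ((g 0 1)%:~R / (g 1 1)%:~R)%R : R.
  rewrite (@eq_hyp _ ((phi \o trH b) \o scH l)).
    have m1 := measurable_comp_uhp (measurable_trH b) (@trH_uhp _ b) mphi.
    rewrite (hyp_scH m1)//; last by move=> p; exact: phi0.
    exact: (hyp_trH mphi).
  by move=> p p0 /=; have [_ ->] := act_c0 dg p0 c0.
set b := ((g 0 0)%:~R / (g 1 0)%:~R)%R : R.
set l := ((\det g)%:~R / (g 1 0)%:~R ^+ 2)%R : R.
set d := ((g 1 1)%:~R / (g 1 0)%:~R)%R : R.
have l0 : (0 < l)%R by rewrite divr_gt0 ?ltr0z// exprn_even_gt0//= intr_eq0.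
rewrite (@eq_hyp _ (((phi \o trH b) \o scH l) \o invH \o trH d)); last first.
  by move=> p p0 /=; rewrite act_cN0.
have m1 := measurable_comp_uhp (measurable_trH b) (@trH_uhp _ b) mphi.
have m2 := measurable_comp_uhp (measurable_scH l) (fun p => @scH_uhp _ l p l0) m1.
have m3 := measurable_comp_uhp (@measurable_invH R) (@invH_uhp R) m2.
rewrite (hyp_trH m3); last by move=> p; exact: phi0.
rewrite (hyp_invH m2); last by move=> p; exact: phi0.
rewrite (hyp_scH m1)//; last by move=> p; exact: phi0.
exact: (hyp_trH mphi).
Qed.
End act_invariance.
End Moebius.

(** * The Ford domain and unfolding *)

Section EsumCount.
Local Open Scope ereal_scope.
Context (R : realType) (I : countType).

(** Enumerating the index type turns a sum over matrices into a series, for which measurability and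
    monotone convergence are available. *)
Lemma esum_pickle (a : I -> \bar R) : (forall i, 0 <= a i) ->
  \esum_(i in [set: I]) a i = \sum_(n <oo) oapp a 0 (pickle_inv n).
Proof.
move=> a0; rewrite nneseries_esumT; last by move=> n; case: (pickle_inv n) => [i|] //=.
have -> : \esum_(n in [set: nat]) oapp a 0 (pickle_inv n) =
    \esum_(n in [set: nat]) if n \in range (@pickle I) then oapp a 0 (pickle_inv n) else 0.
  apply: eq_esum => n _; case: ifPn => // /negP; rewrite inE/= => nr.
  case E : (pickle_inv n) => [x|//]; case: nr; exists x => //.
  by have := @pickle_invK I n; rewrite E.
rewrite -esum_mkcond esum_image; last by move=> x y _ _ /(pcan_inj (@pickleK I)).
by apply: eq_esum => x _; rewrite pickleK_inv.
Qed.

Context d (T : measurableType d) (mu : {measure set T -> \bar R}).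
Variables (D : set T) (A : set I) (f : I -> T -> \bar R).
Hypothesis mD : measurable D.
Hypothesis mf : forall i, A i -> measurable_fun D (f i).
Hypothesis f0 : forall i x, 0 <= f i x.

Let b i x := if i \in A then f i x else 0.
Let b0 i x : 0 <= b i x. Proof. by rewrite /b; case: ifP. Qed.
Let mb i : measurable_fun D (b i).
Proof.
rewrite /b; case: (boolP (i \in A)) => [|_]; last exact: measurable_cst.
by rewrite inE; exact: mf.
Qed.

Lemma measurable_fun_esum : measurable_fun D (fun x => \esum_(i in A) f i x).
Proof.
have -> : (fun x => \esum_(i in A) f i x) = (fun x => \sum_(n <oo) oapp (b^~ x) 0 (pickle_inv n)).
  apply/funext => x; rewrite -esum_pickle//; exact: esum_mkcond.
apply: ge0_emeasurable_sum => [n x _ _|n _]; first by case: pickle_inv => //=.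
by case: pickle_inv => [i|] /=; [exact: mb|exact: measurable_cst].
Qed.

Lemma ge0_integral_esum :
  \int[mu]_(x in D) (\esum_(i in A) f i x) = \esum_(i in A) \int[mu]_(x in D) f i x.
Proof.
rewrite [RHS]esum_mkcond esum_pickle; last first.
  by move=> i; case: ifP => // _; exact: integral_ge0.
transitivity (\int[mu]_(x in D) \sum_(n <oo) oapp (b^~ x) 0 (pickle_inv n)).
  by apply: eq_integral => x _; rewrite -esum_pickle//; exact: esum_mkcond.
rewrite integral_nneseries//; last 2 first.
- by move=> n; case: pickle_inv => [i|] /=; [exact: mb|exact: measurable_cst].
- by move=> n x _; case: pickle_inv => //=.
apply: eq_eseriesr => n _; case: pickle_inv => [i|] /=; last exact: integral0.
by rewrite /b; case: ifP => // _; exact: integral0.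
Qed.
End EsumCount.

Section Ford.
Variables (R : realType) (N : nat).
Hypothesis N0 : (0 < N)%N.
Implicit Types (z : R[i]) (g h : 'M[int]_2) (p : R * R).
Notation G := (Gamma0 N).
Notation F := (@fund_domain R N).

Lemma Gamma0_det (n : nat) g : Gamma0 n g -> \det g = 1. Proof. by case. Qed.

Lemma Gamma0_det_gt0 (n : nat) g : Gamma0 n g -> 0 < \det g.
Proof. by move=> /Gamma0_det ->. Qed.

Lemma Gamma0_1 (n : nat) : Gamma0 n 1%:M.
Proof. by split; rewrite /SL2Z/= ?det1// mxE dvdz0. Qed.

Lemma Gamma0M (n : nat) g h : Gamma0 n g -> Gamma0 n h -> Gamma0 n (g *m h).
Proof.
move=> [dg gn] [dh hn]; split; first by rewrite /SL2Z/= det_mulmx dg dh mulr1.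
by rewrite mulmx2; apply: rpredD; [exact: dvdz_mulr|exact: dvdz_mull].
Qed.

Lemma Gamma0_adj (n : nat) g : Gamma0 n g -> Gamma0 n (adj2 g).
Proof.
by move=> [dg gn]; split; rewrite /SL2Z/= ?det_adj2// mx2E rpredN.
Qed.

Lemma mul_adj_Gamma0 (n : nat) g : Gamma0 n g -> adj2 g *m g = 1%:M.
Proof. by move=> /Gamma0_det dg; rewrite mul_adj2l dg. Qed.

Lemma mul_Gamma0_adj (n : nat) g : Gamma0 n g -> g *m adj2 g = 1%:M.
Proof. by move=> /Gamma0_det dg; rewrite mul_adj2 dg. Qed.

Lemma Gamma0N (n : nat) g : Gamma0 n g -> Gamma0 n (- g).
Proof.
move=> [dg gn]; split; last by rewrite mxE rpredN.
by move: dg; rewrite /SL2Z/= !det2 !mxE mulrNN mulrNN.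
Qed.

Lemma actM g h p : 0 < \det h -> \det g != 0 -> uhp p -> act (g *m h) p = act g (act h p).
Proof. by move=> dh dg p0; rewrite /act ofCK moebiusM. Qed.

Lemma act1 p : act 1%:M p = p.
Proof. by rewrite /act moebius_scalar// toCK. Qed.

Lemma actN g p : act (- g) p = act g p.
Proof.
rewrite /act /moebius /autj !mxE !mulrNz !mulNr -!opprD.
by rewrite invrN mulrNN.
Qed.

Lemma fund_domain_uhp p : F p -> uhp p. Proof. by case. Qed.

Lemma int_sqr_bound (m : int) (B : R) : (m%:~R : R) ^+ 2 <= B -> (`|m| <= Num.truncn B)%N.
Proof.
move=> mB; have B0 : 0 <= B by rewrite (le_trans _ mB)// sqr_ge0.
rewrite truncn_ge_nat// (le_trans _ mB)//.
rewrite -[X in _ <= X]ger0_norm ?sqr_ge0// normrX -intr_norm -rmorphXn /= natr_absz ler_int.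
by case: (`|m|) (normr_ge0 m) => // -[//|k] _; rewrite expr2; lia.
Qed.

(** |c z + d|^2 is a positive definite quadratic form in (c, d): the imaginary part bounds c, and
    then the real part bounds d. *)
Lemma lin_bound z (K : R) : upper z -> exists B : nat, forall c d : int,
  sqC (c%:~R * z + d%:~R) <= K -> (`|c| <= B)%N /\ (`|d| <= B)%N.
Proof.
rewrite /upper/=; case: z => x y /= y0.
set B1 := K / y ^+ 2; set B2 := 2 * (K + B1 * x ^+ 2).
exists (maxn (Num.truncn B1) (Num.truncn B2)) => c d.
rewrite /sqC !intC /= !(mul0r, subr0, addr0) => h.
have c1 : (c%:~R : R) ^+ 2 <= B1.
  rewrite ler_pdivlMr ?exprn_gt0// -exprMn (le_trans _ h)//.
  by rewrite lerDr sqr_ge0.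
split; rewrite leq_max; apply/orP; [left|right]; first exact: int_sqr_bound.
apply: int_sqr_bound; rewrite /B2.
have h1 : (c%:~R * x + d%:~R) ^+ 2 <= K by rewrite (le_trans _ h)// lerDl sqr_ge0.
have h2 : (c%:~R * x) ^+ 2 <= B1 * x ^+ 2 by rewrite exprMn ler_wpM2r ?sqr_ge0.
(* This square being nonnegative is d^2 <= 2 (c x + d)^2 + 2 (c x)^2. *)
have := sqr_ge0 (c%:~R * x + d%:~R + c%:~R * x); nra.
Qed.

Lemma finite_bounded_int (B : nat) : finite_set [set m : int | (`|m| <= B)%N].
Proof.
apply: (@sub_finite_set _ _ ((fun k : nat => k%:Z - B%:Z) @` `I_(B + B).+1)).
  move=> m /= mB; exists (absz (m + B%:Z)); last by lia.
  by rewrite /=; lia.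
exact/finite_image/finite_II.
Qed.

Lemma finite_bounded_mx2 (B : nat) :
  finite_set [set g : 'M[int]_2 | forall i j, (`|g i j| <= B)%N].
Proof.
pose I := [set m : int | (`|m| <= B)%N].
have fI := finite_bounded_int B.
apply: (@sub_finite_set _ _ ((fun x => mx2 x.1.1 x.1.2 x.2.1 x.2.2) @` ((I `*` I) `*` (I `*` I)))).
  move=> g /= gB; exists ((g 0 0, g 0 1), (g 1 0, g 1 1)); last by rewrite /= -mx2_eta.
  by rewrite /I /=; do !split => /=.
by apply: finite_image; apply: finite_setX; apply: finite_setX.
Qed.

Lemma finite_set_argmin (T : eqType) (A : set T) (f : T -> R) :
  finite_set A -> A !=set0 -> exists2 x, A x & forall y, A y -> f x <= f y.
Proof.
move=> /finite_seqP[s ->] {A}; elim: s => [|a s IH] [x]; first by [].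
move=> _; have [->|s0] := eqVneq s [::].
  by exists a; rewrite /= ?mem_seq1// => y; rewrite /= mem_seq1 => /eqP ->.
have /IH[b /= bs bmin] : [set` s] !=set0.
  by case: s s0 {IH} => // b s _; exists b; rewrite /= mem_head.
have [ab|ba] := leP (f a) (f b).
  exists a; first by rewrite /= mem_head.
  by move=> y /=; rewrite inE => /predU1P[->//|ys]; rewrite (le_trans ab)// bmin.
exists b; first by rewrite /= inE bs orbT.
by move=> y /=; rewrite inE => /predU1P[->|ys]; [exact: ltW|exact: bmin].
Qed.

(** The identity attains the value 1, so only the finitely many bottom rows with |c z + d| <= 1
    compete. Minimising |c z + d| maximises the height on the orbit. *)
Lemma min_autj z : upper z ->
  exists2 g, G g & forall h, G h -> sqC (autj g z) <= sqC (autj h z).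
Proof.
move=> z0; have [B hB] := lin_bound 1 z0.
pose A := [set cd : int * int | (exists2 g, G g & cd = (g 1 0, g 1 1)) /\
  sqC (cd.1%:~R * z + cd.2%:~R) <= 1].
have fA : finite_set A.
  apply: (@sub_finite_set _ _ ([set m : int | (`|m| <= B)%N] `*` [set m : int | (`|m| <= B)%N])).
    by move=> [c d] [_ /= /hB].
  by apply: finite_setX; exact: finite_bounded_int.
have j1 : sqC (0%:~R * z + 1%:~R) = 1 by rewrite mul0r add0r /sqC /= expr1n expr0n addr0.
have A0 : A !=set0.
  exists (0, 1); split => /=; last by rewrite j1.
  by exists 1%:M; [exact: Gamma0_1|rewrite !mxE].
have [[c d] [[g Gg [-> ->]] /= g1] gmin] := finite_set_argmin (fun cd => sqC (cd.1%:~R * z + cd.2%:~R)) fA A0.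
exists g => // h Gh; have [h1|h1] := leP (sqC (autj h z)) 1.
  by apply: (gmin (h 1 0, h 1 1)); split => //=; exists h.
by rewrite (le_trans g1)// ltW.
Qed.

Definition transl (n : int) : 'M[int]_2 := mx2 1 n 0 1.

Lemma Gamma0_transl (m : nat) n : Gamma0 m (transl n).
Proof. by split; rewrite /SL2Z/= ?det2 !mx2E ?mulr0 ?subr0// dvdz0. Qed.

Lemma moebius_transl n z : moebius (transl n) z = z + n%:~R.
Proof. by rewrite /moebius /autj !mx2E mul0r add0r mul1r divr1. Qed.

Lemma Im_act_le p : uhp p -> exists2 g, G g &
  forall h, G h -> (act h p).2 <= (act g p).2.
Proof.
move=> p0; have [g Gg gmin] := min_autj (p0 : upper (toC p)).
exists g => // h Gh; rewrite /act/=.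
have dg := Gamma0_det Gg; have dh := Gamma0_det Gh.
rewrite !Im_moebius ?dg ?dh// ?oner_eq0// mul1r.
rewrite ler_wpM2l ?(ltW p0)// lef_pV2 ?gmin// posrE sqC_gt0 autj_neq0 ?dg ?dh ?oner_eq0//.
Qed.

Lemma int_translate (x : R) : exists n : int, `|x + n%:~R| <= 2^-1.
Proof.
exists (- Num.floor (x + 2^-1)).
have /andP[] := floor_itv (x + 2^-1); move: (Num.floor _) => m h1.
rewrite intrD mulrNz ler_norml => h2; apply/andP; split; lra.
Qed.

(** Move to a highest point of the orbit, then translate it into the strip |x| <= 1/2; translations
    keep the height. *)
Lemma fund_domain_exists p : uhp p -> exists2 g, G g & F (act g p).
Proof.
move=> p0; have [g Gg gmax] := Im_act_le p0.
have dg := Gamma0_det_gt0 Gg.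
have q0 := act_uhp dg p0; set q := act g p in q0 gmax *.
have [n n1] := int_translate q.1.
have Gn := Gamma0_transl N n.
exists (transl n *m g); first exact: Gamma0M.
rewrite actM//; last by rewrite (Gamma0_det Gn) oner_eq0.
rewrite -/q.
have qE : act (transl n) q = (q.1 + n%:~R, q.2).
  by rewrite /act moebius_transl /ofC /toC intC /= addr0.
rewrite {1}qE; split; rewrite ?qE; [exact: q0|exact: n1|].
  move=> h Gh; rewrite -[X in _ <= X]/((q.1 + n%:~R, q.2).2) -qE.
  have -> : complex.Im (moebius h (toC (act (transl n) q))) = (act h (act (transl n) q)).2 by [].
  rewrite -actM//; last by rewrite (Gamma0_det Gh) oner_eq0.
  rewrite -actM//; last by rewrite det_mulmx (Gamma0_det Gh) (Gamma0_det Gn) oner_eq0.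
  rewrite (_ : (act (transl n) q).2 = q.2); last by rewrite qE.
  by apply: gmax; exact: Gamma0M (Gamma0M Gh Gn) Gg.
by rewrite (Gamma0_det Gn).
Qed.

Definition orbit_hits p := [set g | G g /\ F (act g p)].

Lemma act_Gamma0 h g p : G h -> G g -> uhp p -> act (h *m g) p = act h (act g p).
Proof.
by move=> Gh Gg p0; rewrite actM// ?(Gamma0_det Gh) ?(Gamma0_det Gg) ?oner_eq0.
Qed.

Lemma fund_domain_Im_le g h p : uhp p -> G g -> G h -> F (act g p) ->
  (act h p).2 <= (act g p).2.
Proof.
move=> p0 Gg Gh [_ _ /(_ (h *m adj2 g))].
have -> : complex.Im (moebius (h *m adj2 g) (toC (act g p))) = (act (h *m adj2 g) (act g p)).2 by [].
have Ga := Gamma0_adj Gg.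
rewrite -(act_Gamma0 (Gamma0M Gh Ga) Gg p0) -mulmxA (mul_adj_Gamma0 Gg) mulmx1.
by apply; exact: Gamma0M.
Qed.

(** All hits share the maximal height Y, so |c p + d|^2 = p.2 / Y bounds the bottom row. The top row
    satisfies a p + b = (g p)(c p + d), where |g p|^2 <= 1/4 + Y^2 because g p lies in the strip. *)
Lemma finite_orbit_hits p : uhp p -> finite_set (orbit_hits p).
Proof.
move=> p0; have [h Gh Fh] := fund_domain_exists p0.
have Y0 := fund_domain_uhp Fh; set Y := (act h p).2; rewrite /uhp/= -/Y in Y0.
pose K := p.2 / Y.
have [B1 hB1] := lin_bound K (p0 : upper (toC p)).
have [B2 hB2] := lin_bound ((1 + Y ^+ 2) * K) (p0 : upper (toC p)).
apply: (@sub_finite_set _ _ [set g : 'M[int]_2 | forall i j, (`|g i j| <= maxn B1 B2)%N]); last first.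
  exact: finite_bounded_mx2.
move=> g [Gg Fg] /=; have dg := Gamma0_det Gg.
have gY : (act g p).2 <= Y by exact: fund_domain_Im_le.
have Yg : Y <= (act g p).2 by exact: fund_domain_Im_le.
have j0 : 0 < sqC (autj g (toC p)) by rewrite sqC_gt0 autj_neq0// dg oner_eq0.
have gE : (act g p).2 = p.2 / sqC (autj g (toC p)).
  by rewrite /act/= Im_moebius ?dg ?oner_eq0// mul1r.
have jK : sqC (autj g (toC p)) <= K.
  by rewrite /K ler_pdivlMr// mulrC -ler_pdivlMr// -gE.
have [c1 d1] := hB1 _ _ jK.
have : sqC ((g 0 0)%:~R * toC p + (g 0 1)%:~R) <= (1 + Y ^+ 2) * K.
  have -> : (g 0 0)%:~R * toC p + (g 0 1)%:~R = toC (act g p) * autj g (toC p).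
    by rewrite /act ofCK /moebius divfK// -sqC_eq0 gt_eqF.
  rewrite sqCM ler_pM ?sqC_ge0// /sqC /= lerD//.
    case: Fg => _ + _; rewrite /act /=; set x := complex.Re _.
    by rewrite ler_norml => /andP[]; nra.
  by rewrite ler_sqr// nnegrE ltW// ?(fund_domain_uhp Fg).
move=> /hB2[a2 b2].
by move=> i j; elim/ord2P: i; elim/ord2P: j; rewrite leq_max ?c1 ?d1 ?a2 ?b2 ?orbT.
Qed.

Local Open Scope ereal_scope.

Definition hits p : \bar R := \esum_(g in G) (\1_F (act g p))%:E.

Lemma hitsE p : hits p = \esum_(g in orbit_hits p) 1.
Proof.
rewrite /hits /orbit_hits (_ : [set g | _] = G `&` [set g | F (act g p)])// [RHS]esum_mkcondr.
apply: eq_esum => g Gg; rewrite indicE.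
case: ifPn => [|/negP]; rewrite inE/= => h; first by rewrite (mem_set h).
by rewrite (memNset h).
Qed.

Lemma hits_fsum p : uhp p -> hits p = \sum_(g \in orbit_hits p) (1%R : R)%:E.
Proof. by move=> p0; rewrite hitsE esum_fset//; exact: finite_orbit_hits. Qed.

Lemma hits_fin p : uhp p -> hits p \is a fin_num.
Proof.
move=> p0; rewrite hits_fsum// fsbig_finite; last exact: finite_orbit_hits.
by apply/sum_fin_numP => *.
Qed.

Lemma hits_ge1 p : uhp p -> 1 <= hits p.
Proof.
move=> p0; have [h Gh Fh] := fund_domain_exists p0.
rewrite hitsE; apply: esum_ge; exists [set h].
  by split; [exact: finite_set1|move=> _ ->].
by rewrite fsbig_set1.
Qed.

Lemma Gamma0_mulr_bij h : G h -> set_bij G G (mulmx^~ h).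
Proof.
move=> Gh; split.
- by move=> g Gg; exact: Gamma0M.
- by move=> g g' _ _ e; rewrite -[g]mulmx1 -(mul_Gamma0_adj Gh) mulmxA e -mulmxA (mul_Gamma0_adj Gh) mulmx1.
- move=> g Gg; exists (g *m adj2 h); first exact: Gamma0M Gg (Gamma0_adj Gh).
  by rewrite -mulmxA (mul_adj_Gamma0 Gh) mulmx1.
Qed.

Lemma hits_act h p : G h -> uhp p -> hits (act h p) = hits p.
Proof.
move=> Gh p0; rewrite [RHS]/hits (reindex_esum _ _ _ _ (Gamma0_mulr_bij Gh)).
by apply: eq_esum => g Gg; rewrite act_Gamma0.
Qed.

(* [F] may meet an orbit several times; dividing by the number of hits makes
   the weights of the translates of a point sum to one. *)
Definition fwt p : R := (\1_F p / fine (hits p))%R.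

Lemma fine_hits_ge1 p : uhp p -> (1 <= fine (hits p))%R.
Proof. by move=> p0; rewrite -lee_fin fineK ?hits_fin// hits_ge1. Qed.

Lemma hits_ge0 p : 0 <= hits p.
Proof. by apply: esum_ge0 => g _; rewrite lee_fin. Qed.

Lemma fwt_ge0 p : (0 <= fwt p)%R.
Proof. by rewrite /fwt divr_ge0// fine_ge0// hits_ge0. Qed.

Lemma esum_fwt p : uhp p -> \esum_(g in G) (fwt (act g p))%:E = 1.
Proof.
move=> p0; have h1 := fine_hits_ge1 p0.
transitivity (\esum_(g in orbit_hits p) (1 * ((fine (hits p))^-1)%:E)).
  rewrite /orbit_hits (_ : [set g | _] = G `&` [set g | F (act g p)])// [RHS]esum_mkcondr.
  apply: eq_esum => g Gg; rewrite /fwt hits_act// indicE.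
  case: ifPn => [|/negP]; rewrite inE/= => h; first by rewrite (mem_set h) mul1r mul1e.
  by rewrite (memNset h) mul0r.
rewrite esum_fset; last 2 first.
- exact: finite_orbit_hits.
- by move=> i _; rewrite mul1e lee_fin invr_ge0 (le_trans _ h1).
rewrite -ge0_mule_fsuml// -hits_fsum// -[X in X * _]fineK ?hits_fin//.
by rewrite -EFinM divff// gt_eqF// (lt_le_trans _ h1).
Qed.

Lemma measurable_fund_domain : measurable F.
Proof.
pose E (g : 'M[int]_2) := [set p : R * R | G g -> ((act g p).2 <= p.2)%R] `&` uhp.
have mE g : measurable (E g).
  have [Gg|nGg] := pselect (G g); last first.
    rewrite (_ : E g = uhp); first exact: measurable_uhp.
    by apply/seteqP; split => [p []//|p p0]; split.
  rewrite (_ : E g = uhp `&` [set p | ((act g p).2 <= p.2)%R]); last first.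
    by apply/seteqP; split => p [h1 h2]; split=> //; exact: h1.
  apply: measurable_fun_ler => //.
  - apply: (measurableT_comp measurable_snd); exact: measurable_act (Gamma0_det_gt0 Gg).
  - by apply: measurable_funTS; exact: measurable_snd.
  - exact: measurable_uhp.
rewrite (_ : F = (uhp `&` [set p : R * R | (`|p.1| <= 2^-1)%R]) `&`
    ~` (\bigcup_g (~` E g))); last first.
  rewrite setC_bigcup; apply/seteqP; split => p.
    move=> [p0 p1 p2]; split; first by [].
    by move=> g _; rewrite setCK; split => // /p2.
  by move=> [[p0 p1] p2]; split => // g Gg; have := p2 g Logic.I; rewrite setCK => -[/(_ Gg)].
apply: measurableI.
  apply: measurable_fun_ler => //; last exact: measurable_uhp.
  by apply: measurable_funTS; apply: measurableT_comp => //.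
apply: measurableC; apply: countable_bigcupT_measurable; first exact: countableP.
by move=> g; exact: measurableC.
Qed.

Lemma measurable_hits : measurable_fun uhp hits.
Proof.
apply: measurable_fun_esum.
- move=> g Gg; apply: (measurable_comp_act (Gamma0_det_gt0 Gg) (phi := fun p => (\1_F p)%:E)).
  apply/measurable_EFinP/measurable_funTS; exact: measurable_indic measurable_fund_domain.
- by move=> g p; rewrite lee_fin.
Qed.

Lemma measurable_fwt : measurable_fun uhp fwt.
Proof.
apply: measurable_funM.
  by apply/measurable_funTS; exact: measurable_indic measurable_fund_domain.
apply: (measurableT_comp (@measurable_invr R)).
apply: measurableT_comp => //; exact: measurable_hits.
Qed.

Lemma area_null_of_sections (A : set (R * R)) : measurable A ->
  (forall y, countable [set x | A (x, y)]) -> (@area R).-negligible A.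
Proof.
move=> mA cA; exists A; split => //.
transitivity (\int[@area R]_p (\1_A p)%:E); first by rewrite integral_indic// setIT.
rewrite /area.
rewrite fubini_tonelli2//; last exact/measurable_EFinP/measurable_indic.
apply: integral0_eq => y _; rewrite /fubini_G.
transitivity (\int[lebesgue_measure]_x (\1_[set x | A (x, y)] x)%:E).
  by apply: eq_integral => x _; rewrite !indicE; congr (_%:R%:E); apply/idP/idP; rewrite !inE.
have my : measurable [set x | A (x, y)].
  have := measurable_ysection y mA; congr measurable.
  by apply/seteqP; split => x /=; rewrite /ysection/= inE.
rewrite integral_indic// setIT; exact: countable_lebesgue_measure0.
Qed.

(** The curves on which boundary identifications of the Ford domain can occur: the circles |c z + d|
    = 1 with c <> 0 and the lines x = 1/2 and x = -1/2. Their horizontal sections are finite, hence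
    they are null sets. *)
Definition ford_edges (g : 'M[int]_2) : set (R * R) :=
  [set p | ((g 1 0)%R != 0%R /\ sqC (autj g (toC p)) = 1)%R \/ ((2 * p.1) ^+ 2 = 1)%R].

Lemma finite_sqr_eq (a : R) : finite_set [set x : R | (x ^+ 2 = a)%R].
Proof.
apply: (@sub_finite_set _ _ [set Num.sqrt a; (- Num.sqrt a)%R]); last exact: finite_set2.
move=> x /= xa; have : ((Num.sqrt a) ^+ 2 = x ^+ 2)%R by rewrite sqr_sqrtr// -xa sqr_ge0.
by move/eqP; rewrite eqf_sqr => /orP[|] /eqP ->; [left|right; rewrite opprK].
Qed.

Lemma finite_affine_sqr_eq (a c d : R) : c != 0%R -> finite_set [set x : R | ((c * x + d) ^+ 2 = a)%R].
Proof.
move=> c0; apply: (@sub_finite_set _ _ ((fun t => (t - d) / c)%R @` [set x : R | (x ^+ 2 = a)%R])).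
  by move=> x /= xa; exists (c * x + d)%R => //; field.
exact/finite_image/finite_sqr_eq.
Qed.

Lemma sqC_autj g p : sqC (autj g (toC p)) =
  (((g 1%R 0%R)%:~R * p.1 + (g 1%R 1%R)%:~R) ^+ 2 + ((g 1%R 0%R)%:~R * p.2) ^+ 2)%R.
Proof. by rewrite /sqC /autj !intC /=; congr (_ ^+ 2 + _ ^+ 2)%R; ring. Qed.

Lemma negligible_ford_edges g : (@area R).-negligible (ford_edges g).
Proof.
apply: area_null_of_sections; last first.
  move=> y; apply: finite_set_countable.
  rewrite (_ : [set x | _] = [set x | ((g 1 0)%R != 0%R /\ sqC (autj g (toC (x, y))) = 1)%R] `|`
    [set x | (2 * x + 0) ^+ 2 = 1]%R); last first.
    by apply/seteqP; split => x; rewrite /ford_edges /= addr0.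
  rewrite finite_setU; split; last exact: finite_affine_sqr_eq.
  have [g0|g0] := eqVneq (g 1 0)%R 0%R.
    by rewrite (_ : [set _ | _] = set0)// -subset0 => x [].
  apply: sub_finite_set (@finite_affine_sqr_eq (1 - ((g 1%R 0%R)%:~R * y) ^+ 2)%R
     (g 1%R 0%R)%:~R (g 1%R 1%R)%:~R _); last by rewrite intr_eq0.
  by move=> x /= [_]; rewrite sqC_autj /=; lra.
have mx : measurable_fun setT (fun p : R * R => sqC (autj g (toC p))).
  rewrite (_ : (fun p => _) = fun p : R * R => (((g 1%R 0%R)%:~R * p.1 + (g 1%R 1%R)%:~R) ^+ 2 + ((g 1%R 0%R)%:~R * p.2) ^+ 2)%R); last first.
    by apply/funext => p; rewrite sqC_autj.
  apply: measurable_funD; apply: measurable_funX; first apply: measurable_funD => //; exact: measurable_funM.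
have m2 : measurable_fun setT (fun p : R * R => ((2 * p.1) ^+ 2)%R).
  by apply: measurable_funX; exact: measurable_funM.
rewrite (_ : ford_edges g = ((setT `&` (fun p => sqC (autj g (toC p))) @^-1` [set 1%R]) `&` (if (g 1 0)%R != 0%R then setT else set0)) `|`
  (setT `&` (fun p => ((2 * p.1) ^+ 2)%R) @^-1` [set 1%R])); last first.
  apply/seteqP; split => p.
    by case=> [[g0 h]|h]; [left; split; rewrite ?g0|right].
  by case=> [[[_ h]]|[_ h]]; [case: ifP => // g0 _; left; split|right].
apply: measurableU; last exact: m2.
apply: measurableI; first exact: mx.
by case: ifP.
Qed.

Lemma fund_domain_transl g p : g 1%R 0%R = 0%R -> g 0%R 0%R = 1%R -> g 1%R 1%R = 1%R ->
  F p -> F (act g p) -> g = 1%:M \/ ((2 * p.1) ^+ 2 = 1)%R.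
Proof.
move=> c0 a1 d1 Fp Fg; have [b0|b0] := eqVneq (g 0 1)%R 0%R.
  by left; apply: mx2_eq; rewrite !mxE /= ?c0 ?a1 ?d1 ?b0.
right; move: Fp Fg; rewrite /act /moebius /autj c0 a1 d1 mul0r add0r mul1r divr1 intC.
case=> _ + _ [_ + _]; rewrite /ofC /toC/=.
have : ((1 <= (g 0 1)%:~R :> R) \/ ((g 0 1)%:~R <= -1 :> R))%R.
  have [h|h] := leP 1%R (g 0%R 1%R); [left|right]; first by rewrite ler1z.
  by rewrite -(mulrN1z 1) ler_int; lia.
rewrite !ler_norml; move: (_%:~R)%R p.1 => b x hb /andP[h1 h2] /andP[h3 h4].
have : (x = 2^-1 \/ x = - 2^-1)%R by case: hb => ?; [right|left]; lra.
by case=> ->; field.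
Qed.

(** The two hits are the identity and its negative. Two hits have equal height, so |c p + d| = 1,
    which off the circles forces c = 0; the remaining translations are trivial unless they exchange
    the lines x = 1/2 and x = -1/2. *)
Lemma hits_eq2 p : F p -> ~ (\bigcup_g ford_edges g) p -> hits p = 2%:E.
Proof.
move=> Fp nE; have p0 := fund_domain_uhp Fp.
have nline : ((2 * p.1) ^+ 2 <> 1)%R by move=> h; apply: nE; exists 1%:M => //; right.
have I1 : (1%:M : 'M[int]_2) <> (- 1%:M)%R.
  by move=> /matrixP /(_ 0%R 0%R); rewrite !mxE /=.
rewrite hitsE (_ : orbit_hits p = [set 1%:M; (- 1%:M)%R]); last first.
  apply/seteqP; split => g; last first.
    case=> ->; split; rewrite ?actN ?act1//; first exact: Gamma0_1.
    exact/Gamma0N/Gamma0_1.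
  move=> [Gg Fg]; have dg := Gamma0_det Gg.
  have Ie : (act g p).2 = p.2.
    apply/eqP; rewrite eq_le; apply/andP; split.
      by have := fund_domain_Im_le p0 (Gamma0_1 N) Gg; rewrite act1; exact.
    by have := fund_domain_Im_le p0 Gg (Gamma0_1 N) Fg; rewrite act1.
  have [c0|c0] := eqVneq (g 1 0)%R 0%R; last first.
    exfalso; apply: nE; exists g => //; left; split => //.
    have j0 : (sqC (autj g (toC p)) != 0)%R by rewrite sqC_eq0 autj_neq0// dg oner_eq0.
    move: Ie; rewrite /act/= Im_moebius ?dg ?oner_eq0// mul1r => /eqP.
    rewrite [complex.Im _]/= -[X in _ == X]divr1 eqr_div ?oner_eq0// mulr1 => /eqP.
    by rewrite -[LHS]mulr1 => /(mulfI (lt0r_neq0 p0)).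
  have ad : (g 0 0 * g 1 1 = 1)%R by move: dg; rewrite det2 c0 mulr0 subr0.
  have {ad} [/= [a1 d1]|[a1 d1]] : (g 0 0 = 1 /\ g 1 1 = 1)%R \/ (g 0 0 = -1 /\ g 1 1 = -1)%R.
    have := congr1 absz ad; rewrite abszM => /eqP; rewrite muln_eq1 => /andP[/eqP a1 /eqP d1].
    have [aE|aE] : (g 0 0 = 1 \/ g 0 0 = -1)%R by lia.
      by left; move: ad; rewrite aE; lia.
    by right; move: ad; rewrite aE; lia.
  - by left; case: (fund_domain_transl c0 a1 d1 Fp Fg).
  - right; rewrite -[g]opprK; congr (- _)%R.
    have Fg' : F (act (- g)%R p) by rewrite actN.
    by case: (@fund_domain_transl (- g)%R p _ _ _ Fp Fg'); rewrite ?mxE ?c0 ?a1 ?d1 ?oppr0 ?opprK.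
rewrite esum_fset; [|exact: finite_set2|by []].
rewrite fsbigU//= ?fsbig_set1; last by move=> x [-> e]; case: I1.
by rewrite -EFinD.
Qed.

(** [fwt] is almost everywhere half the indicator of the domain, since -1 acts trivially; hence the
    factor 2. The right-hand side is an integral over the whole half-plane, the form that can be
    unfolded. *)
Lemma ge0_integral_fund_domain (phi : R * R -> \bar R) :
  measurable_fun uhp phi -> (forall p, 0 <= phi p) ->
  \int[@area R]_(p in F) (phi p * (p.2 ^- 2)%:E) =
  2%:E * hyp (fun p => (fwt p)%:E * phi p).
Proof.
move=> mphi phi0.
have mm : measurable_fun uhp (fun p : R * R => (p.2 ^- 2)%:E).
  apply/measurable_EFinP/measurable_funTS.
  apply: (measurableT_comp (@measurable_invr R)); exact: measurable_funX.
have w0 p : 0 <= (fwt p)%:E by rewrite lee_fin fwt_ge0.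
have y0 (p : R * R) : 0 <= (p.2 ^- 2)%:E by rewrite lee_fin invr_ge0 sqr_ge0.
have mw : measurable_fun uhp (fun p => (fwt p)%:E) by apply/measurable_EFinP; exact: measurable_fwt.
rewrite /hyp -ge0_integralZl_EFin//; last 3 first.
- exact: measurable_uhp.
- by move=> p _; rewrite !mule_ge0.
- by do 2 apply: emeasurable_funM => //.
rewrite [LHS]integral_mkcond [RHS]integral_mkcond.
apply: ge0_ae_eq_integral => //.
- apply/(measurable_restrictT _ measurable_fund_domain).
  apply: (@measurable_funS _ _ _ _ uhp); first exact: measurable_uhp.
    by move=> p; exact: fund_domain_uhp.
  exact: emeasurable_funM.
- apply/(measurable_restrictT _ measurable_uhp).
  by apply: emeasurable_funM => //; do 2 apply: emeasurable_funM => //.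
- by move=> p _; rewrite patchE; case: ifP => // _; rewrite mule_ge0.
- by move=> p _; rewrite patchE; case: ifP => // _; rewrite !mule_ge0.
have nE : (@area R).-negligible (\bigcup_g ford_edges g).
  pose e n := if pickle_inv n is Some g then ford_edges g else set0.
  rewrite (_ : \bigcup_g _ = \bigcup_n e n).
    by apply: negligible_bigcup => n; rewrite /e; case: pickle_inv => [g|]; [exact: negligible_ford_edges|exact: negligible_set0].
  apply/seteqP; split => p [n _].
    by move=> h; exists (pickle n) => //; rewrite /e pickleK_inv.
  by rewrite /e; case: pickle_inv => // g h; exists g.
apply: negligibleS nE => p /= h; apply: contrapT => np; apply: h => _.
rewrite !patchE; case: ifPn => [|/negP]; rewrite inE => Fp.
  rewrite mem_set; last exact: fund_domain_uhp.
  by rewrite !muleA /fwt indicE mem_set// hits_eq2//= -EFinM mul1r divff// mul1e.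
case: ifP => // _; rewrite /fwt indicE memNset// mul0r !mul0e mule0//.
Qed.
End Ford.

(** * Correspondences and the Petersson product *)

Section EsumMore.
Local Open Scope ereal_scope.
Context (R : realType).

Lemma esum_fin (I : finType) (a : I -> \bar R) : (forall i, 0 <= a i) ->
  \esum_(i in [set: I]) a i = \sum_i a i.
Proof.
move=> a0; rewrite esum_fset//; last exact: finite_finset.
rewrite (_ : [set: I] = [set` index_enum I]); last first.
  by apply/seteqP; split => i //= _; rewrite mem_index_enum.
by rewrite -fsbig_seq// index_enum_uniq.
Qed.

Lemma esumZr (I : countType) (A : set I) (a : I -> \bar R) (c : R) :
  (forall i, 0 <= a i) -> (0 <= c)%R ->
  \esum_(i in A) (a i * c%:E) = (\esum_(i in A) a i) * c%:E.
Proof.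
move=> a0 c0; rewrite esum_mkcond [in RHS]esum_mkcond !esum_pickle; last 2 first.
- by move=> i; case: ifP.
- by move=> i; case: ifP => // _; rewrite mule_ge0.
rewrite muleC -nneseriesZl; last by move=> n _; case: (pickle_inv n) => //= i; case: ifP.
apply: eq_eseriesr => n _; case: (pickle_inv n) => [i|] /=; last by rewrite mule0.
by case: ifP => _; rewrite ?mule0// muleC.
Qed.

Lemma hyp_esum (I : countType) (A : set I) (f : I -> R * R -> \bar R) :
  (forall i, A i -> measurable_fun uhp (f i)) -> (forall i p, 0 <= f i p) ->
  hyp (fun p => \esum_(i in A) f i p) = \esum_(i in A) hyp (f i).
Proof.
move=> mf f0; rewrite /hyp -ge0_integral_esum; last 3 first.
- exact: measurable_uhp.
- move=> i Ai; apply: emeasurable_funM; first exact: mf.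
  apply/measurable_EFinP/measurable_funTS.
  apply: (measurableT_comp (@measurable_invr R)); exact: measurable_funX.
- by move=> i p; rewrite mule_ge0// lee_fin invr_ge0 sqr_ge0.
apply: eq_integral => p _; rewrite esumZr// invr_ge0 sqr_ge0//.
Qed.
End EsumMore.

Section ComplexMeasurable.
Variable R : realType.
Implicit Types f g : R[i] -> R[i].

Definition cmeas f := measurable_fun uhp (fun p : R * R => complex.Re (f (toC p))) /\
  measurable_fun uhp (fun p : R * R => complex.Im (f (toC p))).

Lemma eq_cmeas f g : (forall z, upper z -> f z = g z) -> cmeas f -> cmeas g.
Proof.
move=> fg [h1 h2]; split.
  by apply: eq_measurable_fun h1 => p /[!inE] p0; rewrite fg.
by apply: eq_measurable_fun h2 => p /[!inE] p0; rewrite fg.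
Qed.

Lemma cmeas_cst c : cmeas (fun=> c).
Proof. by split; exact: measurable_cst. Qed.

Lemma cmeas_id : cmeas id.
Proof. by split; apply: measurable_funTS; [exact: measurable_fst|exact: measurable_snd]. Qed.

Lemma cmeasD f g : cmeas f -> cmeas g -> cmeas (fun z => f z + g z).
Proof.
move=> [f1 f2] [g1 g2]; split.
  by apply: eq_measurable_fun (measurable_funD f1 g1) => p _; rewrite /= raddfD.
by apply: eq_measurable_fun (measurable_funD f2 g2) => p _; rewrite /= raddfD.
Qed.

Lemma cmeasM f g : cmeas f -> cmeas g -> cmeas (fun z => f z * g z).
Proof.
move=> [f1 f2] [g1 g2]; split.
  apply: eq_measurable_fun (measurable_funB (measurable_funM f1 g1) (measurable_funM f2 g2)) => p _ /=.
  by case: (f _) => a b; case: (g _).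
apply: eq_measurable_fun (measurable_funD (measurable_funM f1 g2) (measurable_funM f2 g1)) => p _ /=.
by case: (f _) => a b; case: (g _) => c d /=; ring.
Qed.

Lemma measurable_sqC f : cmeas f -> measurable_fun uhp (fun p : R * R => sqC (f (toC p))).
Proof.
by move=> [f1 f2]; apply: measurable_funD; apply: measurable_funX.
Qed.

Lemma cmeasV f : cmeas f -> cmeas (fun z => (f z)^-1).
Proof.
move=> mf; have mi := measurableT_comp (@measurable_invr R) (measurable_sqC mf).
case: mf => f1 f2; split.
  apply: eq_measurable_fun (measurable_funM f1 mi) => p _ /=.
  by rewrite /sqC; case: (f _).
apply: eq_measurable_fun (measurable_funN (measurable_funM f2 mi)) => p _ /=.
by rewrite /sqC; case: (f _).
Qed.

Lemma cmeasX f n : cmeas f -> cmeas (fun z => f z ^+ n).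
Proof.
move=> mf; elim: n => [|n IH]; first exact: cmeas_cst.
by apply: eq_cmeas (cmeasM mf IH) => z _; rewrite exprS.
Qed.

Lemma cmeas_sum n (f : 'I_n -> R[i] -> R[i]) : (forall i, cmeas (f i)) ->
  cmeas (fun z => \sum_i f i z).
Proof.
elim: n f => [|n IH] f mf.
  by apply: eq_cmeas (cmeas_cst 0) => z _; rewrite big_ord0.
have := cmeasD (mf ord0) (IH _ (fun i => mf (lift ord0 i))).
by apply: eq_cmeas => z _; rewrite big_ord_recl.
Qed.

Lemma cmeas_moebius f (g : 'M[int]_2) : 0 < \det g -> cmeas f -> cmeas (fun z => f (moebius g z)).
Proof.
move=> dg [f1 f2].
have H (u : R * R -> R) : measurable_fun uhp u -> measurable_fun uhp (u \o act g).
  move=> mu; apply: (measurable_comp (@measurable_uhp R)) => //.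
  - by move=> _ [p p0 <-]; exact: act_uhp.
  - exact: measurable_act.
by split; [apply: eq_measurable_fun (H _ f1)|apply: eq_measurable_fun (H _ f2)] => p _;
  rewrite /= /act ofCK.
Qed.

Lemma cmeas_slash k f (g : 'M[int]_2) : 0 < \det g -> cmeas f -> cmeas (slash k f g).
Proof.
move=> dg mf; apply: cmeasM; last exact: cmeas_moebius.
apply: cmeasV; apply: cmeasX; apply: cmeasD; last exact: cmeas_cst.
by apply: cmeasM; [exact: cmeas_cst|exact: cmeas_id].
Qed.
End ComplexMeasurable.

(** * Unfolding a double coset from both sides *)

Section Correspondence.
Variables (R : realType) (k l : nat).
Hypothesis kl : k = (l + l)%N.
Implicit Types (f g : R[i] -> R[i]) (d : 'M[int]_2) (p : R * R).

Definition modular (N : nat) f := forall (g : 'M[int]_2) z, Gamma0 N g -> upper z -> slash k f g z = f z.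

(** [slash] carries no power of the determinant; det^l with l = k / 2 restores the normalisation
    under which d and its adjugate act inversely to each other. The forms are added rather than
    multiplied so that the density stays nonnegative. *)
Definition corr_term f g d p : R :=
  sqC ((\det d)%:~R ^+ l * slash k f d (toC p) + g (toC p)) * p.2 ^+ k.

Lemma measurable_corr_term f g d : 0 < \det d -> cmeas f -> cmeas g ->
  measurable_fun uhp (corr_term f g d).
Proof.
move=> dd mf mg; apply: measurable_funM.
  apply: (measurable_sqC (f := fun z => (\det d)%:~R ^+ l * slash k f d z + g z)).
  by apply: cmeasD => //; apply: cmeasM; [exact: cmeas_cst|exact: cmeas_slash].
apply: measurable_funTS; exact: measurable_funX.
Qed.

(** [d *m adj2 d] is the scalar det, which acts trivially and slashes by det^(-2l); the automorphy
    factor that is left over is absorbed by y^k. *)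
Lemma corr_term_flip f g d p : 0 < \det d -> uhp p ->
  corr_term f g d (act (adj2 d) p) = corr_term g f (adj2 d) p.
Proof.
move=> dd p0; have z0 : upper (toC p) by [].
have dn0 := lt0r_neq0 dd.
have da : 0 < \det (adj2 d) by rewrite det_adj2.
have j0 := autj_neq0 (lt0r_neq0 da) z0.
have nC : (\det d)%:~R != 0 :> R[i] by rewrite intr_eq0.
have := slashM k f da dn0 z0; rewrite mul_adj2 slash_scalar// {1}/slash => e1.
have e2 : g (moebius (adj2 d) (toC p)) = autj (adj2 d) (toC p) ^+ k * slash k g (adj2 d) (toC p).
  by rewrite /slash mulVKf// expf_neq0.
have {}e1 : slash k f d (moebius (adj2 d) (toC p)) =
    autj (adj2 d) (toC p) ^+ k * ((\det d)%:~R ^- k * f (toC p)).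
  by rewrite -e1 mulVKf// expf_neq0.
rewrite /corr_term /act ofCK e1 e2 [(ofC _).2]/= Im_moebius ?lt0r_neq0// det_adj2.
set j := autj _ _; set s := slash _ _ _ _; set n : int := \det d.
have -> : n%:~R ^+ l * (j ^+ k * (n%:~R ^- k * f (toC p))) + j ^+ k * s =
   j ^+ k * (n%:~R ^- l * (n%:~R ^+ l * s + f (toC p))).
  have := expf_neq0 l nC; rewrite -/n [in n%:~R ^- k]kl exprD.
  by move: (j ^+ k) (n%:~R ^+ l) => u v v0; field.
rewrite !sqCM sqCX sqCV sqCX intC sqC_real /=.
have nR : n%:~R != 0 :> R by rewrite intr_eq0.
have sj : sqC j != 0 by rewrite sqC_eq0.
have -> : (n%:~R ^+ 2 : R) ^+ l = n%:~R ^+ k by rewrite -exprM mul2n -addnn -kl.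
rewrite (exprMn _ _ (sqC j)^-1) (exprMn _ n%:~R) exprVn.
have := expf_neq0 k nR; have := expf_neq0 k sj.
by move: (sqC j ^+ k) (n%:~R ^+ k) (p.2 ^+ k) (sqC _) => u v w x u0 v0; field; rewrite u0 v0.
Qed.

(** One weight sits at p for level N2 and one at d p for level N1, so that the expression is
    symmetric under passing to adjugates. Summing over the left cosets of Gamma0(N1) removes the
    second weight. *)
Definition corr_sum (N1 N2 : nat) (D : set 'M[int]_2) f g : \bar R :=
  (\esum_(d in D) hyp (fun p => ((fwt N2 p)%:E * (fwt N1 (act d p))%:E) *
     `|corr_term f g d p|%:E))%E.

Local Open Scope ereal_scope.

Lemma corr_sum_flip N1 N2 (D : set 'M[int]_2) f g :
  (forall d, D d -> (0 < \det d)%R) -> cmeas f -> cmeas g ->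
  corr_sum N1 N2 D f g = corr_sum N2 N1 (@adj2 _ @` D) g f.
Proof.
move=> dD mf mg; rewrite /corr_sum esum_image; last by move=> x y _ _; exact: (can_inj (@adj2K _)).
apply: eq_esum => d Dd; have dd := dD _ Dd.
have da : (0 < \det (adj2 d))%R by rewrite det_adj2.
rewrite -(hyp_act da); last 2 first.
- apply: emeasurable_funM; last first.
    apply/measurable_EFinP; apply: measurableT_comp => //; exact: measurable_corr_term.
  apply: emeasurable_funM; first by apply/measurable_EFinP; exact: measurable_fwt.
  apply: (measurable_comp_act dd (phi := fun p => (fwt N1 p)%:E)).
  by apply/measurable_EFinP; exact: measurable_fwt.
- by move=> p; rewrite !mule_ge0// lee_fin fwt_ge0.
apply: eq_hyp => p p0 /=; rewrite corr_term_flip//.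
have -> : act d (act (adj2 d) p) = p.
  rewrite -actM// ?lt0r_neq0// mul_adj2 /act moebius_scalar ?toCK// lt0r_neq0//.
by rewrite [X in X * _]muleC.
Qed.

Lemma corr_term_mulG N f g h d p : Gamma0 N h -> modular N f -> (0 < \det d)%R -> uhp p ->
  corr_term f g (h *m d) p = corr_term f g d p.
Proof.
move=> Gh mf dd p0; rewrite /corr_term det_mulmx (Gamma0_det Gh) mul1r.
rewrite -slashM// ?(Gamma0_det Gh) ?oner_eq0//.
rewrite {1}/slash mf//; exact: upper_moebius.
Qed.

(** Modularity of f makes the term constant along each coset Gamma0(N1) r_i, and the weights of the
    translates of r_i p sum to 1. *)
Lemma corr_sum_unfold (I : finType) (r : I -> 'M[int]_2) N1 N2 (D : set 'M[int]_2) f g :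
  (0 < N1)%N ->
  (forall d, D d -> (0 < \det d)%R) ->
  set_bij ([set: I] `*`` (fun=> Gamma0 N1)) D (fun x => x.2 *m r x.1) ->
  cmeas f -> cmeas g -> modular N1 f ->
  corr_sum N1 N2 D f g =
  \sum_i hyp (fun p => (fwt N2 p)%:E * `|corr_term f g (r i) p|%:E).
Proof.
move=> N10 dD bD mf mg modf.
have rD i : D (r i).
  have [h _ _] := bD; have := h (i, 1%:M); rewrite mul1mx; apply.
  by split => //; exact: Gamma0_1.
have dr i := dD _ (rD i).
have w0 N p : 0 <= (fwt N p : R)%:E by rewrite lee_fin fwt_ge0.
have mw N : measurable_fun uhp (fun p => (fwt N p : R)%:E).
  by apply/measurable_EFinP; exact: measurable_fwt.
have mc i : measurable_fun uhp (fun p => `|corr_term f g (r i) p|%:E).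
  apply/measurable_EFinP; apply: measurableT_comp => //; exact: measurable_corr_term.
rewrite /corr_sum (reindex_esum _ _ _ _ bD).
rewrite -(esum_esum (a := fun i h => hyp (fun p => ((fwt N2 p)%:E * (fwt N1 (act (h *m r i) p))%:E) *
     `|corr_term f g (h *m r i) p|%:E))); last first.
  move=> i h _ _; apply: integral_ge0 => p p0.
  by rewrite !mule_ge0// lee_fin// invr_ge0 sqr_ge0.
rewrite esum_fin; last first.
  move=> i; apply: esum_ge0 => h _; apply: integral_ge0 => p p0.
  by rewrite !mule_ge0// lee_fin// invr_ge0 sqr_ge0.
apply: eq_bigr => i _.
transitivity (\esum_(h in Gamma0 N1) hyp (fun p =>
    (fwt N1 (act h (act (r i) p)))%:E * ((fwt N2 p)%:E * `|corr_term f g (r i) p|%:E))).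
  apply: eq_esum => h Gh; apply: eq_hyp => p p0.
  rewrite (corr_term_mulG _ Gh)// actM ?(Gamma0_det Gh) ?oner_eq0//.
  by rewrite muleA [X in X * _ = _]muleC.
rewrite -hyp_esum; last 2 first.
- move=> h Gh; apply: emeasurable_funM; last exact: emeasurable_funM.
  apply: (measurable_comp_act (dr i) (phi := fun p => (fwt N1 (act h p))%:E)).
  exact: (measurable_comp_act (Gamma0_det_gt0 Gh) (phi := fun p => (fwt N1 p)%:E)).
- by move=> h p; rewrite !mule_ge0.
apply: eq_hyp => p p0.
have X0 : (0 <= fwt N2 p * `|corr_term f g (r i) p|)%R by rewrite mulr_ge0// fwt_ge0.
rewrite -EFinM esumZr//.
by rewrite esum_fwt ?mul1e//; exact: act_uhp.
Qed.

(** The squared Petersson norm with values in the extended reals, so that identities can be stated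
    before finiteness is known. *)
Definition qnorm (N : nat) f : \bar R :=
  \int[@area R]_(p in fund_domain N) (sqC (f (toC p)) * (p.2 ^+ k / p.2 ^+ 2))%:E.

Lemma qnormE N f : (0 < N)%N -> cmeas f ->
  qnorm N f = 2%:E * hyp (fun p => (fwt N p)%:E * `|sqC (f (toC p)) * p.2 ^+ k|%:E).
Proof.
move=> N0 mf; rewrite -ge0_integral_fund_domain//; last first.
  apply/measurable_EFinP; apply: measurableT_comp => //; apply: measurable_funM.
    exact: measurable_sqC.
  apply: measurable_funTS; exact: measurable_funX.
apply: eq_integral => p /[!inE] /fund_domain_uhp p0; rewrite -EFinM ger0_norm ?mulrA//.
by rewrite mulr_ge0 ?sqC_ge0// exprn_ge0// ltW.
Qed.

(* Unfolding over [D] along its Gamma0(N1)-cosets on one side, and, after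
   z |-> adj(d) z, along the Gamma0(N2)-cosets of adj(D) on the other. *)
Theorem correspondence (I J : finType) (r : I -> 'M[int]_2) (s : J -> 'M[int]_2) N1 N2
    (D : set 'M[int]_2) (n : int) f g :
  (0 < N1)%N -> (0 < N2)%N -> (0 < n)%R ->
  (forall d, D d -> \det d = n) ->
  set_bij ([set: I] `*`` (fun=> Gamma0 N1)) D (fun x => x.2 *m r x.1) ->
  set_bij ([set: J] `*`` (fun=> Gamma0 N2)) (@adj2 _ @` D) (fun x => x.2 *m s x.1) ->
  cmeas f -> cmeas g -> modular N1 f -> modular N2 g ->
  \sum_i qnorm N2 (fun z => n%:~R ^+ l * slash k f (r i) z + g z)%R =
  \sum_j qnorm N1 (fun z => n%:~R ^+ l * slash k g (s j) z + f z)%R.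
Proof.
move=> N10 N20 n0 dD bD bD' mf mg modf modg.
have dD1 d : D d -> (0 < \det d)%R by move=> /dD ->.
have dD2 d : (@adj2 _ @` D) d -> (0 < \det d)%R by move=> [e /dD1 + <-]; rewrite det_adj2.
have rn i : \det (r i) = n.
  apply: dD; have [h _ _] := bD; have := h (i, 1%:M); rewrite mul1mx; apply.
  by split => //; exact: Gamma0_1.
have sn j : \det (s j) = n.
  have [h _ _] := bD'; have := h (j, 1%:M); rewrite mul1mx.
  by case=> [|d Dd <-]; [split => //; exact: Gamma0_1|rewrite det_adj2 dD].
have := corr_sum_flip N1 N2 dD1 mf mg.
rewrite (corr_sum_unfold _ N10 dD1 bD mf mg modf) (corr_sum_unfold _ N20 dD2 bD' mg mf modg).
move=> /(congr1 (fun x => 2%:E * x)).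
rewrite !ge0_sume_distrr; last 2 first.
- by move=> i _; apply: integral_ge0 => p p0; rewrite !mule_ge0// lee_fin ?fwt_ge0// invr_ge0 sqr_ge0.
- by move=> i _; apply: integral_ge0 => p p0; rewrite !mule_ge0// lee_fin ?fwt_ge0// invr_ge0 sqr_ge0.
have mE (u v : R[i] -> R[i]) d : (0 < \det d)%R -> cmeas u -> cmeas v ->
    cmeas (fun z => n%:~R ^+ l * slash k u d z + v z)%R.
  by move=> dd mu mv; apply: cmeasD => //; apply: cmeasM; [exact: cmeas_cst|exact: cmeas_slash].
move=> e; transitivity (\sum_i 2%:E * hyp (fun p => (fwt N2 p)%:E * `|corr_term f g (r i) p|%:E)).
  apply: eq_bigr => i _; have dr : (0 < \det (r i))%R by rewrite rn.
  rewrite (@eq_hyp _ (fun p => (fwt N2 p)%:E * `|corr_term f g (r i) p|%:E)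
    (fun p => (fwt N2 p)%:E * `|sqC (n%:~R ^+ l * slash k f (r i) (toC p) + g (toC p)) * p.2 ^+ k|%:E)).
    exact: (qnormE N20 (mE f g (r i) dr mf mg)).
  by move=> p _; rewrite /corr_term rn.
rewrite e; apply: eq_bigr => j _; have ds : (0 < \det (s j))%R by rewrite sn.
rewrite (@eq_hyp _ (fun p => (fwt N1 p)%:E * `|corr_term g f (s j) p|%:E)
  (fun p => (fwt N1 p)%:E * `|sqC (n%:~R ^+ l * slash k g (s j) (toC p) + f (toC p)) * p.2 ^+ k|%:E)).
  exact: (esym (qnormE N10 (mE g f (s j) ds mg mf))).
by move=> p _; rewrite /corr_term sn.
Qed.
End Correspondence.

Arguments petersson : simpl never.

(** * The Petersson product on square-integrable forms *)

Section PeterssonForm.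
Variables (R : realType) (k : nat).
Implicit Types (f g h : R[i] -> R[i]) (p : R * R) (N : nat).

Definition L2 N f := cmeas f /\ (qnorm k N f < +oo)%E.

Definition dens p : R := p.2 ^+ k / p.2 ^+ 2.
Definition reprod f g p : R :=
  (complex.Re (f (toC p)) * complex.Re (g (toC p)) +
   complex.Im (f (toC p)) * complex.Im (g (toC p))) * dens p.
Definition improd f g p : R :=
  (complex.Im (f (toC p)) * complex.Re (g (toC p)) -
   complex.Re (f (toC p)) * complex.Im (g (toC p))) * dens p.

Lemma peterssonE N f g : petersson k N f g =
  (\int[@area R]_(p in fund_domain N) reprod f g p) +i*
  (\int[@area R]_(p in fund_domain N) improd f g p).
Proof.
rewrite /petersson; congr (_ +i* _); apply: eq_Rintegral => p _;
  rewrite /reprod /improd /dens /toC;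
  case: (f _) => a b; case: (g _) => c d /=; ring.
Qed.

Lemma mfund N : measurable (fund_domain N : set (measurableTypeR R * measurableTypeR R)).
Proof. exact: measurable_fund_domain. Qed.

Lemma dens_ge0 p : uhp p -> 0 <= dens p.
Proof. by move=> p0; rewrite divr_ge0// exprn_ge0// ltW. Qed.

Lemma measurable_dens : measurable_fun [set: R * R] dens.
Proof.
apply: measurable_funM; first exact: measurable_funX.
by apply: (measurableT_comp (@measurable_invr R)); exact: measurable_funX.
Qed.

Lemma fund_measurable N (u : R * R -> R) : measurable_fun uhp u ->
  measurable_fun (fund_domain N) u.
Proof.
apply: measurable_funS; first exact: measurable_uhp.
by move=> p; exact: fund_domain_uhp.
Qed.

Lemma measurable_reprod f g : cmeas f -> cmeas g -> measurable_fun uhp (reprod f g).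
Proof.
move=> [f1 f2] [g1 g2]; apply: measurable_funM; last by apply: measurable_funTS; exact: measurable_dens.
by apply: measurable_funD; exact: measurable_funM.
Qed.

Lemma measurable_improd f g : cmeas f -> cmeas g -> measurable_fun uhp (improd f g).
Proof.
move=> [f1 f2] [g1 g2]; apply: measurable_funM; last by apply: measurable_funTS; exact: measurable_dens.
by apply: measurable_funB; exact: measurable_funM.
Qed.

Lemma qnorm_ge0 N f : (0 <= qnorm k N f)%E.
Proof.
apply: integral_ge0 => p /fund_domain_uhp p0.
by rewrite lee_fin mulr_ge0 ?sqC_ge0// (dens_ge0 p0).
Qed.

Lemma integrable_sq N f : L2 N f ->
  (@area R).-integrable (fund_domain N) (EFin \o reprod f f).
Proof.
move=> [mf ff]; apply/integrableP; split.
  by apply/measurable_EFinP; apply: fund_measurable; exact: measurable_reprod.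
apply: le_lt_trans ff; rewrite le_eqVlt; apply/orP; left; apply/eqP.
apply: eq_integral => p /[!inE] /fund_domain_uhp p0 /=.
rewrite /reprod /sqC !expr2 ger0_norm// mulr_ge0 ?dens_ge0//.
by rewrite addr_ge0// -expr2 sqr_ge0.
Qed.

Lemma qnorm_Re N f : complex.Re (petersson k N f f) = fine (qnorm k N f).
Proof.
rewrite peterssonE /= /Rintegral; congr fine; exact: eq_integral.
Qed.

Lemma integrable_dom N (u : R * R -> R) f g : L2 N f -> L2 N g ->
  measurable_fun uhp u ->
  (forall p, uhp p -> `|u p| <= reprod f f p + reprod g g p) ->
  (@area R).-integrable (fund_domain N) (EFin \o u).
Proof.
move=> Lf Lg mu ub.
have If := integrable_sq Lf; have Ig := integrable_sq Lg.
apply: le_integrable (integrableD _ If Ig) => //.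
- exact: mfund.
- by apply/measurable_EFinP; exact: fund_measurable.
- move=> p /fund_domain_uhp p0 /=; rewrite lee_fin.
  by rewrite (le_trans (ub _ p0))// ler_norm.
- exact: mfund.
Qed.

Lemma integrable_reprod N f g : L2 N f -> L2 N g ->
  (@area R).-integrable (fund_domain N) (EFin \o reprod f g).
Proof.
move=> Lf Lg; apply: (integrable_dom Lf Lg).
  by case: Lf => ? _; case: Lg => ? _; exact: measurable_reprod.
move=> p p0; have := dens_ge0 p0; rewrite /reprod -mulrDl.
case: (f _) => a b; case: (g _) => c d /= d0.
rewrite normrM (ger0_norm d0) ler_wpM2r// ler_norml.
have := sqr_ge0 (a + c); have := sqr_ge0 (b + d); have := sqr_ge0 (a - c); have := sqr_ge0 (b - d).
by move=> h1 h2 h3 h4; apply/andP; split; nra.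
Qed.

Lemma integrable_improd N f g : L2 N f -> L2 N g ->
  (@area R).-integrable (fund_domain N) (EFin \o improd f g).
Proof.
move=> Lf Lg; apply: (integrable_dom Lf Lg).
  by case: Lf => ? _; case: Lg => ? _; exact: measurable_improd.
move=> p p0; have := dens_ge0 p0; rewrite /reprod /improd -mulrDl.
case: (f _) => a b; case: (g _) => c d /= d0.
rewrite normrM (ger0_norm d0) ler_wpM2r// ler_norml.
have := sqr_ge0 (a + d); have := sqr_ge0 (b + c); have := sqr_ge0 (a - d); have := sqr_ge0 (b - c).
by move=> h1 h2 h3 h4; apply/andP; split; nra.
Qed.

Lemma L2_of_integrable N f : cmeas f ->
  (@area R).-integrable (fund_domain N) (EFin \o reprod f f) -> L2 N f.
Proof.
move=> mf /integrableP[_ h]; split=> //; apply: le_lt_trans h.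
apply: ge0_le_integral; first exact: mfund.
- by move=> p /fund_domain_uhp p0; rewrite lee_fin mulr_ge0 ?sqC_ge0// (dens_ge0 p0).
- apply/measurable_EFinP; apply: fund_measurable; apply: measurable_funM; first exact: measurable_sqC.
  by apply: measurable_funTS; exact: measurable_dens.
- apply/measurable_EFinP; apply: measurableT_comp => //; apply: fund_measurable; exact: measurable_reprod.
- by move=> p _; rewrite lee_fin /= (le_trans _ (ler_norm _))// /reprod /sqC !expr2.
Qed.

Lemma integrableD_EFin N (u v : R * R -> R) :
  (@area R).-integrable (fund_domain N) (EFin \o u) ->
  (@area R).-integrable (fund_domain N) (EFin \o v) ->
  (@area R).-integrable (fund_domain N) (EFin \o (fun p => u p + v p)).
Proof. by move=> Iu Iv; exact: (integrableD (mfund N) Iu Iv). Qed.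

Lemma integrableZ_EFin N (c : R) (u : R * R -> R) :
  (@area R).-integrable (fund_domain N) (EFin \o u) ->
  (@area R).-integrable (fund_domain N) (EFin \o (fun p => c * u p)).
Proof. by move=> Iu; exact: (integrableZl (mfund N) c Iu). Qed.

Lemma L2D N f g : L2 N f -> L2 N g -> L2 N (fun z => f z + g z).
Proof.
move=> Lf Lg; have mfg : cmeas (fun z => f z + g z) by apply: cmeasD; [case: Lf|case: Lg].
apply: L2_of_integrable => //.
have mF := mfund N.
have h := integrableD_EFin (integrableD_EFin (integrable_sq Lf) (integrable_sq Lg))
   (integrableD_EFin (integrable_reprod Lf Lg) (integrable_reprod Lf Lg)).
move: h; congr is_true; congr integrable; apply/funext => p /=; congr (_%:E); rewrite /reprod.
by case: (f _) => a b; case: (g _) => c d /=; ring.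
Qed.

Lemma L2Z N (c : R[i]) f : L2 N f -> L2 N (fun z => c * f z).
Proof.
move=> Lf; have mf : cmeas (fun z => c * f z) by apply: cmeasM; [exact: cmeas_cst|case: Lf].
apply: L2_of_integrable => //.
have mF := mfund N.
have h := integrableZ_EFin (sqC c) (integrable_sq Lf).
move: h; congr is_true; congr integrable; apply/funext => p /=; congr (_%:E); rewrite /reprod /sqC.
by case: c {mf} => x y; case: (f _) => a b /=; ring.
Qed.

Lemma L2_0 N : L2 N (fun=> 0).
Proof.
split; first exact: cmeas_cst.
rewrite /qnorm integral0_eq// => p _; rewrite sqC0 mul0r//.
Qed.

Lemma petersson_conj N f g : L2 N f -> L2 N g ->
  petersson k N g f = (petersson k N f g)^*.
Proof.
move=> Lf Lg; rewrite !peterssonE; apply/eqP; rewrite eq_complex /=; apply/andP; split; apply/eqP.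
  by apply: eq_Rintegral => p _; rewrite /reprod; ring.
have mF := mfund N.
rewrite -mulN1r -RintegralZl//; last exact: integrable_improd.
by apply: eq_Rintegral => p _; rewrite /improd; ring.
Qed.

Lemma peterssonDl N f g h : L2 N f -> L2 N g -> L2 N h ->
  petersson k N (fun z => f z + g z) h = petersson k N f h + petersson k N g h.
Proof.
move=> Lf Lg Lh; rewrite !peterssonE; have mF := mfund N.
apply/eqP; rewrite eq_complex /=; apply/andP; split; apply/eqP.
  rewrite -RintegralD//; try exact: integrable_reprod.
  by apply: eq_Rintegral => p _; rewrite /reprod raddfD raddfD /=; ring.
rewrite -RintegralD//; try exact: integrable_improd.
by apply: eq_Rintegral => p _; rewrite /improd raddfD raddfD /=; ring.
Qed.

Lemma peterssonZl N (c : R[i]) f g : L2 N f -> L2 N g ->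
  petersson k N (fun z => c * f z) g = c * petersson k N f g.
Proof.
move=> Lf Lg; rewrite !peterssonE; have mF := mfund N.
have I1 := integrable_reprod Lf Lg; have I2 := integrable_improd Lf Lg.
case: c => x y; apply/eqP; rewrite eq_complex /=; apply/andP; split; apply/eqP.
  rewrite -(RintegralZl x mF I1) -(RintegralZl y mF I2) -RintegralB//; try exact: integrableZ_EFin.
  by apply: eq_Rintegral => p _; rewrite /reprod /improd; case: (f _) => a b /=; ring.
rewrite -(RintegralZl x mF I2) -(RintegralZl y mF I1) -RintegralD//; try exact: integrableZ_EFin.
by apply: eq_Rintegral => p _; rewrite /reprod /improd; case: (f _) => a b /=; ring.
Qed.

Lemma L2_sum N n (f : 'I_n -> R[i] -> R[i]) : (forall i, L2 N (f i)) ->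
  L2 N (fun z => \sum_i f i z).
Proof.
elim: n f => [|n IH] f Lf.
  rewrite (_ : (fun z => _) = fun=> 0); first exact: L2_0.
  by apply/funext => z; rewrite big_ord0.
rewrite (_ : (fun z => _) = fun z => f ord0 z + \sum_(i < n) f (lift ord0 i) z); last first.
  by apply/funext => z; rewrite big_ord_recl.
by apply: L2D => //; exact: IH.
Qed.

Lemma petersson_suml N n (f : 'I_n -> R[i] -> R[i]) g : (forall i, L2 N (f i)) -> L2 N g ->
  petersson k N (fun z => \sum_i f i z) g = \sum_i petersson k N (f i) g.
Proof.
elim: n f => [|n IH] f Lf Lg.
  rewrite big_ord0 (_ : (fun z => _) = fun z => 0 * 0); last first.
    by apply/funext => z; rewrite big_ord0 mul0r.
  by rewrite (peterssonZl 0 (L2_0 N) Lg) mul0r.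
rewrite (_ : (fun z => _) = fun z => f ord0 z + \sum_(i < n) f (lift ord0 i) z); last first.
  by apply/funext => z; rewrite big_ord_recl.
rewrite peterssonDl//; last by apply: L2_sum.
by rewrite big_ord_recl IH.
Qed.

Lemma eq_petersson N f f' g g' : (forall z, upper z -> f z = f' z) ->
  (forall z, upper z -> g z = g' z) -> petersson k N f g = petersson k N f' g'.
Proof.
move=> ff gg; rewrite !peterssonE; congr (_ +i* _); apply: eq_Rintegral => p /[!inE] /fund_domain_uhp p0;
  by rewrite /reprod /improd ff// gg.
Qed.

Lemma eq_L2 N f g : (forall z, upper z -> f z = g z) -> L2 N f -> L2 N g.
Proof.
move=> fg [mf qf]; split; first exact: eq_cmeas mf.
apply: le_lt_trans qf; rewrite le_eqVlt; apply/orP; left; apply/eqP.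
by apply: eq_integral => p /[!inE] /fund_domain_uhp p0; rewrite fg.
Qed.

Lemma qnorm_fin N f : L2 N f -> qnorm k N f = (complex.Re (petersson k N f f))%:E.
Proof. by move=> [_ h]; rewrite qnorm_Re fineK// ge0_fin_numE// qnorm_ge0. Qed.

Lemma petersson_ge0 N f : 0 <= complex.Re (petersson k N f f).
Proof. by rewrite qnorm_Re fine_ge0// qnorm_ge0. Qed.

Lemma petersson_real N f : complex.Im (petersson k N f f) = 0.
Proof.
rewrite peterssonE /= /Rintegral integral0_eq// => p _.
by congr (_%:E); rewrite /improd; ring.
Qed.

Lemma qnormD N f g : L2 N f -> L2 N g ->
  complex.Re (petersson k N (fun z => f z + g z) (fun z => f z + g z)) =
  complex.Re (petersson k N f f) + complex.Re (petersson k N g g) +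
    2 * complex.Re (petersson k N f g).
Proof.
move=> Lf Lg; have LD := L2D Lf Lg.
rewrite (peterssonDl Lf Lg LD) (petersson_conj LD Lf) (petersson_conj LD Lg).
rewrite (peterssonDl Lf Lg Lf) (peterssonDl Lf Lg Lg) (petersson_conj Lf Lg).
case: (petersson k N f g) (petersson k N f f) (petersson k N g g) => a b [c d] [e h] /=; ring.
Qed.
End PeterssonForm.

(** * Adjointness by polarization *)

Section Adjoint.
Variables (R : realType) (k l : nat).
Hypothesis kl : k = (l + l)%N.
Implicit Types (f g h : R[i] -> R[i]) (p : R * R).

Lemma slashZ (c : R[i]) f (d : 'M[int]_2) z : slash k (fun w => c * f w) d z = c * slash k f d z.
Proof. by rewrite /slash mulrCA. Qed.

Lemma modularZ N (c : R[i]) f : modular k N f -> modular k N (fun z => c * f z).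
Proof. by move=> mf g z Gg z0; rewrite slashZ mf. Qed.

Variables (I J : finType) (r : I -> 'M[int]_2) (s : J -> 'M[int]_2) (N1 N2 : nat).
Variables (D : set 'M[int]_2) (n : int).
Hypotheses (N10 : (0 < N1)%N) (N20 : (0 < N2)%N) (n0 : (0 < n)%R).
Hypothesis dD : forall d, D d -> \det d = n.
Hypothesis bD : set_bij ([set: I] `*`` (fun=> Gamma0 N1)) D (fun x => x.2 *m r x.1).
Hypothesis bD' : set_bij ([set: J] `*`` (fun=> Gamma0 N2)) (@adj2 _ @` D) (fun x => x.2 *m s x.1).

Let corr f g := correspondence kl N10 N20 n0 dD bD bD' (f := f) (g := g).

Let nl0 : (n%:~R ^+ l : R[i]) != 0.
Proof. by rewrite expf_neq0// intr_eq0 gt_eqF. Qed.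

Let dr i : 0 < \det (r i).
Proof.
rewrite (dD (d := r i))//; have [h _ _] := bD; have := h (i, 1%:M); rewrite mul1mx; apply.
by split => //; exact: Gamma0_1.
Qed.

Let ds j : 0 < \det (s j).
Proof.
have [h _ _] := bD'; have := h (j, 1%:M); rewrite mul1mx.
by case=> [|d Dd <-]; [split => //; exact: Gamma0_1|rewrite det_adj2 dD].
Qed.

Let modular0 N : modular k N (fun=> 0 : R[i]).
Proof. by move=> g z _ _; rewrite /slash mulr0. Qed.

Let slash0 (d : 'M[int]_2) z : slash k (fun=> 0 : R[i]) d z = 0.
Proof. by rewrite /slash mulr0. Qed.

Let eq_qnorm N f g : (forall z, f z = g z) -> qnorm k N f = qnorm k N g.
Proof. by move=> fg; apply: eq_integral => p _; rewrite fg. Qed.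

Let A f i z := n%:~R ^+ l * slash k f (r i) z.
Let B g j z := n%:~R ^+ l * slash k g (s j) z.

(** The correspondence with g = 0. It makes the total norm of the slashed forms finite, so each of
    them is square-integrable, and it supplies the diagonal terms to be cancelled in the
    polarization. *)
Let sumA f : cmeas f -> modular k N1 f ->
  (\sum_i qnorm k N2 (A f i) = \sum_(j : J) qnorm k N1 f)%E.
Proof.
move=> mf modf; have := corr mf (cmeas_cst 0) modf (@modular0 N2).
move=> e; transitivity (\sum_i qnorm k N2 (fun z => n%:~R ^+ l * slash k f (r i) z + 0)%R)%E.
  by apply: eq_bigr => i _; apply: eq_qnorm => z; rewrite addr0.
by rewrite e; apply: eq_bigr => j _; apply: eq_qnorm => z; rewrite slash0 mulr0 add0r.
Qed.

Let sumB g : cmeas g -> modular k N2 g ->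
  (\sum_j qnorm k N1 (B g j) = \sum_(i : I) qnorm k N2 g)%E.
Proof.
move=> mg modg; have := corr (cmeas_cst 0) mg (@modular0 N1) modg.
move=> e; transitivity (\sum_j qnorm k N1 (fun z => n%:~R ^+ l * slash k g (s j) z + 0)%R)%E.
  by apply: eq_bigr => i _; apply: eq_qnorm => z; rewrite addr0.
by rewrite -e; apply: eq_bigr => j _; apply: eq_qnorm => z; rewrite slash0 mulr0 add0r.
Qed.

Let term_lt (K : finType) (a : K -> \bar R) i : (forall j, 0 <= a j)%E ->
  (\sum_j a j < +oo)%E -> (a i < +oo)%E.
Proof.
move=> a0; apply: le_lt_trans; rewrite (bigD1 i)//= leeDl// sume_ge0//.
Qed.

Let LA f i : L2 k N1 f -> modular k N1 f -> L2 k N2 (A f i).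
Proof.
move=> [mf qf] modf; split.
  by apply: cmeasM; [exact: cmeas_cst|exact: cmeas_slash].
apply: (term_lt (a := fun i => qnorm k N2 (A f i))); first by move=> j; exact: qnorm_ge0.
by rewrite sumA//; apply: lte_sum_pinfty.
Qed.

Let LB g j : L2 k N2 g -> modular k N2 g -> L2 k N1 (B g j).
Proof.
move=> [mg qg] modg; split.
  by apply: cmeasM; [exact: cmeas_cst|exact: cmeas_slash].
apply: (term_lt (a := fun j => qnorm k N1 (B g j))); first by move=> i; exact: qnorm_ge0.
by rewrite sumB//; apply: lte_sum_pinfty.
Qed.

Lemma L2_slash_r f i : L2 k N1 f -> modular k N1 f -> L2 k N2 (slash k f (r i)).
Proof.
move=> Lf mf; apply: eq_L2 (L2Z (n%:~R ^- l) (LA i Lf mf)) => z _.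
by rewrite /A mulKf.
Qed.

Lemma L2_slash_s g j : L2 k N2 g -> modular k N2 g -> L2 k N1 (slash k g (s j)).
Proof.
move=> Lg mg; apply: eq_L2 (L2Z (n%:~R ^- l) (LB j Lg mg)) => z _.
by rewrite /B mulKf.
Qed.

Let polar_cancel (a c : I -> R) (a' c' : J -> R) (b b' : R) :
  (\sum_i (a i + b + 2 * c i)%:E = \sum_j (a' j + b' + 2 * c' j)%:E)%E ->
  (\sum_i (a i)%:E = \sum_(j : J) b'%:E)%E -> (\sum_j (a' j)%:E = \sum_(i : I) b%:E)%E ->
  \sum_i c i = \sum_j c' j.
Proof.
rewrite !sumEFin => -[e] [ea] [ea']; move: e.
by rewrite !big_split/= -!mulr_sumr ea ea'; lra.
Qed.

Let Re_sum (K : finType) (F : K -> R[i]) : complex.Re (\sum_i F i) = \sum_i complex.Re (F i).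
Proof. exact: raddf_sum. Qed.

Let adjoint_Re f g : L2 k N1 f -> L2 k N2 g -> modular k N1 f -> modular k N2 g ->
  complex.Re (\sum_i petersson k N2 (A f i) g) = complex.Re (\sum_j petersson k N1 (B g j) f).
Proof.
move=> Lf Lg modf modg.
have := corr (proj1 Lf) (proj1 Lg) modf modg.
have qA i : qnorm k N2 (fun z => n%:~R ^+ l * slash k f (r i) z + g z) =
   (complex.Re (petersson k N2 (A f i) (A f i)) + complex.Re (petersson k N2 g g) +
    2 * complex.Re (petersson k N2 (A f i) g))%:E.
  by rewrite -qnormD// ?qnorm_fin//; [apply: L2D => //|]; exact: LA.
have qB j : qnorm k N1 (fun z => n%:~R ^+ l * slash k g (s j) z + f z) =
   (complex.Re (petersson k N1 (B g j) (B g j)) + complex.Re (petersson k N1 f f) +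
    2 * complex.Re (petersson k N1 (B g j) f))%:E.
  by rewrite -qnormD// ?qnorm_fin//; [apply: L2D => //|]; exact: LB.
move=> e; rewrite !Re_sum.
apply: (polar_cancel (a := fun i => complex.Re (petersson k N2 (A f i) (A f i)))
  (a' := fun j => complex.Re (petersson k N1 (B g j) (B g j)))
  (b := complex.Re (petersson k N2 g g)) (b' := complex.Re (petersson k N1 f f))).
- transitivity (\sum_i qnorm k N2 (fun z => n%:~R ^+ l * slash k f (r i) z + g z)%R)%E.
    by apply: eq_bigr => i _; rewrite qA.
  by rewrite e; apply: eq_bigr => j _; rewrite qB.
- transitivity (\sum_i qnorm k N2 (A f i))%E.
    by apply: eq_bigr => i _; rewrite (qnorm_fin (LA i Lf modf)).
  by rewrite (sumA (proj1 Lf) modf) (qnorm_fin Lf).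
- transitivity (\sum_j qnorm k N1 (B g j))%E.
    by apply: eq_bigr => j _; rewrite (qnorm_fin (LB j Lg modg)).
  by rewrite (sumB (proj1 Lg) modg) (qnorm_fin Lg).
Qed.

(** Comparing squares yields only real parts. Applying the comparison to multiples of f recovers
    both parts, with c = 1 and c = -i; dividing c by n^l undoes the normalisation built into [A] and
    [B]. *)
Lemma adjoint f g : L2 k N1 f -> L2 k N2 g -> modular k N1 f -> modular k N2 g ->
  \sum_i petersson k N2 (slash k f (r i)) g = \sum_j petersson k N1 f (slash k g (s j)).
Proof.
move=> Lf Lg modf modg.
have H (c : R[i]) : complex.Re (c * \sum_i petersson k N2 (slash k f (r i)) g) =
    complex.Re (c * \sum_j petersson k N1 f (slash k g (s j))).
  pose c' := c / n%:~R ^+ l.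
  have LcF := L2Z c' Lf.
  have := adjoint_Re LcF Lg (modularZ c' modf) modg.
  have -> : \sum_i petersson k N2 (A (fun z => c' * f z) i) g =
     c * \sum_i petersson k N2 (slash k f (r i)) g.
    rewrite mulr_sumr; apply: eq_bigr => i _; rewrite -peterssonZl//; last exact: L2_slash_r.
    by apply: eq_petersson => z _ //; rewrite /A slashZ mulrA /c' mulrC [_ ^+ l * _]mulrC divfK// mulrC.
  move=> ->; rewrite !mulr_sumr !Re_sum; apply: eq_bigr => j _.
  rewrite -peterssonZl//; last exact: L2_slash_s.
  have LcB : L2 k N1 (B g j) by exact: LB.
  rewrite (petersson_conj LcF LcB).
  have -> : petersson k N1 (fun z => c' * f z) (B g j) = petersson k N1 (fun z => c * f z) (slash k g (s j)).
    have Ls := L2_slash_s j Lg modg.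
    rewrite (peterssonZl c' Lf LcB) (peterssonZl c Lf Ls) (petersson_conj LcB Lf).
    rewrite (peterssonZl _ Ls Lf) (petersson_conj Ls Lf).
    rewrite /c' (_ : n%:~R ^+ l = ((n%:~R ^+ l : R)%:C) :> R[i]); last by rewrite expC -intC.
    have m0 : (n%:~R ^+ l : R)%:C != 0 by rewrite expC -intC.
    have conjM (m : R) (x : R[i]) : (m%:C * x)^* = m%:C * x^*.
      by case: x => x y; apply/eqP; rewrite eq_complex /=; apply/andP; split; apply/eqP; ring.
    by rewrite conjM mulrA divfK.
  by case: (petersson _ _ _ _).
have h1 := H 1; have h2 := H (- 'i).
move: h1 h2; case: (\sum_i _) => a b; case: (\sum_i _) => c d /=.
rewrite !mul1r !mul0r !subr0 => -> h2; congr (_ +i* _); move: h2; lra.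
Qed.
End Adjoint.

(** * Fourier expansions *)

Section Exponential.
Variable R : realType.
Implicit Types (z w : R[i]).

Lemma e2piD z w : e2pi (z + w) = e2pi z * e2pi w.
Proof.
case: z w => a b [c d]; rewrite /e2pi /= !mulrDr cosD sinD opprD expRD.
by apply/eqP; rewrite eq_complex /=; apply/andP; split; apply/eqP; ring.
Qed.

Lemma e2pi0 : e2pi (0 : R[i]) = 1.
Proof. by rewrite /e2pi /= !mulr0 oppr0 expR0 cos0 sin0 mul1r. Qed.

Lemma e2piX z n : e2pi (n%:R * z) = e2pi z ^+ n.
Proof.
elim: n => [|n IH]; first by rewrite mul0r e2pi0 expr0.
by rewrite -addn1 natrD mulrDl mul1r e2piD IH exprD expr1.
Qed.

Lemma e2pi1 : e2pi (1 : R[i]) = 1.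
Proof.
rewrite /e2pi /= !mulr0 oppr0 expR0 mul1r mulr1 mulr_natl cos2pi sin2pi.
by apply/eqP; rewrite eq_complex /= !eqxx.
Qed.

Lemma e2pi_nat n : e2pi (n%:R : R[i]) = 1.
Proof. by rewrite -[X in e2pi X]mulr1 e2piX e2pi1 expr1n. Qed.

Lemma sqC_e2pi z : sqC (e2pi z) = expR (- (2 * pi * complex.Im z)) ^+ 2.
Proof.
rewrite /e2pi sqCM sqC_real -[RHS]mulr1; congr (_ * _).
by rewrite /sqC /= cos2Dsin2.
Qed.

Lemma e2pi_neq1 (x : R) : 0 < x < 1 -> e2pi (x%:C : R[i]) != 1.
Proof.
move=> /andP[x0 x1]; apply/eqP => /(congr1 (@complex.Re R)).
rewrite /e2pi /= !mulr0 oppr0 expR0 mul0r subr0 mul1r.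
have -> : 2 * pi * x = (pi * x) *+ 2 :> R by rewrite -mulrA mulr_natl.
have s0 : 0 < sin (pi * x) by apply: sin_gt0_pi; rewrite mulr_gt0 ?pi_gt0//= gtr_pMr ?pi_gt0.
rewrite cos_mulr2n; have := cos2Dsin2 (pi * x); nra.
Qed.

Lemma sum_e2pi (d j : nat) : (0 < d)%N ->
  \sum_(b < d) e2pi (j%:R * (b%:R / d%:R)) = (if (d %| j)%N then d%:R else 0) :> R[i].
Proof.
move=> d0; have dC : d%:R != 0 :> R[i] by rewrite pnatr_eq0 -lt0n.
pose q := e2pi (j%:R / d%:R : R[i]).
have -> : \sum_(b < d) e2pi (j%:R * (b%:R / d%:R) : R[i]) = \sum_(b < d) q ^+ b.
  by apply: eq_bigr => b _; rewrite -e2piX mulrCA.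
have qd : q ^+ d = 1 by rewrite /q -e2piX mulrC divfK// e2pi_nat.
case: ifPn => [dj|dj].
  have -> : q = 1.
    by rewrite /q -(divnK dj) natrM mulfK// e2pi_nat.
  under eq_bigr do rewrite expr1n.
  by rewrite sumr_const card_ord.
have q1 : q != 1.
  rewrite /q {1}(divn_eq j d) natrD natrM mulrDl mulfK// e2piD e2pi_nat mul1r.
  have -> : (j %% d)%:R / d%:R = ((j %% d)%:R / d%:R : R)%:C :> R[i] by rewrite divC -!natC.
  have jd : (0 < j %% d)%N by rewrite lt0n.
  apply: e2pi_neq1; apply/andP; split; first by rewrite divr_gt0 ?ltr0n.
  by rewrite ltr_pdivrMr ?ltr0n// mul1r ltr_nat ltn_pmod.
apply: (mulfI (x := q - 1)); first by rewrite subr_eq0.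
by rewrite -subrX1 qd subrr mulr0.
Qed.

Lemma cmeas_e2pi (h : R[i] -> R[i]) : cmeas h -> cmeas (fun z => e2pi (h z)).
Proof.
move=> [h1 h2].
have m1 : measurable_fun uhp (fun p : R * R => expR (- (2 * pi * complex.Im (h (toC p))))).
  apply: (measurableT_comp (@measurable_expR R)); apply: measurable_funN.
  exact: measurable_funM.
have m2 : measurable_fun uhp (fun p : R * R => cos (2 * pi * complex.Re (h (toC p)))).
  apply: (measurableT_comp (f := @cos R)); last exact: measurable_funM.
  by apply: continuous_measurable_fun; exact: continuous_cos.
have m3 : measurable_fun uhp (fun p : R * R => sin (2 * pi * complex.Re (h (toC p)))).
  apply: (measurableT_comp (f := @sin R)); last exact: measurable_funM.
  by apply: continuous_measurable_fun; exact: continuous_sin.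
split.
  apply: eq_measurable_fun (measurable_funM m1 m2) => p _; rewrite /e2pi /=.
  by rewrite mul0r subr0.
apply: eq_measurable_fun (measurable_funM m1 m3) => p _; rewrite /e2pi /=.
by rewrite mul0r addr0.
Qed.
End Exponential.

Section ComplexLimits.
Variable R : realType.
Implicit Types (u v : nat -> R[i]) (l m : R[i]).

Definition ccvg u l := ((fun n => complex.Re (u n)) @ \oo --> complex.Re l) /\
  ((fun n => complex.Im (u n)) @ \oo --> complex.Im l).

Lemma ccvgP u l : u @ \oo --> (l : R[i]^o) <-> ccvg u l.
Proof.
have H := cvgrPdist_lt (K := R[i]) (V := R[i]^o) (F := \oo) u l.
split => [/H ul|[ulr uli]].
  split; apply/cvgrPdist_lt => e e0; have e0C : 0 < e%:C by rewrite ltcE /= eqxx.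
    move: (ul _ e0C); apply: filterS => n.
    rewrite ltcE /= => /andP[_]; apply: le_lt_trans; rewrite -raddfB /=.
    by case: (l - u n) => a b /=; rewrite -sqrtr_sqr ler_wsqrtr// lerDl sqr_ge0.
  move: (ul _ e0C); apply: filterS => n.
  rewrite ltcE /= => /andP[_]; apply: le_lt_trans; rewrite -raddfB /=.
  by case: (l - u n) => a b /=; rewrite -sqrtr_sqr ler_wsqrtr// lerDr sqr_ge0.
apply/H => -[e e']; rewrite ltcE /= => /andP[/eqP -> e0].
have e2 : 0 < e / 2 by rewrite divr_gt0.
move/cvgrPdist_lt : ulr => /(_ _ e2) ulr; move/cvgrPdist_lt : uli => /(_ _ e2).
apply: filterS2 ulr => n; rewrite -!raddfB /= => h1 h2; rewrite ltcE /= eqxx /=.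
case: (l - u n) h1 h2 => a b /= h1 h2.
apply: (@le_lt_trans _ _ (`|a| + `|b|)); last by lra.
rewrite -[X in _ <= X]ger0_norm ?addr_ge0// -sqrtr_sqr ler_wsqrtr//.
rewrite -(real_normK (num_real a)) -(real_normK (num_real b)).
by have := normr_ge0 a; have := normr_ge0 b; nra.
Qed.

Lemma eq_ccvg u v l : (forall n, u n = v n) -> ccvg u l -> ccvg v l.
Proof. by move=> /funext ->. Qed.

Lemma ccvg_cst l : ccvg (fun=> l) l.
Proof. by split; exact: cvg_cst. Qed.

Lemma ccvgD u v l m : ccvg u l -> ccvg v m -> ccvg (fun n => u n + v n) (l + m).
Proof.
move=> [u1 u2] [v1 v2]; split.
  rewrite raddfD /= (_ : (fun n => _) = (fun n => complex.Re (u n)) + (fun n => complex.Re (v n))).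
    exact: cvgD.
  by apply/funext => n; rewrite raddfD.
rewrite raddfD /= (_ : (fun n => _) = (fun n => complex.Im (u n)) + (fun n => complex.Im (v n))).
  exact: cvgD.
by apply/funext => n; rewrite raddfD.
Qed.

Lemma ccvgZ (a : R[i]) u l : ccvg u l -> ccvg (fun n => a * u n) (a * l).
Proof.
case: a => a b [u1 u2]; split.
  rewrite (_ : complex.Re _ = a * complex.Re l - b * complex.Im l); last by case: l {u1 u2}.
  rewrite (_ : (fun n => _) = (fun n => a * complex.Re (u n)) - (fun n => b * complex.Im (u n))).
    by apply: cvgB; apply: cvgMl_tmp.
  by apply/funext => n; rewrite !fctE; case: (u n).
rewrite (_ : complex.Im _ = a * complex.Im l + b * complex.Re l); last by case: l {u1 u2}.
rewrite (_ : (fun n => _) = (fun n => a * complex.Im (u n)) + (fun n => b * complex.Re (u n))).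
  by apply: cvgD; apply: cvgMl_tmp.
by apply/funext => n; rewrite !fctE; case: (u n).
Qed.

Lemma ccvg_sum K (u : nat -> nat -> R[i]) (l : nat -> R[i]) :
  (forall b, ccvg (u b) (l b)) -> ccvg (fun n => \sum_(b < K) u b n) (\sum_(b < K) l b).
Proof.
move=> ul; elim: K => [|K IH].
  by rewrite big_ord0; apply: eq_ccvg (ccvg_cst 0) => n; rewrite big_ord0.
rewrite big_ord_recr /=; apply: eq_ccvg (ccvgD IH (ul K)) => n.
by rewrite big_ord_recr.
Qed.

Lemma ccvg_subseq (e : nat -> nat) u l : e @ \oo --> \oo -> ccvg u l -> ccvg (fun n => u (e n)) l.
Proof.
by move=> eo [u1 u2]; split; [exact: (cvg_comp _ _ eo u1)|exact: (cvg_comp _ _ eo u2)].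
Qed.

Lemma cmeas_cvg (h : nat -> R[i] -> R[i]) (f : R[i] -> R[i]) :
  (forall n, cmeas (h n)) ->
  (forall z, upper z -> ccvg (fun n => h n z) (f z)) -> cmeas f.
Proof.
move=> mh hf; split.
  apply: (measurable_fun_cvg (h := fun n p => complex.Re (h n (toC p)))).
    by move=> n; case: (mh n).
  by move=> p p0; case: (hf (toC p) p0).
apply: (measurable_fun_cvg (h := fun n p => complex.Im (h n (toC p)))).
  by move=> n; case: (mh n).
by move=> p p0; case: (hf (toC p) p0).
Qed.
End ComplexLimits.

Section Expansions.
Variable R : realType.
Implicit Types (F G : R[i] -> R[i]) (c : nat -> R[i]) (z w : R[i]).

(** Series start at e(z), so [c 0] does not enter and coefficients are determined only from index 1
    on. Convergence is that of the partial sums in their given order. *)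
Definition hasexp F c := forall z, upper z ->
  ccvg (series (fun n => c n.+1 * e2pi (n.+1%:R * z))) (F z).

Lemma eq_hasexp_coef F c d : (forall n, c n = d n) -> hasexp F c -> hasexp F d.
Proof. by move=> /funext ->. Qed.

Lemma eq_hasexp F G c : (forall z, upper z -> F z = G z) -> hasexp F c -> hasexp G c.
Proof. by move=> FG Fc z z0; rewrite -FG//; exact: Fc. Qed.

Lemma hasexp_cmeas F c : hasexp F c -> cmeas F.
Proof.
move=> Fc; apply: cmeas_cvg Fc => n; rewrite /series /=.
have : forall m, cmeas (fun z => \sum_(i < m) c i.+1 * e2pi (i.+1%:R * z)).
  move=> m; apply: cmeas_sum => i; apply: cmeasM; first exact: cmeas_cst.
  by apply: cmeas_e2pi; apply: cmeasM; [exact: cmeas_cst|exact: cmeas_id].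
by move=> /(_ n); apply: eq_cmeas => z _; rewrite big_mkord.
Qed.

Lemma hasexpD F G c d : hasexp F c -> hasexp G d -> hasexp (fun z => F z + G z) (fun n => c n + d n).
Proof.
move=> Fc Gd z z0; apply: eq_ccvg (ccvgD (Fc z z0) (Gd z z0)) => n; rewrite /series /=.
by rewrite -big_split; apply: eq_bigr => i _; rewrite mulrDl.
Qed.

Lemma hasexpZ a F c : hasexp F c -> hasexp (fun z => a * F z) (fun n => a * c n).
Proof.
move=> Fc z z0; apply: eq_ccvg (ccvgZ a (Fc z z0)) => n; rewrite /series /=.
by rewrite mulr_sumr; apply: eq_bigr => i _; rewrite mulrA.
Qed.

Lemma hasexp0 : hasexp (fun=> 0) (fun=> 0).
Proof.
move=> z z0; apply: eq_ccvg (ccvg_cst 0) => n.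
by rewrite /series /= big1// => i _; rewrite mul0r.
Qed.

Lemma hasexp_bigsum (I : Type) (s : seq I) (P : pred I) (F : I -> R[i] -> R[i])
    (c : I -> nat -> R[i]) : (forall i, P i -> hasexp (F i) (c i)) ->
  hasexp (fun z => \sum_(i <- s | P i) F i z) (fun m => \sum_(i <- s | P i) c i m).
Proof.
move=> Fc; elim: s => [|i s IH].
  apply: (eq_hasexp_coef (c := fun=> 0)); first by move=> n; rewrite big_nil.
  by apply: eq_hasexp hasexp0 => z _; rewrite big_nil.
have [Pi|nPi] := boolP (P i); last first.
  apply: (eq_hasexp_coef (c := fun m => \sum_(j <- s | P j) c j m)).
    by move=> n; rewrite big_cons (negPf nPi).
  by apply: eq_hasexp IH => z _; rewrite big_cons (negPf nPi).
apply: (eq_hasexp_coef (c := fun m => c i m + \sum_(j <- s | P j) c j m)).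
  by move=> n; rewrite big_cons Pi.
by apply: eq_hasexp (hasexpD (Fc _ Pi) IH) => z _; rewrite big_cons Pi.
Qed.

Lemma hasexp_shift (b : R) F c : hasexp F c ->
  hasexp (fun z => F (z + b%:C)) (fun n => c n * e2pi (n%:R * b%:C)).
Proof.
move=> Fc z z0; have z1 : upper (z + b%:C) by move: z0; rewrite /upper; case: z => ? ? /=; rewrite addr0.
apply: eq_ccvg (Fc _ z1) => n; rewrite /series /=.
by apply: eq_bigr => i _; rewrite mulrDr e2piD; ring.
Qed.

Lemma upper_natM (a : nat) z : (0 < a)%N -> upper z -> upper (a%:R * z).
Proof. by move=> a0; rewrite /upper /= natC Im_realM => z0; rewrite mulr_gt0// ltr0n. Qed.

Lemma cvg_divn (a : nat) : (0 < a)%N -> (fun n => n %/ a)%N @ \oo --> \oo.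
Proof.
move=> a0 A [m _ mA]; exists (m * a)%N => // n /= mn.
by apply: mA; rewrite /= leq_divRL.
Qed.

Lemma cvg_muln (a : nat) : (0 < a)%N -> (fun n => a * n)%N @ \oo --> \oo.
Proof.
move=> a0 A [m _ mA]; exists m => // n /= mn.
by apply: mA; rewrite /= (leq_trans mn)// leq_pmull.
Qed.

(** Partial sums are matched exactly, as no absolute convergence is assumed: the first n terms after
    dilation are the first n %/ a terms before it. *)
Lemma hasexp_dilate (a : nat) F c : (0 < a)%N -> hasexp F c ->
  hasexp (fun z => F (a%:R * z)) (fun n => if (a %| n)%N then c (n %/ a)%N else 0).
Proof.
move=> a0 Fc z z0.
apply: eq_ccvg (ccvg_subseq (cvg_divn a0) (Fc _ (upper_natM a0 z0))) => n; rewrite /series /=.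
elim: n => [|n IH]; first by rewrite div0n !big_geq//.
rewrite big_nat_recr//= -IH divnS// ; case: ifP => an; last by rewrite add0n mul0r addr0.
rewrite add1n big_nat_recr//=; congr (_ + _ * e2pi _).
  by congr c; rewrite an add1n.
rewrite mulrA -natrM; congr (_%:R * _).
by have := divnK an; rewrite divnS// an add1n.
Qed.

(** Averaging over the d translates kills the exponents prime to or not divisible by d, so the first
    d n terms before averaging give the first n terms after it. *)
Lemma hasexp_decimate (d : nat) F c : (0 < d)%N -> hasexp F c ->
  hasexp (fun z => d%:R^-1 * \sum_(b < d) F ((z + b%:R) / d%:R)) (fun n => c (d * n)%N).
Proof.
move=> d0 Fc z z0.
have dC : d%:R != 0 :> R[i] by rewrite pnatr_eq0 -lt0n.
have zb (b : nat) : upper ((z + b%:R) / d%:R).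
  rewrite /upper /= mulrC (_ : d%:R^-1 = (d%:R^-1 : R)%:C); last by rewrite natC fmorphV.
  rewrite Im_realM mulr_gt0 ?invr_gt0 ?ltr0n//.
  by move: z0; rewrite /upper natC; case: (z) => ? ? /=; rewrite addr0.
apply: eq_ccvg (ccvgZ d%:R^-1 (ccvg_sum (u := fun b n => _) d (fun b => ccvg_subseq (cvg_muln d0) (Fc _ (zb b))))) => n.
rewrite /series /=.
rewrite exchange_big /=.
have E i : \sum_(b < d) c i.+1 * e2pi (i.+1%:R * ((z + b%:R) / d%:R)) =
    if (d %| i.+1)%N then d%:R * (c i.+1 * e2pi ((i.+1 %/ d)%:R * z)) else 0.
  rewrite -mulr_sumr.
  under eq_bigr do rewrite mulrDl mulrDr e2piD.
  rewrite -mulr_sumr sum_e2pi//; case: ifP => [di|]; last by rewrite !mulr0.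
  rewrite mulrA [RHS]mulrC; congr (_ * e2pi _ * _).
  by rewrite -{1}(divnK di) natrM; field.
under eq_bigr do rewrite E.
elim: n => [|n IH]; first by rewrite muln0 !big_geq// mulr0.
rewrite big_nat_recr//= -IH mulnS addnC.
rewrite (big_cat_nat _ (n := (d * n)%N))//= ?leq_addr// mulrDr; congr (_ + _).
rewrite -{1}[(d * n)%N]add0n big_addn addKn.
case: d d0 dC {zb E IH} => // d _ dC.
rewrite big_nat_recr//= big1_seq ?add0r; last first.
  move=> i; rewrite mem_index_iota => /andP[_ /andP[_ id]].
  rewrite ifF//; apply/negbTE; rewrite -addSn dvdn_addl ?dvdn_mulr//.
  by rewrite gtnNdvd.
rewrite -addSn -mulnS mulnC dvdn_mull// mulnK//.
by rewrite mulKf//; congr (c _ * _); rewrite mulnC mulnSr.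
Qed.

Lemma cusp_hasexp k N f g : (0 < N)%N -> cusp_form k N f -> SL2Z g ->
  exists b, hasexp (fun z => slash k f g (N%:R * z)) b.
Proof.
move=> N0 [_ _ _ /(_ g)] + Sg => /(_ Sg)[b hb]; exists b => z z0.
have /ccvgP := hb _ (upper_natM N0 z0); apply: eq_ccvg => n; rewrite /series /=.
by apply: eq_bigr => i _; congr (_ * e2pi _); field; rewrite pnatr_eq0 -lt0n.
Qed.

(** The terms of a convergent series are bounded; this is that remark at the point i y. *)
Lemma hasexp_bound F c (y : R) : hasexp F c -> 0 < y ->
  exists2 B : R, 0 <= B & forall n, sqC (c n.+1) <= B * expR (4 * pi * y * n.+1%:R).
Proof.
move=> Fc y0; have z0 : upper (0 +i* y) by [].
have [h1 h2] := Fc _ z0.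
have bnd (u : nat -> R) (l : R) : series u @ \oo --> l -> exists2 B : R, 0 <= B & forall n, u n ^+ 2 <= B.
  move=> ul; have u0 : u @ \oo --> 0 by apply: cvg_series_cvg_0; apply/cvg_ex; exists l.
  have : bounded_fun u by apply: cvg_seq_bounded; apply/cvg_ex; exists 0.
  move=> [M [Mr hM]]; exists ((`|M| + 1) ^+ 2); first exact: sqr_ge0.
  move=> n; have /(_ (ltr_pwDr ltr01 (ler_norm M)) n I) := hM (`|M| + 1).
  rewrite -(real_normK (num_real (u n))) /= => h.
  by rewrite ler_sqr// nnegrE// addr_ge0.
have e1 : (fun n => complex.Re (series (fun n => c n.+1 * e2pi (n.+1%:R * (0 +i* y))) n)) =
    series (fun n => complex.Re (c n.+1 * e2pi (n.+1%:R * (0 +i* y)))).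
  by apply/funext => n; rewrite /series /= raddf_sum.
have e2 : (fun n => complex.Im (series (fun n => c n.+1 * e2pi (n.+1%:R * (0 +i* y))) n)) =
    series (fun n => complex.Im (c n.+1 * e2pi (n.+1%:R * (0 +i* y)))).
  by apply/funext => n; rewrite /series /= raddf_sum.
rewrite e1 in h1; rewrite e2 in h2.
have [B1 B10 hB1] := bnd _ _ h1; have [B2 B20 hB2] := bnd _ _ h2.
exists (B1 + B2); first exact: addr_ge0.
move=> n; have : sqC (c n.+1 * e2pi (n.+1%:R * (0 +i* y))) <= B1 + B2 by apply: lerD.
rewrite sqCM sqC_e2pi natC Im_realM /= -expRM_natr -ler_pdivlMr ?expR_gt0// -expRN.
by congr (_ <= _ * expR _); ring.
Qed.

(** * Trigonometric polynomials and Bessel's inequality *)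

Definition per (n : nat) (x : R) : R[i] := cos (2 * pi * n%:R * x) +i* sin (2 * pi * n%:R * x).

Definition unitI : set R := `[(- 2^-1 : R), 2^-1]%classic.
Notation mu := (@lebesgue_measure R).

Lemma measurable_unitI : measurable (unitI : set (measurableTypeR R)).
Proof. exact: measurable_itv. Qed.

Lemma integrable_cont (u : R -> R) : continuous u -> mu.-integrable unitI (EFin \o u).
Proof.
move=> cu; apply: continuous_compact_integrable; first exact: segment_compact.
by apply: continuous_subspaceT => x; exact: cu.
Qed.

Lemma integral_FTC (u U : R -> R) : continuous u -> (forall x : R, is_derive x (1 : R) U (u x)) ->
  \int[mu]_(x in unitI) u x = U 2^-1 - U (- 2^-1).
Proof.
move=> cu dU; rewrite /Rintegral (@continuous_FTC2 _ u U)//.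
- by lra.
- by apply: continuous_subspaceT => x; exact: cu.
- have cU x : {for x, continuous U}.
    by apply: differentiable_continuous; apply/derivable1_diffP; case: (dU x).
  split; first by move=> x _; case: (dU x).
    by apply: cvg_at_right_filter; exact: cU.
  by apply: cvg_at_left_filter; exact: cU.
- by move=> x _; rewrite derive1E; case: (dU x).
Qed.

Lemma sin_int (m : int) : sin (pi * m%:~R) = 0 :> R.
Proof.
have H (n : nat) : sin (pi * n%:R) = 0 :> R.
  elim: n => [|n IH]; first by rewrite mulr0 sin0.
  by rewrite -addn1 natrD mulrDr mulr1 sinD IH sinpi mul0r mulr0 addr0.
by case: m => n; rewrite ?NegzE ?mulrNz ?mulrN ?sinN H ?oppr0.
Qed.

Lemma continuous_cosM (a : R) : continuous (fun x : R => cos (a * x)).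
Proof.
by move=> x; apply: continuous_comp; [exact: mulrl_continuous|exact: continuous_cos].
Qed.

Lemma continuous_sinM (a : R) : continuous (fun x : R => sin (a * x)).
Proof.
by move=> x; apply: continuous_comp; [exact: mulrl_continuous|exact: continuous_sin].
Qed.

Lemma is_derive1_scale (a x : R) (u : R -> R) (du : R) : is_derive x (1 : R) u du ->
  is_derive x (1 : R) (fun t => a * u t) (a * du).
Proof. by move=> h; exact: (is_deriveZ a). Qed.

Lemma is_derive1_mul (a x : R) : is_derive x (1 : R) (fun t => a * t) a.
Proof. by rewrite -[X in is_derive _ _ _ X]mulr1; apply: is_derive1_scale; exact: is_derive_id. Qed.

Lemma integral_cos_int (m : int) : m != 0 ->
  \int[mu]_(x in unitI) cos (2 * pi * m%:~R * x) = 0.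
Proof.
move=> m0; have a0 : 2 * pi * m%:~R != 0 :> R by rewrite !mulf_neq0// ?intr_eq0// gt_eqF// pi_gt0.
set a := 2 * pi * m%:~R in a0 *.
have dU (x : R) : is_derive x (1 : R) (fun x => a^-1 * sin (a * x)) (cos (a * x)).
  have h : is_derive x (1 : R) (fun x => sin (a * x)) (cos (a * x) * a).
    apply: (is_derive1_comp (f := @sin R) (g := fun t => a * t)); exact: is_derive1_mul.
  have := is_derive1_scale a^-1 h.
  by rewrite mulrCA mulVf// mulr1.
rewrite (integral_FTC (@continuous_cosM a) dU).
rewrite mulrN sinN (_ : a * 2^-1 = pi * m%:~R :> R); last by rewrite /a; field.
by rewrite sin_int oppr0 subrr.
Qed.

Lemma integral_sin_int (m : int) :
  \int[mu]_(x in unitI) sin (2 * pi * m%:~R * x) = 0.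
Proof.
have [->|m0] := eqVneq m 0.
  under eq_Rintegral do rewrite mulr0 mul0r sin0.
  by rewrite /Rintegral integral0.
have a0 : 2 * pi * m%:~R != 0 :> R by rewrite !mulf_neq0// ?intr_eq0// gt_eqF// pi_gt0.
set a := 2 * pi * m%:~R in a0 *.
have dU (x : R) : is_derive x (1 : R) (fun x => - a^-1 * cos (a * x)) (sin (a * x)).
  have h : is_derive x (1 : R) (fun x => cos (a * x)) (- sin (a * x) * a).
    apply: (is_derive1_comp (f := @cos R) (g := fun t => a * t)); exact: is_derive1_mul.
  have := is_derive1_scale (- a^-1) h.
  by rewrite (_ : - a^-1 * (- sin (a * x) * a) = sin (a * x))//; field.
rewrite (integral_FTC (@continuous_sinM a) dU).
by rewrite mulrN cosN subrr.
Qed.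

Lemma contD (u v : R -> R) : continuous u -> continuous v -> continuous (fun x => u x + v x).
Proof. by move=> cu cv x; apply: (@continuousD _ _ _ u v x); [exact: cu|exact: cv]. Qed.

Lemma contM (u v : R -> R) : continuous u -> continuous v -> continuous (fun x => u x * v x).
Proof. by move=> cu cv x; apply: (@continuousM _ _ u v x); [exact: cu|exact: cv]. Qed.

Lemma contC (a : R) : continuous (fun _ : R => a).
Proof. by move=> x; exact: cst_continuous. Qed.

Lemma RintD (u v : R -> R) : continuous u -> continuous v ->
  \int[mu]_(x in unitI) (u x + v x) = \int[mu]_(x in unitI) u x + \int[mu]_(x in unitI) v x.
Proof.
by move=> cu cv; apply: RintegralD; [exact: measurable_unitI|exact: integrable_cont|exact: integrable_cont].
Qed.

Lemma RintZ (a : R) (u : R -> R) : continuous u ->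
  \int[mu]_(x in unitI) (a * u x) = a * \int[mu]_(x in unitI) u x.
Proof.
by move=> cu; apply: RintegralZl; [exact: measurable_unitI|exact: integrable_cont].
Qed.

Lemma integral_trig0 K (a b : nat -> R) (m : nat -> int) : (forall n, (n < K)%N -> m n != 0) ->
  continuous (fun x : R => \sum_(n < K) (a n * cos (2 * pi * (m n)%:~R * x) + b n * sin (2 * pi * (m n)%:~R * x))) /\
  \int[mu]_(x in unitI) \sum_(n < K) (a n * cos (2 * pi * (m n)%:~R * x) + b n * sin (2 * pi * (m n)%:~R * x)) = 0.
Proof.
elim: K => [|K IH] mK.
  split; first by under eq_fun do rewrite big_ord0; exact: contC.
  by under eq_Rintegral do rewrite big_ord0; rewrite /Rintegral integral0.
have [c1 i1] := IH (fun n nK => mK n (ltnW nK)).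
have ca : continuous (fun x : R => a K * cos (2 * pi * (m K)%:~R * x)).
  by apply: contM; [exact: contC|exact: continuous_cosM].
have cb : continuous (fun x : R => b K * sin (2 * pi * (m K)%:~R * x)).
  by apply: contM; [exact: contC|exact: continuous_sinM].
split.
  under eq_fun do rewrite big_ord_recr /=.
  by apply: contD => //; exact: contD.
under eq_Rintegral do rewrite big_ord_recr /=.
rewrite RintD//; last exact: contD.
rewrite i1 RintD// RintZ; last exact: continuous_cosM.
rewrite RintZ; last exact: continuous_sinM.
by rewrite integral_cos_int ?mK// integral_sin_int !mulr0 !addr0.
Qed.

Definition trigpoly (d : nat -> R[i]) K (x : R) : R[i] := \sum_(n < K) d n * per n.+1 x.

Lemma continuous_trigpoly d K : continuous (fun x => complex.Re (trigpoly d K x)) /\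
  continuous (fun x => complex.Im (trigpoly d K x)).
Proof.
have H (e : R[i]) n : continuous (fun x => complex.Re (e * per n x)) /\ continuous (fun x => complex.Im (e * per n x)).
  case: e => a b; rewrite /per /=; split.
    under eq_fun do rewrite -mulNr.
    by apply: contD; apply: contM; [exact: contC|exact: continuous_cosM|exact: contC|exact: continuous_sinM].
  by apply: contD; apply: contM; [exact: contC|exact: continuous_sinM|exact: contC|exact: continuous_cosM].
elim: K => [|K [IH1 IH2]]; rewrite /trigpoly.
  by split; under eq_fun do rewrite big_ord0 /=; exact: contC.
have [h1 h2] := H (d K) K.+1.
by split; under eq_fun do rewrite big_ord_recr raddfD /=; exact: contD.
Qed.

Lemma continuous_sq_trigpoly d K : continuous (fun x => sqC (trigpoly d K x)).
Proof.
have [h1 h2] := continuous_trigpoly d K; rewrite /sqC.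
by under eq_fun do rewrite !expr2; apply: contD; exact: contM.
Qed.

(** Induction on the number of terms: the cross terms of the new frequency K + 1 with an old one n +
    1 have frequency n - K, which is nonzero, and integrate to 0. *)
Lemma integral_sq_trigpoly d K :
  \int[mu]_(x in unitI) sqC (trigpoly d K x) = \sum_(n < K) sqC (d n).
Proof.
elim: K => [|K IH].
  rewrite big_ord0; under eq_Rintegral do rewrite /trigpoly big_ord0 sqC0.
  by rewrite /Rintegral integral0.
pose a n := 2 * (complex.Re (d n) * complex.Re (d K) + complex.Im (d n) * complex.Im (d K)).
pose b n := 2 * (complex.Re (d n) * complex.Im (d K) - complex.Im (d n) * complex.Re (d K)).
pose m n : int := n%:Z - K%:Z.
have mK n : (n < K)%N -> m n != 0 by rewrite /m; lia.
have [c1 i1] := integral_trig0 a b mK.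
have E x : sqC (trigpoly d K.+1 x) = (sqC (trigpoly d K x) + sqC (d K)) +
    \sum_(n < K) (a n * cos (2 * pi * (m n)%:~R * x) + b n * sin (2 * pi * (m n)%:~R * x)).
  have sp n : sqC (per n x) = 1 by rewrite /sqC /per /= cos2Dsin2.
  have sqD (u v : R[i]) : sqC (u + v) = sqC u + sqC v +
      2 * (complex.Re u * complex.Re v + complex.Im u * complex.Im v).
    by case: u v => ? ? [? ?]; rewrite /sqC /=; ring.
  rewrite /trigpoly big_ord_recr /= sqD sqCM sp mulr1; congr (_ + _).
  rewrite !raddf_sum /= !mulr_suml -big_split /= mulr_sumr; apply: eq_bigr => n _.
  have -> : 2 * pi * (m n)%:~R * x = 2 * pi * n.+1%:R * x - 2 * pi * K.+1%:R * x.
    by rewrite /m intrB -!pmulrn -!natr1; ring.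
  rewrite cosB sinB /a /b /per.
  by case: (d n) (d K) => ? ? [? ?] /=; ring.
under eq_Rintegral do rewrite E.
have cq := (@continuous_sq_trigpoly d K).
rewrite RintD//; last by apply: contD => //; exact: contC.
rewrite i1 addr0 RintD//; last exact: contC.
rewrite IH big_ord_recr /=; congr (_ + _).
rewrite Rintegral_cst; last exact: measurable_unitI.
have mu1 : mu unitI = 1%E.
  have := lebesgue_measure_itv `[(- 2^-1 : R), 2^-1].
  rewrite /= lte_fin ifT; last by lra.
  by move=> ->; rewrite -EFinD; congr (_%:E); field.
rewrite -[RHS]mulr1; congr (_ * _); exact: (congr1 fine mu1).
Qed.

Lemma e2pi_per n (x y : R) : e2pi (n%:R * (x +i* y)) = (expR (- (2 * pi * n%:R * y)))%:C * per n x.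
Proof. by rewrite /e2pi natC Im_realM Re_realM /per /= !mulrA. Qed.

Section Bessel.
Variables (F : R[i] -> R[i]) (c : nat -> R[i]) (y : R).
Hypotheses (Fc : hasexp F c) (y0 : 0 < y).

Let d n := c n.+1 * (expR (- (2 * pi * n.+1%:R * y)))%:C.

Let dE n : sqC (d n) = sqC (c n.+1) * expR (- (4 * pi * n.+1%:R * y)).
Proof.
rewrite /d sqCM sqC_real -expRM_natr; congr (_ * expR _); ring.
Qed.

Let cvg_trig x : ccvg (fun K => trigpoly d K x) (F (x +i* y)).
Proof.
have z0 : upper (x +i* y) by [].
apply: eq_ccvg (Fc z0) => K; rewrite /series /trigpoly /= big_mkord.
by apply: eq_bigr => n _; rewrite e2pi_per mulrA.
Qed.

(** Convergence at height y / 2 bounds the squared coefficients by B e^(2 pi y n); against the decay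
    e^(-4 pi y n) at height y this leaves the terms dominated by a geometric series of ratio e^(-pi
    y). *)
Let bound : exists C : R, forall K x, sqC (trigpoly d K x) <= C.
Proof.
have y2 : 0 < y / 2 by rewrite divr_gt0.
have [B B0 hB] := hasexp_bound Fc y2.
pose rho : R := expR (- (pi * y)).
have rho0 : 0 < rho by exact: expR_gt0.
have rho1 : rho < 1 by rewrite /rho -[X in _ < X]expR0 ltr_expR oppr_lt0 mulr_gt0// pi_gt0.
have hd n : sqC (d n) <= (Num.sqrt B * rho ^+ n) ^+ 2.
  rewrite dE exprMn sqr_sqrtr//.
  have le1 : rho ^+ n.+1 <= rho ^+ n by rewrite exprS ger_pMl ?exprn_gt0// ltW.
  apply: (@le_trans _ _ (B * (rho ^+ n.+1) ^+ 2)); last first.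
    by rewrite ler_wpM2l// ler_sqr// nnegrE exprn_ge0// ltW.
  apply: (le_trans (ler_wpM2r (expR_ge0 _) (hB n))).
  rewrite -[X in X <= _]mulrA ler_wpM2l// -expRD /rho -!expRM_natr ler_expR le_eqVlt; apply/orP; left; apply/eqP.
  by field.
pose C0 := Num.sqrt B / (1 - rho).
have gs K : \sum_(n < K) Num.sqrt B * rho ^+ n <= C0.
  rewrite -mulr_sumr /C0 ler_wpM2l ?sqrtr_ge0//.
  rewrite -[X in _ <= X]mul1r ler_pdivlMr ?subr_gt0// mulrC.
  have := subrX1 rho K; have : 0 <= rho ^+ K by rewrite exprn_ge0// ltW.
  by move=> h1 h2; nra.
have hRe n x : `|complex.Re (d n * per n.+1 x)| <= Num.sqrt B * rho ^+ n.
  rewrite -ler_sqr ?nnegrE ?mulr_ge0 ?sqrtr_ge0 ?exprn_ge0 ?(ltW rho0)// real_normK ?num_real//.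
  apply: le_trans (hd n); have <- : sqC (d n * per n.+1 x) = sqC (d n).
    by rewrite sqCM /per {2}/sqC /= cos2Dsin2 mulr1.
  by rewrite /sqC lerDl sqr_ge0.
have hIm n x : `|complex.Im (d n * per n.+1 x)| <= Num.sqrt B * rho ^+ n.
  rewrite -ler_sqr ?nnegrE ?mulr_ge0 ?sqrtr_ge0 ?exprn_ge0 ?(ltW rho0)// real_normK ?num_real//.
  apply: le_trans (hd n); have <- : sqC (d n * per n.+1 x) = sqC (d n).
    by rewrite sqCM /per {2}/sqC /= cos2Dsin2 mulr1.
  by rewrite /sqC lerDr sqr_ge0.
have C00 : 0 <= C0 by rewrite divr_ge0 ?sqrtr_ge0// subr_ge0 ltW.
exists (C0 ^+ 2 + C0 ^+ 2) => K x; rewrite /sqC /trigpoly !raddf_sum /=.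
apply: lerD; rewrite -(real_normK (num_real _)) ler_sqr ?nnegrE//;
  apply: le_trans (ler_norm_sum _ _ _) _; apply: le_trans (gs K); exact: ler_sum.
Qed.

(** Parseval holds for the partial sums, and their uniform bound allows dominated convergence on the
    unit interval; dropping all but M terms leaves the inequality. *)
Lemma bessel M :
  ((\sum_(n < M) sqC (c n.+1) * expR (- (4 * pi * n.+1%:R * y)))%:E <=
   \int[mu]_(x in unitI) (sqC (F (x +i* y)))%:E)%E.
Proof.
have [C hC] := bound.
have mK K : measurable_fun unitI (fun x => sqC (trigpoly d K x)).
  by apply: measurable_funTS; apply: continuous_measurable_fun; exact: continuous_sq_trigpoly.
have cF x : (fun K => sqC (trigpoly d K x)) @ \oo --> sqC (F (x +i* y)).
  have [h1 h2] := cvg_trig x; rewrite /sqC.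
  by under eq_fun do rewrite !expr2; rewrite !expr2; apply: cvgD; exact: cvgM.
have mF : measurable_fun unitI (fun x => sqC (F (x +i* y))).
  by apply: (measurable_fun_cvg mK) => x _; exact: cF.
pose f_ K x := (sqC (trigpoly d K x))%:E; pose f x := (sqC (F (x +i* y)))%:E.
have m1 K : measurable_fun unitI (f_ K) by apply/measurable_EFinP; exact: mK.
have m2 : measurable_fun unitI f by apply/measurable_EFinP; exact: mF.
have a1 : {ae mu, forall x, unitI x -> f_ ^~ x @ \oo --> f x}.
  by apply: aeW => x _; apply/fine_cvgP; split; [exact: nearW|exact: cF].
have a2 : {ae mu, forall x n, unitI x -> (`|f_ n x| <= C%:E)%E}.
  by apply: aeW => x n _; rewrite /f_ /= lee_fin ger0_norm// sqC_ge0.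
have [_ _ h] := @dominated_convergence _ _ R mu unitI measurable_unitI f_ f (fun=> C%:E) m1 m2 a1
  (integrable_cont (@contC C)) a2.
have iK K : (\int[mu]_(x in unitI) f_ K x = (\sum_(n < K) sqC (d n))%:E)%E.
  rewrite -integral_sq_trigpoly /Rintegral fineK//.
  apply: integrable_fin_num; first exact: measurable_unitI.
  by apply: integrable_cont; exact: continuous_sq_trigpoly.
rewrite -(cvg_lim _ h)//; apply: lime_ge; first by apply/cvg_ex; eexists; exact: h.
exists M => // K /= MK; rewrite iK lee_fin.
rewrite (eq_bigr (fun n : 'I_M => sqC (d n))); last by move=> n _; rewrite dE.
rewrite -!(big_mkord xpredT (fun n => sqC (d n))) [X in _ <= X](big_cat_nat _ (n := M))//= lerDl.
by apply: sumr_ge0 => n _; exact: sqC_ge0.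
Qed.
End Bessel.

(** Bessel's inequality for the zero function, at height 1. This is the source of the uniqueness of
    Fourier coefficients. *)
Lemma hasexp0_coef c : hasexp (fun=> 0) c -> forall n, c n.+1 = 0.
Proof.
move=> h n; have := bessel h ltr01 n.+1.
rewrite [X in (_ <= X)%E]integral0_eq; last by move=> x _; rewrite sqC0.
rewrite lee_fin => h0; apply/eqP; rewrite -sqC_eq0.
have : sqC (c n.+1) * expR (- (4 * pi * n.+1%:R * 1)) <= 0.
  apply: le_trans h0; rewrite big_ord_recr /= lerDr sumr_ge0// => i _.
  by rewrite mulr_ge0 ?sqC_ge0 ?expR_ge0.
rewrite pmulr_lle0 ?expR_gt0// => h1.
by rewrite eq_le h1 sqC_ge0.
Qed.

Lemma hasexp_unique F c d : hasexp F c -> hasexp F d -> forall n, c n.+1 = d n.+1.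
Proof.
move=> Fc Fd n; have h := hasexpD Fc (hasexpZ (-1) Fd).
have {}h : hasexp (fun=> 0) (fun n => c n + -1 * d n).
  by apply: eq_hasexp h => z _; rewrite mulN1r subrr.
by have /eqP := hasexp0_coef h n; rewrite mulN1r subr_eq0 => /eqP.
Qed.

End Expansions.

(** * Coset representatives *)

Section Cosets.
Implicit Types (m g h : 'M[int]_2) (N n p : nat).

Lemma int_mul_eq1 (e f : int) : e * f = 1 -> (e = 1 /\ f = 1) \/ (e = -1 /\ f = -1).
Proof.
move=> ef; have := congr1 absz ef; rewrite abszM => /eqP; rewrite muln_eq1 => /andP[/eqP e1 /eqP f1].
have [eE|eE] : e = 1 \/ e = -1 by lia.
  by left; move: ef; rewrite eE; lia.
by right; move: ef; rewrite eE; lia.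
Qed.

Lemma mulmx2_inj r : \det r != 0 -> injective (fun g : 'M[int]_2 => g *m r).
Proof.
move=> dr g h /(congr1 (fun x => x *m adj2 r)); rewrite -!mulmxA mul_adj2 !mul_mx_scalar.
move=> e; apply/matrixP => i j; have := congr1 (fun x : 'M[int]_2 => x i j) e.
by rewrite !mxE => /(mulfI dr).
Qed.

(** Hermite normal form: Bezout coefficients of the first column give a unimodular matrix that
    clears the lower left entry. *)
Lemma triangular m : 0 < \det m -> exists h, exists a b d : int,
  [/\ SL2Z h, 0 < a, 0 < d & m = h *m mx2 a b 0 d].
Proof.
move=> dm; pose a := gcdz (m 0 0) (m 1 0).
have a0 : a != 0.
  apply/negP; rewrite gcdz_eq0 => /andP[/eqP m00 /eqP m10].
  by move: dm; rewrite det2 m00 m10 mul0r mulr0 subrr ltxx.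
have agt0 : 0 < a by rewrite lt_neqAle eq_sym a0 /a.
have [u [v uv]] := Bezoutz (m 0 0) (m 1 0); rewrite -/a in uv.
have /dvdzP[x xE] : (a %| (m 0 0)%R)%Z by exact: dvdz_gcdl.
have /dvdzP[y yE] : (a %| (m 1 0)%R)%Z by exact: dvdz_gcdr.
pose hi := mx2 u v (- y) x.
have dhi : \det hi = 1.
  rewrite det2 !mx2E; apply: (mulfI a0); rewrite mulr1 -[RHS]uv xE yE; ring.
pose b := u * m 0 1 + v * m 1 1; pose d := - y * m 0 1 + x * m 1 1.
have him : hi *m m = mx2 a b 0 d.
  apply: mx2_eq; rewrite mulmx2 !mx2E; [exact: uv|by []| |by []].
  by rewrite xE yE; ring.
exists (adj2 hi), a, b, d; split => //.
- by rewrite /SL2Z/= det_adj2.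
- have : 0 < \det (hi *m m) by rewrite det_mulmx dhi mul1r.
  by rewrite him det2 !mx2E mulr0 subr0 pmulr_rgt0.
- by rewrite -him mulmxA mul_adj2l dhi mul1mx.
Qed.

(** The quotient of the two group elements is upper triangular, and positivity of the diagonals
    makes it a translation; b and b' being reduced modulo the same d makes the translation
    trivial. *)
Lemma tri_inj (N : nat) g g' (a b d a' b' d' : int) :
  Gamma0 N g -> Gamma0 N g' -> 0 < a -> 0 < a' -> 0 < d ->
  0 <= b < d -> 0 <= b' < d' ->
  g *m mx2 a b 0 d = g' *m mx2 a' b' 0 d' -> [/\ g = g', a = a', b = b' & d = d'].
Proof.
move=> Gg Gg' a0 a0' d0 hb hb' e.
pose h := adj2 g' *m g.
have hE : h *m mx2 a b 0 d = mx2 a' b' 0 d'.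
  by rewrite /h -mulmxA e mulmxA (mul_adj_Gamma0 Gg') mul1mx.
have dh : h 0 0 * h 1 1 - h 0 1 * h 1 0 = 1.
  by rewrite -det2 /h det_mulmx det_adj2 (Gamma0_det Gg) (Gamma0_det Gg') mulr1.
have E i j := congr1 (fun x : 'M[int]_2 => x i j) hE.
have gE : g = g' *m h by rewrite /h mulmxA (mul_Gamma0_adj Gg') mul1mx.
clearbody h; have := E 0 0; have := E 0 1; have := E 1 0; have := E 1 1; rewrite !mulmx2 !mx2E !mulr0 !addr0.
move=> e11 /eqP; rewrite mulf_eq0 (gt_eqF a0) orbF => /eqP c0 e01 e00.
rewrite c0 mulr0 subr0 in dh; rewrite c0 mul0r add0r in e11.
have [[h0 h1]|[h0 h1]] := int_mul_eq1 dh; last by move: e00; rewrite h0; lia.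
rewrite h0 mul1r in e00; rewrite h1 mul1r in e11; rewrite h0 mul1r in e01.
have f0 : h 0 1 = 0 by move: hb hb' e01; rewrite -e11; move: (h 0 1) => f; nia.
have h1E : h = 1%:M by apply: mx2_eq; rewrite !mxE /=.
split => //; last by move: e01; rewrite f0 mul0r addr0.
by rewrite gE h1E mulmx1.
Qed.

Definition heckeSet N n : set 'M[int]_2 := [set m | \det m = n%:Z /\ (N%:Z %| (m 1 0)%R)%Z].

Definition heckeP n (x : 'I_n.+1 * 'I_n) := [&& (0 < x.1)%N, (x.1 %| n)%N & (x.2 < n %/ x.1)%N].
Definition heckeI n := {x : 'I_n.+1 * 'I_n | heckeP x}.
Definition heckeR n (x : 'I_n.+1 * 'I_n) : 'M[int]_2 :=
  mx2 (x.1 : nat)%:Z (x.2 : nat)%:Z 0 (n %/ x.1)%N%:Z.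

Lemma heckeSet_bij N n : (0 < n)%N -> coprime n N ->
  set_bij ([set: heckeI n] `*`` (fun=> Gamma0 N)) (heckeSet N n)
    (fun x => x.2 *m heckeR (val x.1)).
Proof.
move=> n0 nN; split.
- move=> [[[a b] /= ab] g] [_ /= Gg]; have /and3P[/= a0 an bd] := ab.
  split; last by rewrite mulmx2 !mx2E mulr0 addr0; apply: dvdz_mulr; case: Gg.
  rewrite det_mulmx (Gamma0_det Gg) mul1r det2 !mx2E mulr0 subr0.
  by rewrite -PoszM mulnC divnK.
- move=> [[[a b] ab] g] [[[a' b'] ab'] g'] /[!inE] [[_ /= Gg]] [_ /= Gg'].
  have /and3P[/= a0 an bd] := ab; have /and3P[/= a0' an' bd'] := ab'.
  have dd : (0 < n %/ a)%N by rewrite divn_gt0// dvdn_leq.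
  rewrite /heckeR /= => /(tri_inj Gg Gg') [].
  + by rewrite ltz_nat.
  + by rewrite ltz_nat.
  + by rewrite ltz_nat.
  + by rewrite lez_nat ltz_nat.
  + by rewrite lez_nat ltz_nat.
  + move=> -> /eqP; rewrite eqz_nat => /eqP aE /eqP; rewrite eqz_nat => /eqP bE _.
    by congr (_, _); apply: val_inj; congr (_, _); apply: val_inj.
- move=> m [dm mN].
  have dm0 : 0 < \det m by rewrite dm ltz_nat.
  have [h [a [b [d [Sh a0 d0 mE]]]]] := triangular dm0.
  have ad : a * d = n%:Z.
    by rewrite -dm mE det_mulmx Sh mul1r det2 !mx2E mulr0 subr0.
  have an : (absz a %| n)%N by apply/dvdnP; exists (absz d); move: ad; nia.
  (* The lower left entry of m is that of h times a, and a is prime to N. *)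
  have Gh : Gamma0 N h.
    split=> //; move: mN; rewrite mE mulmx2 !mx2E mulr0 addr0.
    rewrite Gauss_dvdzl//; rewrite coprimezE coprime_sym; exact: coprime_dvdl an nN.
  have bd : 0 <= (b %% d)%Z < d by rewrite modz_ge0 ?ltz_pmod// gt_eqF.
  have abs_a : (absz a < n.+1)%N by rewrite ltnS dvdn_leq.
  have dE : (n %/ absz a)%N%:Z = d.
    have : (n = absz d * absz a)%N by move: ad; nia.
    by move=> ->; rewrite mulnK; lia.
  have abs_b : (absz (b %% d)%Z < n)%N.
    have : (absz d <= n)%N by apply: dvdn_leq => //; apply/dvdnP; exists (absz a); move: ad; nia.
    by move: bd; lia.
  have P : heckeP (Ordinal abs_a, Ordinal abs_b).
    apply/and3P; split => /=; [by lia|by []|].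
    by rewrite -ltz_nat dE; move: bd; lia.
  (* Reducing b modulo d costs a translation by b div d, which joins the group element. *)
  exists (exist _ (Ordinal abs_a, Ordinal abs_b) P : heckeI n, h *m transl (b %/ d)%Z).
    by split => //; exact: Gamma0M Gh (Gamma0_transl N _).
  rewrite /= /heckeR /= dE mE -mulmxA; congr (_ *m _).
  apply: mx2_eq; rewrite mulmx2 !mx2E; [by lia| |by lia|by lia].
  rewrite {3}(divz_eq b d) mul1r addrC; congr (_ + _); move: bd; lia.
Qed.

(** Stability under the adjugate makes T_n its own adjoint: the same representatives serve on both
    sides of the correspondence. *)
Lemma heckeSet_adj N n : (@adj2 _ @` heckeSet N n) = heckeSet N n.
Proof.
have H m : heckeSet N n m -> heckeSet N n (adj2 m).
  by move=> [dm mN]; split; [rewrite det_adj2|rewrite mx2E rpredN].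
apply/seteqP; split => [_ [m /H h <-]//|m h].
by exists (adj2 m); [exact: H|rewrite adj2K].
Qed.

(** * Cosets at a prime dividing the level *)

Section AtP.
Variables (N p : nat).
Hypotheses (N0 : (0 < N)%N) (pp : prime p) (pN : (p %| N)%N).
Let L := (N %/ p)%N.

Let p0 : 0 < p%:Z :> int. Proof. by rewrite ltz_nat prime_gt0. Qed.
Let pn0 : p%:Z != 0 :> int. Proof. by rewrite gt_eqF. Qed.
Let NE : N%:Z = p%:Z * L%:Z. Proof. by rewrite -PoszM /L mulnC divnK. Qed.
Let pNz : (p%:Z %| N%:Z)%Z. Proof. by []. Qed.

(* The double coset of the trace from level N to level N / p: its left cosets
   are the p matrices of U_p, together with an Atkin-Lehner matrix when p
   divides N exactly once. *)
Definition uSet : set 'M[int]_2 :=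
  [set m | [/\ \det m = p%:Z, (N%:Z %| (m 1 0)%R)%Z & (p%:Z %| (m 1 1)%R)%Z]].

Definition uR (b : 'I_p) : 'M[int]_2 := mx2 1 (b : nat)%:Z 0 p%:Z.

Lemma uR_set b g : Gamma0 N g -> uSet (g *m uR b).
Proof.
move=> Gg; have [_ gN] := Gg; split.
- by rewrite det_mulmx (Gamma0_det Gg) mul1r det2 !mx2E mulr0 subr0 mul1r.
- by rewrite mulmx2 !mx2E mulr0 addr0 mulr1.
- rewrite mulmx2 !mx2E; apply: rpredD; last exact: dvdz_mull.
  by apply: dvdz_mulr; exact: dvdz_trans gN.
Qed.

Lemma uR_inj b b' g g' : Gamma0 N g -> Gamma0 N g' -> g *m uR b = g' *m uR b' -> g = g' /\ b = b'.
Proof.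
move=> Gg Gg' /(tri_inj Gg Gg') [] //; try by rewrite lez_nat ltz_nat ltn_ord.
by move=> -> _ /eqP; rewrite eqz_nat => /eqP /val_inj ->.
Qed.

(** The residue b is m01 / m00 modulo p; the quotient by [uR b] is then integral because p also
    divides the second row's right entry and N its left one. *)
Lemma uR_surj m : uSet m -> ~~ (p%:Z %| (m 0 0)%R)%Z -> exists b g, Gamma0 N g /\ m = g *m uR b.
Proof.
move=> [dm mN mp] m00.
have cop : coprimez (m 0 0) p%:Z by rewrite coprimez_sym coprimezE prime_coprime.
have [u [v uv]] := Bezoutz (m 0 0) p%:Z; move/eqP: cop uv => -> uv.
pose b := (modz (u * m 0 1) p%:Z).
have bp : 0 <= b < p%:Z by rewrite modz_ge0// ltz_pmod.
have abs_b : (absz b < p)%N by move: bp; lia.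
have bE : (absz b)%:Z = b by move: bp; lia.
have /dvdzP[x xE] : (p%:Z %| (m 0 1 - b * m 0 0)%R)%Z.
  have -> : b = u * m 0 1 - divz (u * m 0 1) p%:Z * p%:Z.
    by rewrite /b /modz.
  have -> : m 0 1 - (u * m 0 1 - divz (u * m 0 1) p%:Z * p%:Z) * m 0 0 =
     (v * m 0 1 + divz (u * m 0 1) p%:Z * m 0 0) * p%:Z.
    by rewrite -{1}[m 0 1]mul1r -{1}uv; ring.
  exact: dvdz_mull.
have /dvdzP[y yE] : (p%:Z %| (m 1 1 - b * m 1 0)%R)%Z.
  by apply: rpredB => //; apply: dvdz_mull; exact: dvdz_trans mN.
exists (Ordinal abs_b), (mx2 (m 0 0) x (m 1 0) y).
have mE : m = mx2 (m 0 0) x (m 1 0) y *m uR (Ordinal abs_b).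
  apply: mx2_eq; rewrite mulmx2 !mx2E /= ?bE ?mulr1 ?mulr0 ?addr0//.
    by rewrite -xE; ring.
  by rewrite -yE; ring.
split => //; split; last by rewrite mx2E.
rewrite /SL2Z/=; apply: (mulfI pn0); rewrite mulr1 -[RHS]dm [RHS](congr1 determinant mE) det_mulmx mulrC.
by congr (_ * _); rewrite det2 !mx2E mulr0 subr0 mul1r.
Qed.

(** If p divided the upper left entry, the determinant p would be divisible by p^2, since p^2
    divides N and hence the lower left entry. Only the cosets of U_p remain. *)
Lemma uSet_bij_sq : (p %| L)%N ->
  set_bij ([set: 'I_p] `*`` (fun=> Gamma0 N)) uSet (fun x => x.2 *m uR x.1).
Proof.
move=> pL; split.
- by move=> [b g] [_ /= Gg]; exact: uR_set.
- move=> [b g] [b' g'] /[!inE] [[_ /= Gg]] [_ /= Gg'] /(uR_inj Gg Gg')[-> ->] //.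
- move=> m um; have [dm mN mp] := um.
  have m00 : ~~ (p%:Z %| (m 0 0)%R)%Z.
    apply/negP => /dvdzP[x xE]; move/dvdzP: mp => [y yE]; move/dvdzP: mN => [w wE].
    move/dvdnP: pL => [q qE].
    have : p%:Z * (p%:Z * (x * y - m 0 1 * w * q%:Z)) = p%:Z * 1.
      rewrite mulr1 -[RHS]dm det2 xE yE wE NE qE PoszM; ring.
    move/(mulfI pn0)/int_mul_eq1 => [[] + _|[] + _]; last by lia.
    by move/eqP; rewrite eqz_nat => /eqP p1; move: pp; rewrite p1.
  have [b [g [Gg ->]]] := uR_surj um m00.
  by exists (b, g).
Qed.

(** Seen from level N / p there is a single coset, that of z |-> p z. This is why pairing a trace
    with g amounts to pairing with the old form g(p z). *)
Lemma uSet_adj_bij :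
  set_bij ([set: unit] `*`` (fun=> Gamma0 L)) (@adj2 _ @` uSet)
    (fun x => x.2 *m mx2 p%:Z 0 0 1).
Proof.
have Ln0 : L%:Z != 0 :> int.
  by rewrite eqz_nat -lt0n divn_gt0 ?prime_gt0// dvdn_leq.
split.
- move=> [[] g] [_ /= [dg gL]]; exists (adj2 (g *m mx2 p%:Z 0 0 1)); last by rewrite adj2K.
  split.
  + by rewrite det_adj2 det_mulmx dg mul1r det2 !mx2E mulr0 subr0 mulr1.
  + rewrite mx2E mulmx2 !mx2E mulr0 addr0 rpredN NE mulrC; exact: dvdz_mul.
  + by rewrite mx2E mulmx2 !mx2E mulr0 addr0; exact: dvdz_mull.
- move=> [[] g] [[] g'] _ _ /= /mulmx2_inj -> //.
  by rewrite det2 !mx2E mulr0 subr0 mulr1.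
- move=> _ [m [dm mN mp] <-].
  move/dvdzP: mp => [y yE]; move/dvdzP: mN => [w wE].
  exists (tt, mx2 y (- m 0 1) (- (w * L%:Z)) (m 0 0)); last first.
    apply: mx2_eq; rewrite mulmx2 !mx2E ?mulr0 ?addr0 ?mulr1 ?add0r//.
    by rewrite wE NE; ring.
  split => //; split; last by rewrite mx2E rpredN dvdz_mull.
  rewrite /SL2Z/=; apply: (mulfI pn0); rewrite mulr1 -[RHS]dm !det2 !mx2E yE wE NE; ring.
Qed.

Section Exactly.
Variables x y : int.
Hypothesis xy : p%:Z * y - L%:Z * x = 1.

(** The Atkin-Lehner matrix at p. The Bezout pair x, y exists when p does not divide N / p, and
    gives the matrix determinant p. *)
Definition wR : 'M[int]_2 := mx2 p%:Z x N%:Z (p%:Z * y).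

Definition wSet : set 'M[int]_2 :=
  [set m | [/\ \det m = p%:Z, (N%:Z %| (m 1 0)%R)%Z, (p%:Z %| (m 1 1)%R)%Z & (p%:Z %| (m 0 0)%R)%Z]].

Lemma det_wR : \det wR = p%:Z.
Proof. by rewrite det2 !mx2E NE -[RHS]mulr1 -xy; ring. Qed.

Lemma wR_set g : Gamma0 N g -> wSet (g *m wR).
Proof.
move=> Gg; have [_ gN] := Gg.
have gp : (p%:Z %| (g 1 0)%R)%Z by exact: dvdz_trans gN.
split; rewrite ?mulmx2 ?mx2E.
- by rewrite det_mulmx (Gamma0_det Gg) mul1r det_wR.
- apply: rpredD; [exact: dvdz_mulr|exact: dvdz_mull].
- by apply: rpredD; [exact: dvdz_mulr|apply: dvdz_mull; exact: dvdz_mulr].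
- by apply: rpredD; [exact: dvdz_mull|apply: dvdz_mull].
Qed.

Lemma wR_surj m : wSet m -> exists2 g, Gamma0 N g & m = g *m wR.
Proof.
move=> [dm /dvdzP[c cE] /dvdzP[d dE] /dvdzP[a aE]].
pose g := mx2 (p%:Z * a * y - m 0 1 * L%:Z) (- a * x + m 0 1) (N%:Z * (c * y - d)) (- L%:Z * c * x + p%:Z * d).
have mE : m = g *m wR.
  apply: mx2_eq; rewrite mulmx2 !mx2E ?aE ?cE ?dE ?NE.
  - by rewrite -[LHS]mulr1 -xy; ring.
  - by rewrite -[LHS]mulr1 -xy; ring.
  - by rewrite -[LHS]mulr1 -xy; ring.
  - by rewrite -[LHS]mulr1 -xy; ring.
exists g => //; split; last by rewrite mx2E dvdz_mulr.
rewrite /SL2Z/=; apply: (mulfI pn0); rewrite mulr1 -[RHS]dm mE det_mulmx mulrC.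
by rewrite det_wR.
Qed.

Lemma wSet_bij : set_bij ([set: unit] `*`` (fun=> Gamma0 N)) wSet (fun u => u.2 *m wR).
Proof.
split.
- by move=> [[] g] [_ /= Gg]; exact: wR_set.
- by move=> [[] g] [[] g'] _ _ /= /mulmx2_inj -> //; rewrite det_wR.
- by move=> m /wR_surj[g Gg ->]; exists (tt, g).
Qed.

Lemma wSet_adj : (@adj2 _ @` wSet) = wSet.
Proof.
have H m : wSet m -> wSet (adj2 m).
  by move=> [dm mN m1 m0]; split; rewrite ?mx2E// ?det_adj2// rpredN.
apply/seteqP; split => [_ [m /H h <-]//|m h].
by exists (adj2 m); [exact: H|rewrite adj2K].
Qed.

Definition uwR (b : option 'I_p) : 'M[int]_2 := if b is Some b then uR b else wR.

(** Divisibility of the upper left entry by p separates the Atkin-Lehner coset from the p cosets of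
    U_p. *)
Lemma uSet_bij_exact :
  set_bij ([set: option 'I_p] `*`` (fun=> Gamma0 N)) uSet (fun u => u.2 *m uwR u.1).
Proof.
have clash b g g' : Gamma0 N g -> Gamma0 N g' -> g *m uR b = g' *m wR -> False.
  move=> [dg gN] Gg' e; have [_ _ _] := wR_set Gg'; rewrite -e mulmx2 !mx2E mulr1 mulr0 addr0 => p00.
  have p10 : (p%:Z %| (g 1 0)%R)%Z by exact: dvdz_trans gN.
  have : (p%:Z %| 1)%Z.
    rewrite -[X in (_ %| X)%Z]dg det2; apply: rpredB; [exact: dvdz_mulr|exact: dvdz_mull].
  by rewrite dvdz1 /= => /eqP p1; move: pp; rewrite p1.
split.
- move=> [[b|] g] [_ /= Gg]; first exact: uR_set.
  by have [] := wR_set Gg.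
- move=> [b g] [b' g'] /[!inE] [[_ /= Gg]] [_ /= Gg']; case: b b' => [b|] [b'|] /=.
  + by move/(uR_inj Gg Gg') => [-> ->].
  + by move/(clash _ _ _ Gg Gg').
  + by move/esym/(clash _ _ _ Gg' Gg).
  + by move/mulmx2_inj => -> //; rewrite det_wR.
- move=> m um; have [dm mN mp] := um; have [m00|m00] := boolP (p%:Z %| (m 0 0)%R)%Z.
    by have [//|g Gg ->] := @wR_surj m; exists (None, g).
  have [b [g [Gg ->]]] := uR_surj um m00.
  by exists (Some b, g).
Qed.
End Exactly.

(** Right multiplication by the larger group Gamma0(N / p) preserves the set, which makes the sum
    over its cosets modular of the lower level. *)
Lemma uSet_mulr m g : uSet m -> Gamma0 L g -> uSet (m *m g).
Proof.
move=> [dm mN mp] [dg gL].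
have mp0 : (p%:Z %| (m 1 0)%R)%Z by exact: dvdz_trans mN.
split; rewrite ?mulmx2.
- by rewrite det_mulmx dm dg mulr1.
- by apply: rpredD; [exact: dvdz_mulr|rewrite NE; exact: dvdz_mul].
- by apply: rpredD; exact: dvdz_mulr.
Qed.
End AtP.
End Cosets.

(** * Orthogonality of newforms *)

Section FiniteSums.
Variables (R : realType) (k : nat) (I : finType) (N : nat).
Implicit Types f : I -> R[i] -> R[i].

Lemma hasexp_fin f : (forall i, exists c, hasexp (f i) c) ->
  exists c, hasexp (fun z => \sum_i f i z) c.
Proof.
move=> /choice[c fc]; exists (fun m => \sum_i c i m).
by apply: hasexp_bigsum => i _; exact: fc.
Qed.

Lemma L2_fin f : (forall i, L2 k N (f i)) -> L2 k N (fun z => \sum_i f i z).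
Proof.
move=> Lf; apply: eq_L2 (L2_sum (f := fun j : 'I_#|I| => f (enum_val j)) (fun j => Lf _)) => z _.
by rewrite -(big_enum_val (A := I) (fun i => f i z)).
Qed.

Lemma petersson_fin f g : (forall i, L2 k N (f i)) -> L2 k N g ->
  petersson k N (fun z => \sum_i f i z) g = \sum_i petersson k N (f i) g.
Proof.
move=> Lf Lg.
have := petersson_suml (f := fun j : 'I_#|I| => f (enum_val j)) (fun j => Lf _) Lg.
rewrite -(big_enum_val (A := I) (fun i => petersson k N (f i) g)) => <-.
by apply: eq_petersson => // z _; rewrite -(big_enum_val (A := I) (fun i => f i z)).
Qed.
End FiniteSums.

Section Slash.
Variables (R : realType) (k : nat).
Implicit Types (f : R[i] -> R[i]) (g : 'M[int]_2) (z : R[i]).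

Lemma Im_div (u v : R[i]) : complex.Im (u / v) =
  (complex.Im u * complex.Re v - complex.Re u * complex.Im v) / sqC v.
Proof.
by case: u v => a b [c d]; rewrite /sqC /=; ring.
Qed.

(** Forms are extended by 0 off the half-plane; this keeps their slashes 0 there as well. *)
Lemma moebius_upper g z : 0 < \det g -> upper (moebius g z) -> upper z.
Proof.
move=> dg; rewrite /upper /= /moebius Im_div /autj !intC.
have -> : complex.Im ((g 0 0)%:~R%:C * z + (g 0 1)%:~R%:C) * complex.Re ((g 1 0)%:~R%:C * z + (g 1 1)%:~R%:C) -
   complex.Re ((g 0 0)%:~R%:C * z + (g 0 1)%:~R%:C) * complex.Im ((g 1 0)%:~R%:C * z + (g 1 1)%:~R%:C) =
   (\det g)%:~R * complex.Im z :> R.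
  by rewrite det2 intrB !intrM; case: z => x y /=; ring.
rewrite -mulrA mulrCA => h; rewrite ltNge; apply/negP => z0; move: h; apply/negP; rewrite -leNgt.
by rewrite mulr_le0_ge0// divr_ge0 ?sqC_ge0// ler0z ltW.
Qed.

Lemma slash_upper_tri f (a b d : int) z :
  slash k f (mx2 a b 0 d) z = d%:~R ^- k * f ((a%:~R * z + b%:~R) / d%:~R).
Proof. by rewrite /slash /moebius /autj !mx2E mul0r add0r. Qed.

Lemma derivable_slash f g z : 0 < \det g -> upper z ->
  derivable (f : R[i]^o -> R[i]^o) (moebius g z) 1 ->
  derivable (slash k f g : R[i]^o -> R[i]^o) z 1.
Proof.
move=> dg z0 df; have j0 := autj_neq0 (lt0r_neq0 dg) z0.
have lin (a b : int) : derivable ((fun w => a%:~R * w + b%:~R) : R[i]^o -> R[i]^o) z 1.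
  apply: derivableD; last exact: derivable_cst.
  apply: derivableM; [exact: derivable_cst|exact: derivable_id].
have dj : derivable (autj g : R[i]^o -> R[i]^o) z 1 by exact: lin.
have dm : derivable (moebius g : R[i]^o -> R[i]^o) z 1.
  apply: derivableM; first exact: lin.
  exact: derivableV.
apply: derivableM.
  apply: derivableV; first by rewrite expf_neq0.
  have H n : derivable ((fun w => autj g w ^+ n) : R[i]^o -> R[i]^o) z 1.
    elim: n => [|n IH]; first exact: derivable_cst.
    have -> : (fun w : R[i] => autj g w ^+ n.+1) = (fun w => autj g w * autj g w ^+ n).
      by apply/funext => w; rewrite exprS.
    exact: derivableM dj IH.
  exact: H.
have P := @derivable1_diffP R[i] R[i]^o.
move/P: dm => dm; move/P: df => df.
apply/P; exact: (differentiable_comp dm df).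
Qed.

Lemma derivable_bigsum (I : Type) (s : seq I) (F : I -> R[i] -> R[i]) z :
  (forall i, derivable (F i : R[i]^o -> R[i]^o) z 1) ->
  derivable ((fun w => \sum_(i <- s) F i w) : R[i]^o -> R[i]^o) z 1.
Proof.
move=> dF; elim: s => [|i s IH].
  have -> : (fun w => \sum_(i <- [::]) F i w) = (fun=> 0) by apply/funext => w; rewrite big_nil.
  exact: derivable_cst.
have -> : (fun w => \sum_(j <- i :: s) F j w) = (fun w => F i w + \sum_(j <- s) F j w).
  by apply/funext => w; rewrite big_cons.
exact: derivableD (dF i) IH.
Qed.
End Slash.

(** * The trace to a lower level is a cusp form *)

Section Descent.
Variables (R : realType) (k N L p : nat) (I : finType) (r : I -> 'M[int]_2) (D : set 'M[int]_2).
Hypotheses (L0 : (0 < L)%N) (p0 : (0 < p)%N) (NE : N = (p * L)%N).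
Hypothesis dD : forall d, D d -> \det d = p%:Z.
Hypothesis bD : set_bij ([set: I] `*`` (fun=> Gamma0 N)) D (fun x => x.2 *m r x.1).
Hypothesis DL : forall m g, D m -> Gamma0 L g -> D (m *m g).
Implicit Types (f : R[i] -> R[i]) (z : R[i]).

Let Dr i : D (r i).
Proof.
have [h _ _] := bD; have := h (i, 1%:M) (conj Logic.I (Gamma0_1 N)).
by rewrite /= mul1mx.
Qed.

Let dr i : 0 < \det (r i). Proof. by rewrite dD// ltz_nat. Qed.
Let dn i : \det (r i) != 0. Proof. by rewrite gt_eqF. Qed.

Definition descent f z := \sum_i slash k f (r i) z.

Lemma slash_descent f g z : 0 < \det g -> upper z ->
  slash k (descent f) g z = \sum_i slash k f (r i *m g) z.
Proof.
move=> dg z0; rewrite /slash /descent mulr_sumr; apply: eq_bigr => i _.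
by rewrite -[LHS]/(slash k (slash k f (r i)) g z) slashM.
Qed.

(** Right multiplication by g permutes the cosets: it induces an injective self-map of the finite
    index type. *)
Lemma descent_modular f : modular k N f -> modular k L (descent f).
Proof.
move=> mf g z Gg z0; have dg := Gamma0_det_gt0 Gg.
rewrite slash_descent//.
have [_ inj surj] := bD.
have /choice[s sP] i : exists j, exists2 h, Gamma0 N h & r i *m g = h *m r j.
  by have [[j h] [_ /= Gh] e] := surj _ (DL (Dr i) Gg); exists j, h.
have sinj : injective s.
  move=> i i' e; have [h Gh hE] := sP i; have [h' Gh' hE'] := sP i'.
  have E : r i = (h *m adj2 h') *m r i'.
    have : r i *m g *m adj2 g = h *m (adj2 h' *m (r i' *m g)) *m adj2 g.
      by rewrite hE' !mulmxA -(mulmxA h) (mul_adj_Gamma0 Gh') mulmx1 hE e.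
    by rewrite -!mulmxA (mul_Gamma0_adj Gg) !mulmx1.
  have := inj (i, 1%:M) (i', h *m adj2 h').
  rewrite !inE /= mul1mx => /(_ _ _ E) H.
  by have [] : (i, 1%:M) = (i', h *m adj2 h') by apply: H; split => //;
    [exact: Gamma0_1|exact: Gamma0M Gh (Gamma0_adj Gh')].
rewrite /descent [RHS](reindex_inj sinj); apply: eq_bigr => i _.
have [h Gh ->] := sP i.
rewrite -slashM//; last by rewrite gt_eqF// (Gamma0_det_gt0 Gh).
by rewrite /slash; congr (_ * _); apply: mf => //; exact: upper_moebius.
Qed.

(** Each r_i g is a unimodular h times a triangular matrix with a d = p, so its term is the
    expansion of f at the cusp of h, shifted and dilated. At N p z the triangular part gives N (a^2
    z + b / (d N)), which has no denominator left in front of z. *)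
Lemma descent_expansion f g : cusp_form k N f -> SL2Z g ->
  exists c, hasexp (fun z => slash k (descent f) g (N%:R * (p%:R * z))) c.
Proof.
move=> cf Sg; have N0 : (0 < N)%N by rewrite NE muln_gt0 p0.
have dg : 0 < \det g by rewrite Sg.
have [c hc] : exists c, hasexp (fun z => \sum_i slash k f (r i *m g) (N%:R * (p%:R * z))) c.
  apply: hasexp_fin => i.
  have drg : 0 < \det (r i *m g) by rewrite det_mulmx mulr_gt0.
  have [h [a [b [d [Sh a0 d0 e]]]]] := triangular drg.
  have ad : a * d = p%:Z.
    rewrite -(dD (Dr i)) -[LHS]mulr1 -[in LHS]Sh -[\det (r i)]mulr1 -[in RHS]Sg -det_mulmx e det_mulmx mulrC.
    by congr (_ * _); rewrite det2 !mx2E mulr0 subr0.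
  have [c hc] := cusp_hasexp N0 cf Sh.
  pose A := absz a; have aE : a = A%:Z by rewrite /A; lia.
  have A0 : (0 < A * A)%N by rewrite muln_gt0 /A; lia.
  have := hasexpZ (d%:~R ^- k) (hasexp_dilate A0 (hasexp_shift (b%:~R / (d%:~R * N%:R)) hc)).
  set c' := (fun n : nat => _) => hc'; exists c'; apply: eq_hasexp hc' => z z0.
  have z1 : upper (N%:R * (p%:R * z)) by do 2 apply: upper_natM => //.
  rewrite e -slashM//; first last.
  - by rewrite Sh.
  - by rewrite det2 !mx2E mulr0 subr0 mulr_gt0.
  rewrite slash_upper_tri; congr (_ * slash k f h _).
  have dn0 : (d%:~R : R[i]) != 0 by rewrite intr_eq0 gt_eqF.
  have Nn0 : (N%:R : R[i]) != 0 by rewrite pnatr_eq0 -lt0n.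
  have -> : (p%:R : R[i]) = A%:R * d%:~R.
    by rewrite -[p%:R]/(p%:Z%:~R) -ad intrM aE.
  have -> : (b%:~R / (d%:~R * N%:R) : R)%:C = b%:~R / (d%:~R * N%:R).
    by rewrite (intC _ b) (intC _ d) (natC _ N) -rmorphM /= -divC.
  rewrite natrM aE -pmulrn.
  by field; rewrite dn0.
exists c; apply: eq_hasexp hc => z z0; rewrite slash_descent//.
by do 2 apply: upper_natM => //; rewrite NE muln_gt0 p0.
Qed.

Lemma descent_cusp f : cusp_form k N f -> cusp_form k L (descent f).
Proof.
move=> cf; have [f0 fd fm fe] := cf; have mG := descent_modular fm.
have N0 : (0 < N)%N by rewrite NE muln_gt0 p0.
split; [| |exact: mG|].
- move=> z nz; rewrite /descent big1// => i _; rewrite /slash f0 ?mulr0//.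
  by move=> h; apply: nz; exact: moebius_upper h.
- move=> z z0.
  have H i : derivable (slash k f (r i) : R[i]^o -> R[i]^o) z 1.
    apply: (derivable_slash (dr i) z0); apply: fd; exact: upper_moebius (dr i) z0.
  exact (@derivable_bigsum R I (index_enum I) (fun i => slash k f (r i)) z H).
- move=> g Sg; have dg : 0 < \det g by rewrite Sg.
  have [c hc] := descent_expansion cf Sg.
  (* The expansion at hand is in powers of e(z / (p N)) with p N = p^2 L, while level L asks for
     powers of e(z / L). Averaging over p^2 translates keeps the exponents divisible by p^2, and
     periodicity under z |-> z + L makes the average equal to the function. *)
  have P0 : (0 < p * p)%N by rewrite muln_gt0 p0.
  exists (fun n => c (p * p * n)%N) => z z0.
  have Ln0 : (L%:R : R[i]) != 0 by rewrite pnatr_eq0 -lt0n.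
  have pn0 : (p%:R : R[i]) != 0 by rewrite pnatr_eq0 -lt0n.
  have up (w : R[i]) (n : nat) : upper w -> upper (w + n%:R).
    by rewrite /upper /= raddfD /= natC addr0.
  have z1 : upper (z / L%:R).
    by rewrite mulrC natC -fmorphV /upper /= Im_realM mulr_gt0// invr_gt0 ltr0n.
  have per (n : nat) w : upper w -> slash k (descent f) g (w + (L * n)%:R) = slash k (descent f) g w.
    move=> w0; pose t := transl (L * n)%N%:Z.
    have dt : \det t = 1 by have [] := Gamma0_transl L (L * n)%N%:Z.
    (* A translation by a multiple L n conjugated by g has lower left entry - L n (g 1 0)^2, so it
       stays in Gamma0(L). *)
    have Gh : Gamma0 L (g *m t *m adj2 g).
      split; first by rewrite /SL2Z/= !det_mulmx det_adj2 dt Sg !mulr1.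
      rewrite !mulmx2 !mx2E PoszM.
      have -> : (g 1 0 * 1 + g 1 1 * 0) * g 1 1 + (g 1 0 * (L%:Z * n%:Z) + g 1 1 * 1) * - g 1 0 =
        L%:Z * (- (g 1 0 * n%:Z * g 1 0)) by ring.
      exact: dvdz_mulr.
    have <- : slash k (descent f) (g *m t) w = slash k (descent f) g (w + (L * n)%:R).
      rewrite -slashM//; [|by rewrite dt|by rewrite Sg].
      rewrite /slash -/(moebius t w) moebius_transl {1}/autj !mx2E mul0r add0r expr1n invr1 mul1r.
      by rewrite -[(_ )%:~R]/((L * n)%:R).
    have -> : g *m t = (g *m t *m adj2 g) *m g.
      by rewrite -!mulmxA mul_adj2l Sg mulmx1.
    rewrite -slashM//; last by rewrite gt_eqF// (Gamma0_det_gt0 Gh).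
    by rewrite {1}/slash mG//; exact: upper_moebius.
  have := hasexp_decimate P0 hc => /(_ _ z1) h.
  apply/ccvgP.
  have -> : slash k (descent f) g z = (p * p)%:R^-1 *
      \sum_(b < p * p) slash k (descent f) g (N%:R * (p%:R * ((z / L%:R + b%:R) / (p * p)%:R))).
    have E (b : 'I_(p * p)) : slash k (descent f) g (N%:R * (p%:R * ((z / L%:R + b%:R) / (p * p)%:R))) =
        slash k (descent f) g z.
      rewrite -(per b z z0); congr (slash _ _ _ _).
      by rewrite NE !natrM; field; rewrite Ln0 pn0.
    rewrite (eq_bigr (fun=> slash k (descent f) g z)); last by move=> b _; exact: E.
    by rewrite sumr_const card_ord -[slash _ _ _ _ *+ _]mulr_natl mulrA mulVf ?mul1r// pnatr_eq0 -lt0n.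
  apply: eq_ccvg h => n; apply: eq_bigr => i _.
  by rewrite mulrA.
Qed.
End Descent.

(** * Forms of norm zero *)

Section NullForms.
Variables (R : realType) (k : nat).
Implicit Types (f g h : R[i] -> R[i]) (N L : nat).

Lemma petersson_null N f h : L2 k N f -> L2 k N h ->
  complex.Re (petersson k N f f) = 0 -> petersson k N f h = 0.
Proof.
move=> Lf Lh f0; set w := petersson k N f h.
have H (c : R[i]) : 0 <= complex.Re (petersson k N h h) + 2 * complex.Re (c * w).
  have Lc := L2Z c Lf.
  have := petersson_ge0 k N (fun z => c * f z + h z).
  rewrite (qnormD Lc Lh) (peterssonZl c Lf Lh) -/w (peterssonZl c Lf Lc).
  rewrite (petersson_conj Lc Lf) (peterssonZl c Lf Lf).
  have -> : petersson k N f f = 0.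
    have := petersson_real k N f; move: f0; case: (petersson k N f f) => x y /= -> ->.
    by [].
  by rewrite !(mulr0, conjc0) add0r.
apply/eqP; apply/contraT => w0; have w1 : 0 < sqC w by rewrite sqC_gt0.
have := petersson_ge0 k N h; set B := complex.Re _ in H * => B0.
(* This multiple of the conjugate of w makes the nonnegative quantity equal to B - (B + 1) = -1. *)
have := H (- (((B + 1) / (2 * sqC w))%:C * w^*)).
have -> : complex.Re (- (((B + 1) / (2 * sqC w))%:C * w^*) * w) = - ((B + 1) / (2 * sqC w)) * sqC w.
  by case: (w) => x y; rewrite /sqC /=; ring.
have -> : 2 * (- ((B + 1) / (2 * sqC w)) * sqC w) = - (B + 1) by field; rewrite gt_eqF.
lra.
Qed.

Lemma modular_weight N f (g : 'M[int]_2) (p : R * R) : Gamma0 N g -> modular k N f -> uhp p ->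
  sqC (f (toC (act g p))) * (act g p).2 ^+ k = sqC (f (toC p)) * p.2 ^+ k.
Proof.
move=> Gg mf p0; have dg := Gamma0_det_gt0 Gg; have z0 : upper (toC p) by [].
have j0 := autj_neq0 (lt0r_neq0 dg) z0.
have -> : toC (act g p) = moebius g (toC p) by rewrite /act /toC /ofC /=; case: (moebius _ _).
have -> : (act g p).2 = p.2 / sqC (autj g (toC p)).
  by rewrite /act /ofC /= (Im_moebius (lt0r_neq0 dg) z0) (Gamma0_det Gg) mul1r.
rewrite -[in RHS](mf g _ Gg z0) /slash sqCM sqCV sqCX exprMn exprVn.
by field; rewrite expf_neq0 // gt_eqF// sqC_gt0.
Qed.

Local Open Scope ereal_scope.

(** Summing over Gamma0(L) spreads the vanishing from the domain of level L to the whole half-plane;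
    the weight of level N is at most 1 there. In this way a statement at level N / p is brought back
    to level N. *)
Lemma qnorm_null N L f : (0 < N)%N -> (0 < L)%N -> cmeas f -> modular k L f ->
  qnorm k L f = 0 -> qnorm k N f = 0.
Proof.
move=> N0 L0 mf modf; rewrite (qnormE k N0 mf) (qnormE k L0 mf).
pose phi (p : R * R) : \bar R := `|sqC (f (toC p)) * p.2 ^+ k|%:E.
have phi0 p : 0 <= phi p by rewrite lee_fin.
have mphi : measurable_fun uhp phi.
  apply/measurable_EFinP; apply: measurableT_comp => //; apply: measurable_funM.
    exact: measurable_sqC.
  by apply: measurable_funX; exact: measurable_funTS.
have mw M : (0 < M)%N -> measurable_fun uhp (fun p => (fwt M p)%:E * phi p).
  move=> M0; apply: emeasurable_funM => //; apply/measurable_EFinP; exact: measurable_fwt.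
have w0 M p : 0 <= (fwt M p)%:E * phi p by rewrite mule_ge0// lee_fin fwt_ge0.
rewrite -/(phi _) => h.
have {}h : hyp (fun p => (fwt L p)%:E * phi p) = 0.
  apply/eqP; move/eqP: h; rewrite mule_eq0 => /orP[|//].
  by rewrite eqe pnatr_eq0.
have H : hyp phi = 0.
  transitivity (hyp (fun p => \esum_(g in Gamma0 L) ((fwt L (act g p))%:E * phi (act g p)))).
    apply: (@eq_hyp R) => p p0.
    have -> : \esum_(g in Gamma0 L) ((fwt L (act g p))%:E * phi (act g p)) =
        \esum_(g in Gamma0 L) ((fwt L (act g p))%:E * phi p).
      by apply: eq_esum => g Gg; rewrite /phi (modular_weight Gg modf p0).
    rewrite /phi esumZr ?esum_fwt ?mul1e//.
    by move=> g; rewrite lee_fin fwt_ge0.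
  rewrite hyp_esum; last first.
  - by move=> g p; exact: w0.
  - by move=> g Gg; exact: (measurable_comp_act (Gamma0_det_gt0 Gg) (mw L L0)).
  apply: esum1 => g Gg.
  exact: (etrans (hyp_act (Gamma0_det_gt0 Gg) (mw L L0) (w0 L)) h).
have m2 : measurable_fun uhp (fun p : R * R => (p.2 ^- 2)%:E).
  apply/measurable_EFinP; apply: measurable_funTS; apply: (measurableT_comp (@measurable_invr R)).
  exact: measurable_funX.
have i0 (p : R * R) : 0 <= (p.2 ^- 2)%:E by rewrite lee_fin invr_ge0 sqr_ge0.
suff -> : hyp (fun p => (fwt N p)%:E * phi p) = 0 by rewrite mule0.
apply/eqP; rewrite eq_le; apply/andP; split; last first.
  by apply: integral_ge0 => p p0; rewrite mule_ge0.
rewrite -H; apply: ge0_le_integral.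
- exact: measurable_uhp.
- by move=> p p0; rewrite mule_ge0.
- by apply: emeasurable_funM => //; exact: mw.
- exact: emeasurable_funM.
- move=> p p0; apply: lee_wpmul2r => //; rewrite -[leRHS]mul1e; apply: lee_wpmul2r => //.
  rewrite lee_fin /fwt; have h1 := fine_hits_ge1 N0 p0.
  have h2 : ((fine (hits N p))^-1 <= 1)%R by rewrite invf_le1// (lt_le_trans _ h1).
  by rewrite indicE; case: (_ \in _); rewrite ?mul1r// mul0r ler01.
Qed.
End NullForms.

Section Conjugation.
Variable R : realType.
Implicit Types x y : R[i].

Lemma conjcM x y : conjc (x * y) = conjc x * conjc y.
Proof. exact: (rmorphM (@conjc R)). Qed.

Lemma conjcN x : conjc (- x) = - conjc x.
Proof. exact: (rmorphN (@conjc R)). Qed.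
End Conjugation.

Lemma sum_unit (R : realType) (F : unit -> R[i]) : \sum_(j : unit) F j = F tt.
Proof. by rewrite (bigD1 tt)//= big1 ?addr0// => -[]. Qed.

(** * Hecke operators as coset sums and on Fourier coefficients *)

Section HeckeSums.
Variables (R : realType) (k N : nat).
Implicit Types (f : R[i] -> R[i]) (z : R[i]).

Lemma hecke_prime p f z : prime p -> (p %| N)%N ->
  hecke k N p f z = p%:R^-1 * \sum_(b < p) f ((z + b%:R) / p%:R).
Proof.
move=> pp pN; rewrite /hecke -big_filter (_ : seq.filter _ _ = [:: 1%N]).
  by rewrite big_seq1 divn1 expr1n mul1r; congr (_ * _); apply: eq_bigr => b _; rewrite mul1r.
apply: perm_small_eq => //; apply: uniq_perm => //; first by rewrite filter_uniq// divisors_uniq.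
move=> a; rewrite mem_filter -dvdn_divisors ?prime_gt0// inE; apply/andP/eqP => [[aN ap]|->]; last first.
  by rewrite coprime1n dvd1n.
have [_ /(_ _ ap) /orP[/eqP->//|/eqP aE]] := primeP pp.
by move: aN; rewrite aE prime_coprime// pN.
Qed.

Lemma sum_uR p f z : prime p -> (p %| N)%N ->
  \sum_(b < p) slash k f (uR b) z = p%:R ^- k * p%:R * hecke k N p f z.
Proof.
move=> pp pN; rewrite hecke_prime// mulrA mulfK ?pnatr_eq0 -?lt0n ?prime_gt0//.
by rewrite mulr_sumr; apply: eq_bigr => b _; rewrite /uR slash_upper_tri mul1r.
Qed.

Lemma sum_heckeR n f z : (0 < n)%N -> coprime n N ->
  \sum_(i : heckeI n) slash k f (heckeR (val i)) z = n%:R ^- k * n%:R * hecke k N n f z.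
Proof.
move=> n0 nN; have nn0 : (n%:R : R[i]) != 0 by rewrite pnatr_eq0 -lt0n.
rewrite /hecke mulrA mulfK//.
pose F (a b : nat) := slash k f (mx2 a%:Z b%:Z 0 (n %/ a)%N%:Z) z.
transitivity (\sum_(a < n.+1 | (0 < a)%N && (a %| n)%N) \sum_(b < n | (b < n %/ a)%N) F a b).
  rewrite pair_big_dep /= (eq_bigl (mem (@heckeP n))); last by move=> x; rewrite /= unfold_in /heckeP andbA.
  exact: (esym (big_sub (@heckeP n) (fun x : 'I_n.+1 * 'I_n => F x.1 x.2))).
have E a : (0 < a)%N -> (a %| n)%N -> \sum_(b < n | (b < n %/ a)%N) F a b =
    n%:R ^- k * (a%:R ^+ k * \sum_(b < n %/ a) f ((a%:R * z + b%:R) / (n %/ a)%:R)).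
  move=> a0 an; rewrite -(big_ord_widen n (F a)) ?leq_div//.
  rewrite !mulr_sumr; apply: eq_bigr => b _; rewrite /F slash_upper_tri mulrA; congr (_ * _).
  have an0 : (a%:R : R[i]) != 0 by rewrite pnatr_eq0 -lt0n.
  rewrite -[in n%:R](divnK an) natrM exprMn invfM -mulrA mulVf ?mulr1// expf_neq0//.
rewrite (eq_bigr (fun a : 'I_n.+1 => n%:R ^- k * (a%:R ^+ k *
    \sum_(b < n %/ a) f ((a%:R * z + b%:R) / (n %/ a)%:R)))); last by move=> a /andP[]; exact: E.
rewrite -mulr_sumr; congr (_ * _).
rewrite -(big_mkord (fun a => (0 < a)%N && (a %| n)%N) (fun a => a%:R ^+ k *
    \sum_(b < n %/ a) f ((a%:R * z + b%:R) / (n %/ a)%:R))).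
rewrite -[LHS]big_filter; rewrite -[RHS]big_filter; apply: perm_big; apply: uniq_perm.
- by rewrite filter_uniq// iota_uniq.
- by rewrite filter_uniq// divisors_uniq.
- move=> a; rewrite !mem_filter mem_index_iota -dvdn_divisors// leq0n ltnS /=.
  have [an|] := boolP (a %| n)%N; last by rewrite !(andbF, andFb).
  by rewrite (dvdn_gt0 n0 an) (dvdn_leq n0 an) (coprime_dvdl an nN).
Qed.

Lemma hecke_coef_prime f c p s : prime p -> (p %| N)%N -> hasexp f c ->
  (forall z, upper z -> hecke k N p f z = s * f z) ->
  forall n, (0 < n)%N -> c (p * n)%N = s * c n.
Proof.
move=> pp pN fc fs [//|n] _.
have h := hasexp_decimate (prime_gt0 pp) fc.
have h' : hasexp (fun z => s * f z) (fun n => c (p * n)%N).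
  by apply: eq_hasexp h => z z0; rewrite -fs// hecke_prime.
exact: (hasexp_unique h' (hasexpZ s fc)).
Qed.

(** Coefficients are compared at index 1, where only the divisor a = 1 contributes. *)
Lemma hecke_coef_coprime f c n s : (0 < n)%N -> coprime n N -> hasexp f c ->
  (forall z, upper z -> hecke k N n f z = s * f z) -> c n = s * c 1%N.
Proof.
move=> n0 nN fc fs.
have nn0 : (n%:R : R[i]) != 0 by rewrite pnatr_eq0 -lt0n.
pose H a z := a%:R ^+ k * ((n %/ a)%:R * ((n %/ a)%:R^-1 *
  \sum_(b < n %/ a) f ((a%:R * z + b%:R) / (n %/ a)%:R))).
pose e a m := a%:R ^+ k * ((n %/ a)%:R * if (a %| m)%N then c ((n %/ a) * (m %/ a))%N else 0).
have He a : (0 < a)%N && (a %| n)%N -> hasexp (H a) (e a).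
  move=> /andP[a0 an]; have d0 : (0 < n %/ a)%N by rewrite divn_gt0// dvdn_leq.
  apply: hasexpZ; apply: hasexpZ.
  exact: (hasexp_dilate a0 (hasexp_decimate d0 fc)).
have h : hasexp (fun z => s * f z)
    (fun m => n%:R^-1 * \sum_(a <- [seq a <- divisors n | coprime a N] | (0 < a)%N && (a %| n)%N) e a m).
  apply: eq_hasexp (hasexpZ n%:R^-1 (hasexp_bigsum _ He)) => z z0.
  rewrite -fs// /hecke; congr (_ * _); rewrite -[RHS]big_filter big_seq_cond [RHS]big_seq.
  apply: eq_big => [a|a].
    rewrite mem_filter -dvdn_divisors//.
    have [an|_] := boolP (a %| n)%N; last by rewrite !(andbF, andFb).
    by rewrite (dvdn_gt0 n0 an) !andbT.
  move=> /andP[_ /andP[a0 an]]; rewrite /H mulVKf// pnatr_eq0 -lt0n divn_gt0// dvdn_leq//.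
have := hasexp_unique h (hasexpZ s fc) 0%N; rewrite /= => <-.
rewrite -big_filter (bigD1_seq 1%N) /=; first last.
- by rewrite !filter_uniq// divisors_uniq.
- by rewrite !mem_filter coprime1n -dvdn_divisors// dvd1n.
rewrite big1 ?addr0.
  by rewrite /e divn1 divnn /= expr1n mul1r muln1 mulKf.
by move=> a a1; rewrite /e dvdn1 (negPf a1) !mulr0.
Qed.
End HeckeSums.

(** * Self-adjointness at primes dividing the level *)

Section AtPrime.
Variables (R : realType) (k l N p : nat).
Hypotheses (kl : k = (l + l)%N) (N0 : (0 < N)%N) (pp : prime p) (pN : (p %| N)%N).
Let L := (N %/ p)%N.
Let L0 : (0 < L)%N. Proof. by rewrite divn_gt0 ?prime_gt0// dvdn_leq. Qed.
Let NE : N = (p * L)%N. Proof. by rewrite mulnC divnK. Qed.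
Let p0 : 0 < p%:Z :> int. Proof. by rewrite ltz_nat prime_gt0. Qed.
Let uD m : uSet N p m -> \det m = p%:Z. Proof. by case. Qed.
Implicit Types (f g h : R[i] -> R[i]).

Section Down.
Variables (I : finType) (r : I -> 'M[int]_2).
Hypothesis bD : set_bij ([set: I] `*`` (fun=> Gamma0 N)) (uSet N p) (fun x => x.2 *m r x.1).

(* The trace of f to level N / p is orthogonal to itself, because its pairing
   with itself is the pairing of f with the old form z |-> (trace f)(p z). *)
Lemma descent_null f h : new_space k N f -> L2 k N f -> L2 k N h ->
  L2 k N (descent k r f) /\ petersson k N (descent k r f) h = 0.
Proof.
move=> [cf ortho] Lf Lh; have mf : modular k N f by case: cf.
have cG := descent_cusp L0 (prime_gt0 pp) NE uD bD (@uSet_mulr N p pN) cf.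
have mG : modular k L (descent k r f) by case: cG.
have Lr i := L2_slash_r (r := r) (s := fun=> mx2 p%:Z 0 0 1) kl N0 L0 p0 uD bD (uSet_adj_bij N0 pp pN) i Lf mf.
have LG : L2 k L (descent k r f) := L2_fin Lr.
have GG : petersson k L (descent k r f) (descent k r f) = 0.
  rewrite (petersson_fin Lr LG) (adjoint (r := r) (s := fun=> mx2 p%:Z 0 0 1) kl N0 L0 p0 uD bD (uSet_adj_bij N0 pp pN) Lf LG mf mG).
  rewrite big1// => -[] _; apply: ortho.
  exists 1%N, (fun=> 1), (fun=> L), (fun=> p), (fun=> descent k r f); split.
    move=> _; split; [by rewrite mulnC -NE|by rewrite ltn_Pdiv ?prime_gt1|exact: cG].
  apply/funext => z; rewrite big_ord1 mul1r slash_upper_tri expr1n invr1 mul1r.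
  by rewrite mulr1 addr0.
have qL : qnorm k L (descent k r f) = 0%E by rewrite (qnorm_fin LG) GG.
have qN := qnorm_null N0 L0 (proj1 LG) mG qL.
have LGN : L2 k N (descent k r f) by split; [exact: (proj1 LG)|rewrite qN].
split=> //; apply: petersson_null => //.
by rewrite qnorm_Re qN.
Qed.
End Down.

Variables (f g : R[i] -> R[i]) (s t : R[i]).
Hypotheses (nf : new_space k N f) (ng : new_space k N g).
Hypotheses (Lf : L2 k N f) (Lg : L2 k N g).
Hypothesis fs : forall z, upper z -> hecke k N p f z = s * f z.
Hypothesis gt : forall z, upper z -> hecke k N p g z = t * g z.

Let kap : R := p%:R ^- k * p%:R.
Let kap0 : kap%:C != 0.
Proof. by rewrite fmorph_eq0 mulf_neq0 ?invr_eq0 ?expf_neq0// pnatr_eq0 -lt0n prime_gt0. Qed.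
Let kapE : (p%:R ^- k * p%:R : R[i]) = kap%:C.
Proof. by rewrite /kap rmorphM fmorphV rmorphXn /= -!natC. Qed.

(** When p^2 | N the trace consists of the cosets of U_p alone, so it is a nonzero multiple of U_p
    u. *)
Let descent_sq (u v : R[i] -> R[i]) (e : R[i]) : (p %| L)%N -> new_space k N u -> L2 k N u ->
  L2 k N v -> (forall z, upper z -> hecke k N p u z = e * u z) -> e * petersson k N u v = 0.
Proof.
move=> pL nu Lu Lv ue.
have [_] := descent_null (uSet_bij_sq N0 pp pN pL) nu Lu Lv.
rewrite (@eq_petersson _ _ _ _ (fun z => kap%:C * (e * u z)) v v) //; last first.
  by move=> z z0; rewrite /descent (sum_uR _ _ _ pp pN) kapE ue.
rewrite (peterssonZl _ (L2Z e Lu) Lv) (peterssonZl _ Lu Lv) => /eqP.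
by rewrite mulf_eq0 (negPf kap0) => /eqP.
Qed.

Let mod_of (u : R[i] -> R[i]) : new_space k N u -> modular k N u.
Proof. by case=> -[]. Qed.

(** If p^2 | N both sides vanish. Otherwise pairing with the null trace replaces U_p by minus the
    Atkin-Lehner operator, up to a real factor, and that operator is self-adjoint because [wSet] is
    stable under the adjugate. *)
Lemma eigen_prime : s * petersson k N f g = (t^*)%C * petersson k N f g.
Proof.
have [pL|npL] := boolP (p %| L)%N.
  rewrite (descent_sq pL nf Lf Lg fs).
  have := descent_sq pL ng Lg Lf gt; rewrite (petersson_conj Lf Lg).
  by move/(congr1 (@conjc R)); rewrite conjcM conjcK conjc0 => ->.
have [x [y xy]] : exists x y : int, p%:Z * y - L%:Z * x = 1.
  have [u [v uv]] := Bezoutz p%:Z L%:Z.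
  have cop : gcdz p%:Z L%:Z = 1.
    by rewrite /gcdz /=; congr Posz; apply/eqP; rewrite -/(coprime p L) prime_coprime.
  by exists (- v), u; rewrite mulrN opprK mulrC (mulrC L%:Z) uv cop.
(* The term [None] of the trace is the Atkin-Lehner slash and the remaining terms are U_p; their sum
   pairs to 0 with v. *)
have W1 (u v : R[i] -> R[i]) e : new_space k N u -> L2 k N u -> L2 k N v ->
    (forall z, upper z -> hecke k N p u z = e * u z) ->
    petersson k N (slash k u (wR N p x y)) v = - (kap%:C * e * petersson k N u v).
  move=> nu Lu Lv ue.
  have wD m : wSet N p m -> \det m = p%:Z by case.
  have bw := wSet_bij pp pN xy.
  have bw' := bw; rewrite -(wSet_adj N p) in bw'.
  have LW := L2_slash_r (r := fun=> wR N p x y) (s := fun=> wR N p x y) kl N0 N0 p0 wD bw bw' tt Lu (mod_of nu).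
  have [_] := descent_null (uSet_bij_exact N0 pp pN xy) nu Lu Lv.
  rewrite (@eq_petersson _ _ _ _ (fun z => slash k u (wR N p x y) z + kap%:C * (e * u z)) v v) //; last first.
    move=> z z0; rewrite /descent (bigD1 None) //=; congr (_ + _).
    rewrite (reindex_omap Some id) /=; last by case.
    by rewrite (eq_bigl xpredT) ?(sum_uR _ _ _ pp pN) ?kapE ?ue// => b; rewrite eqxx.
  have Le := L2Z kap%:C (L2Z e Lu).
  rewrite (peterssonDl LW Le Lv) (peterssonZl _ (L2Z e Lu) Lv) (peterssonZl _ Lu Lv) mulrA.
  by move/eqP; rewrite addr_eq0 => /eqP.
have wD m : wSet N p m -> \det m = p%:Z by case.
have bw := wSet_bij pp pN xy.
have bw' := bw; rewrite -(wSet_adj N p) in bw'.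
have LW := L2_slash_r (r := fun=> wR N p x y) (s := fun=> wR N p x y) kl N0 N0 p0 wD bw bw' tt Lg (mod_of ng).
have := adjoint (r := fun=> wR N p x y) (s := fun=> wR N p x y) kl N0 N0 p0 wD bw bw' Lf Lg (mod_of nf) (mod_of ng).
rewrite !sum_unit (W1 _ _ _ nf Lf Lg fs) (petersson_conj LW Lf) (W1 _ _ _ ng Lg Lf gt) (petersson_conj Lf Lg).
rewrite conjcN !conjcM conjcK conjc_real => /oppr_inj; rewrite -!mulrA.
by move/(mulfI kap0).
Qed.
End AtPrime.

Section Coprime.
Variables (R : realType) (k l N n : nat).
Hypotheses (kl : k = (l + l)%N) (N0 : (0 < N)%N) (n0 : (0 < n)%N) (nN : coprime n N).
Variables (f g : R[i] -> R[i]) (s t : R[i]).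
Hypotheses (mf : modular k N f) (mg : modular k N g).
Hypotheses (Lf : L2 k N f) (Lg : L2 k N g).
Hypothesis fs : forall z, upper z -> hecke k N n f z = s * f z.
Hypothesis gt : forall z, upper z -> hecke k N n g z = t * g z.

Let kap : R := n%:R ^- k * n%:R.
Let kap0 : kap%:C != 0.
Proof. by rewrite fmorph_eq0 mulf_neq0 ?invr_eq0 ?expf_neq0// pnatr_eq0 -lt0n. Qed.
Let kapE : (n%:R ^- k * n%:R : R[i]) = kap%:C.
Proof. by rewrite /kap rmorphM fmorphV rmorphXn /= -!natC. Qed.

Lemma eigen_coprime : s * petersson k N f g = (t^*)%C * petersson k N f g.
Proof.
have nz : 0 < n%:Z :> int by rewrite ltz_nat.
have dD m : heckeSet N n m -> \det m = n%:Z by case.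
have b1 := heckeSet_bij n0 nN; have b2 := b1; rewrite -(heckeSet_adj N n) in b2.
have Lr (u : R[i] -> R[i]) (Lu : L2 k N u) (mu : modular k N u) i :=
  L2_slash_r (r := fun i => heckeR (val i)) (s := fun i => heckeR (val i)) kl N0 N0 nz dD b1 b2 i Lu mu.
have S (u v : R[i] -> R[i]) e : modular k N u -> L2 k N u -> L2 k N v ->
    (forall z, upper z -> hecke k N n u z = e * u z) ->
    \sum_(i : heckeI n) petersson k N (slash k u (heckeR (val i))) v = kap%:C * e * petersson k N u v.
  move=> mu Lu Lv ue; rewrite -(petersson_fin (Lr u Lu mu) Lv).
  rewrite (@eq_petersson _ _ _ _ (fun z => kap%:C * (e * u z)) v v) //; last first.
    by move=> z z0; rewrite (sum_heckeR _ _ _ n0 nN) kapE ue.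
  by rewrite (peterssonZl _ (L2Z e Lu) Lv) (peterssonZl _ Lu Lv) mulrA.
have := adjoint (r := fun i => heckeR (val i)) (s := fun i => heckeR (val i)) kl N0 N0 nz dD b1 b2 Lf Lg mf mg; rewrite (S _ _ _ mf Lf Lg fs).
have -> : \sum_(j : heckeI n) petersson k N f (slash k g (heckeR (val j))) =
    ((\sum_(j : heckeI n) petersson k N (slash k g (heckeR (val j))) f)^*)%C.
  rewrite rmorph_sum /=; apply: eq_bigr => i _; exact: (petersson_conj (Lr g Lg mg i) Lf).
rewrite (S _ _ _ mg Lg Lf gt) (petersson_conj Lf Lg) !conjcM conjcK conjc_real -!mulrA.
by move/(mulfI kap0).
Qed.
End Coprime.

(** * Distinct newforms are orthogonal *)

Section Newforms.
Variables (R : realType) (k l N : nat).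
Hypotheses (kl : k = (l + l)%N) (N0 : (0 < N)%N).
Implicit Types f g : R[i] -> R[i].

Definition coef f n : R[i] := lambda k f n * (n%:R `^ ((k%:R - 1) / 2))%:C.

(** [lambda] falls back to the zero sequence when no expansion exists; the normalisation at index 1
    excludes that case. *)
Lemma newform_hasexp f : newforms k N f -> hasexp f (coef f).
Proof.
move=> [_ _ l1]; have h : fourier_expansion k f (lambda k f).
  have [[lam hl]|nl] := pselect (exists lam, fourier_expansion k f lam).
    exact: (xgetPex (fun=> 0) (ex_intro _ lam hl)).
  move: l1; rewrite /lambda xgetPN; first by move/eqP; rewrite eq_sym oner_eq0.
  by move=> lam hl; apply: nl; exists lam.
by move=> z z0; have /ccvgP := h z z0.
Qed.

Lemma coef1 f : newforms k N f -> coef f 1 = 1.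
Proof. by case=> _ _ l1; rewrite /coef l1 powR1 mulr1. Qed.

Lemma newform_L2 f : newforms k N f -> complex.Re (petersson k N f f) != 0 -> L2 k N f.
Proof.
move=> nf ff; split; first exact: hasexp_cmeas (newform_hasexp nf).
rewrite ltNge leye_eq; apply/negP => /eqP q.
by move: ff; rewrite qnorm_Re q eqxx.
Qed.

(** Self-adjointness gives s = conj t against <f, g> and t = conj t against <g, g>, so the
    eigenvalues agree. Coefficients then agree by strong induction: at n prime to N the coefficient
    is the eigenvalue, and otherwise a prime p dividing both n and N is split off by U_p. *)
Lemma newform_eq f g : newforms k N f -> newforms k N g -> L2 k N f -> L2 k N g ->
  petersson k N f g != 0 -> f = g.
Proof.
move=> nf ng Lf Lg fg; have fc := newform_hasexp nf; have gc := newform_hasexp ng.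
have [sf ef _] := nf; have [sg eg _] := ng.
have mf : modular k N f by case: sf => -[].
have mg : modular k N g by case: sg => -[].
have gg : petersson k N g g != 0.
  apply/negP => /eqP h; move/negP: fg; apply; rewrite (petersson_conj Lg Lf).
  by rewrite (petersson_null Lg Lf) ?h// conjc0.
have E n s t : (0 < n)%N ->
    (forall z, upper z -> hecke k N n f z = s * f z) ->
    (forall z, upper z -> hecke k N n g z = t * g z) ->
    (prime n && (n %| N)%N) || coprime n N -> s = t.
  move=> n0 fs gt /orP[/andP[pn nN]|nN].
    have /(mulIf fg) -> := eigen_prime kl N0 pn nN sf sg Lf Lg fs gt.
    by have /(mulIf gg) <- := eigen_prime kl N0 pn nN sg sg Lg Lg gt gt.
  have /(mulIf fg) -> := eigen_coprime kl N0 n0 nN mf mg Lf Lg fs gt.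
  by have /(mulIf gg) <- := eigen_coprime kl N0 n0 nN mg mg Lg Lg gt gt.
have C n : (0 < n)%N -> coef f n = coef g n.
  elim/ltn_ind: n => n IH n0.
  have [nN|nN] := boolP (coprime n N).
    have [s fs] := ef n n0; have [t gt] := eg n n0.
    rewrite (hecke_coef_coprime n0 nN fc fs) (hecke_coef_coprime n0 nN gc gt) !coef1//.
    by rewrite (E n s t)// nN orbT.
  have [p pp pd] : exists2 p, prime p & (p %| gcdn n N)%N.
    by exists (pdiv (gcdn n N)); [apply: pdiv_prime; rewrite ltn_neqAle eq_sym nN gcdn_gt0 n0|exact: pdiv_dvd].
  move: pd; rewrite dvdn_gcd => /andP[/dvdnP[q qE] pN].
  have q0 : (0 < q)%N by move: n0; rewrite qE muln_gt0 => /andP[].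
  have [s fs] := ef p (prime_gt0 pp); have [t gt] := eg p (prime_gt0 pp).
  have PP : (prime p && (p %| N)%N) || coprime p N by rewrite pp pN.
  have st := E p s t (prime_gt0 pp) fs gt PP.
  have qn : (q < n)%N by rewrite qE; exact: ltn_Pmulr (prime_gt1 pp) q0.
  rewrite qE mulnC (hecke_coef_prime pp pN fc fs q0) (hecke_coef_prime pp pN gc gt q0) st.
  by rewrite (IH q qn q0).
apply/funext => z; have [z0|nz] := pselect (upper z); last first.
  by case: sf => -[-> //]; case: sg => -[-> //].
have [r1 i1] := fc z z0; have [r2 i2] : ccvg (series (fun n => coef f n.+1 * e2pi (n.+1%:R * z))) (g z).
  by apply: eq_ccvg (gc z z0) => n; apply: eq_bigr => i _; rewrite C.
have e1 := cvg_unique (@Rhausdorff R) r1 r2; have e2 := cvg_unique (@Rhausdorff R) i1 i2.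
by move: e1 e2; case: (f z) (g z) => ? ? [? ?] /= -> ->.
Qed.

Lemma newform_ortho f g : newforms k N f -> newforms k N g -> L2 k N f -> L2 k N g ->
  f <> g -> petersson k N f g = 0.
Proof. by move=> nf ng Lf Lg fg; apply/eqP; apply/contraT => /(newform_eq nf ng Lf Lg). Qed.
End Newforms.

(** * The mean-value inequality *)

Section IncompleteGamma.
Variable R : realType.
Notation mu := (@lebesgue_measure R).

(** With s = k - 2 and b = 4 pi n this is the dependence on y of the n-th term of the norm: y^k
    e^(-4 pi n y) divided by y^2. *)
Definition gdens (s : nat) (b t : R) : R := t ^+ s * expR (- (b * t)).

Lemma measurable_gdens s b : measurable_fun [set: R] (gdens s b).
Proof.
apply: measurable_funM; first exact: measurable_funX.
apply: (measurableT_comp (@measurable_expR R)); apply: measurable_funN; exact: measurable_funM.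
Qed.

Lemma gdens_ge0 s b t : 0 <= t -> 0 <= gdens s b t.
Proof. by move=> t0; rewrite mulr_ge0 ?exprn_ge0 ?expR_ge0. Qed.

(** Monotonicity up to the mode s from 1 + v <= e^v alone: (t / u)^s <= e^(-s (u - t) / u) <= e^(t -
    u) when u <= s. *)
Lemma gdens_incr s (t u : R) : 0 <= t -> t <= u -> u <= s%:R -> gdens s 1 t <= gdens s 1 u.
Proof.
move=> t0 tu us; rewrite /gdens !mul1r; have [u0|u0] := leP u 0.
  by have -> : t = u by apply/eqP; rewrite eq_le tu (le_trans u0).
have h : t / u <= expR (- ((u - t) / u)).
  have -> : t / u = 1 + - ((u - t) / u) by field; rewrite gt_eqF.
  exact: expR_ge1Dx.
have h1 : (t / u) ^+ s <= expR (t - u).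
  apply: (@le_trans _ _ (expR (- ((u - t) / u)) ^+ s)).
    by apply: lerXn2r => //; rewrite nnegrE ?expR_ge0// divr_ge0// ltW.
  rewrite -expRM_natl ler_expR -mulr_natl.
  have : (u - t) / u * u <= (u - t) / u * s%:R.
    by rewrite ler_wpM2l// divr_ge0 ?subr_ge0// ltW.
  rewrite divfK ?gt_eqF//; lra.
have -> : t ^+ s = (t / u) ^+ s * u ^+ s by rewrite -exprMn divfK// gt_eqF.
have -> : expR (- u) = expR (t - u) * expR (- t) by rewrite -expRD; congr expR; ring.
rewrite mulrA ler_wpM2r ?expR_ge0// mulrC ler_wpM2l// exprn_ge0//; exact: ltW.
Qed.

Local Open Scope ereal_scope.

Definition upperG s (b x : R) : \bar R := \int[mu]_(t in `[x, +oo[) (gdens s b t)%:E.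

Lemma upperG_ge0 s (b x : R) : (0 <= x)%R -> 0 <= upperG s b x.
Proof.
move=> x0; apply: integral_ge0 => t /=; rewrite in_itv/= andbT => xt.
by rewrite lee_fin gdens_ge0// (le_trans x0).
Qed.

Let mg s b (D : set R) : measurable_fun D (fun t => (gdens s b t)%:E).
Proof. by apply/measurable_EFinP; apply: measurable_funTS; exact: measurable_gdens. Qed.

Lemma upperG_scale s (b y : R) : (0 < b)%R -> (0 < y)%R ->
  upperG s 1 (b * y)%R = (b ^+ s.+1)%:E * upperG s b y.
Proof.
move=> b0 y0; rewrite /upperG integral_mkcond.
rewrite (ge0_integral_lebesgueM b0); last 2 first.
- by apply/(measurable_restrictT _ _).1 => //; exact: mg.
- move=> t; apply: erestrict_ge0 => u /=; rewrite in_itv/= andbT => yu.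
  by rewrite lee_fin gdens_ge0// (le_trans _ yu)// mulr_ge0// ltW.
have -> : (fun x => ((fun t => (gdens s 1 t)%:E) \_ `[(b * y)%R, +oo[) (b * x)%R) =
    (fun x => (b ^+ s)%:E * (gdens s b x)%:E) \_ `[y, +oo[.
  apply/funext => x; rewrite !patchE.
  have -> : (b * x \in `[b * y, +oo[%classic)%R = (x \in `[y, +oo[%classic).
    by rewrite !mem_setE !in_itv/= !andbT ler_pM2l.
  by case: ifP => // _; rewrite -EFinM /gdens exprMn mul1r; congr EFin; ring.
rewrite -integral_mkcond ge0_integralZl//; last 3 first.
- exact: mg.
- move=> x /=; rewrite in_itv/= andbT => yx; rewrite lee_fin gdens_ge0// (le_trans _ yx)//; exact: ltW.
- by rewrite lee_fin exprn_ge0// ltW.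
by rewrite muleA -EFinM exprS.
Qed.

Lemma upperG_exp (x : R) : (0 <= x)%R -> upperG 0 1 x = (expR (- x))%:E * upperG 0 1 0%R.
Proof.
move=> x0; rewrite /upperG integral_mkcond -(ge0_integral_lebesgueD x); last 2 first.
- by apply/(measurable_restrictT _ _).1 => //; exact: mg.
- move=> t; apply: erestrict_ge0 => u /=; rewrite in_itv/= andbT => yu.
  by rewrite lee_fin gdens_ge0// (le_trans _ yu).
have -> : (fun t => ((fun t => (gdens 0 1 t)%:E) \_ `[x, +oo[) (t + x)%R) =
    (fun t => (expR (- x))%:E * (gdens 0 1 t)%:E) \_ `[0%R, +oo[.
  apply/funext => t; rewrite !patchE.
  have -> : (t + x \in `[x, +oo[%classic)%R = (t \in `[0%R, +oo[%classic).
    by rewrite !mem_setE !in_itv/= !andbT; apply/idP/idP; lra.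
  case: ifP => // _; rewrite -EFinM /gdens !expr0 !mul1r -expRD; congr (expR _)%:E; ring.
rewrite -integral_mkcond ge0_integralZl//.
- exact: mg.
- by move=> t /=; rewrite in_itv/= andbT => t0; rewrite lee_fin gdens_ge0.
Qed.

(** [Gamma] is the [fine] of its integral: the same value if finite and 0 if infinite. The
    inequality covers both cases. *)
Lemma Gamma_le s : (Gamma s.+1%:R)%:E <= \int[mu]_(t in `]0%R, +oo[) (gdens s 1 t)%:E.
Proof.
rewrite /Gamma /Rintegral.
have -> : \int[mu]_(t in `]0%R, +oo[) (t `^ (s.+1%:R - 1) * expR (- t))%:E =
    \int[mu]_(t in `]0%R, +oo[) (gdens s 1 t)%:E.
  apply: eq_integral => t; rewrite inE/= in_itv/= andbT => t0.
  by rewrite -natr1 addrK powR_mulrn ?ltW// /gdens mul1r.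
have : 0 <= \int[mu]_(t in `]0%R, +oo[) (gdens s 1 t)%:E.
  apply: integral_ge0 => t /=; rewrite in_itv/= andbT => t0.
  by rewrite lee_fin gdens_ge0// ltW.
by case: (\int[mu]_(t in _) _) => //= _; rewrite leey.
Qed.

Lemma Gamma_ge0 (s : R) : (0 <= Gamma s)%R.
Proof.
apply: fine_ge0; apply: integral_ge0 => t _; rewrite lee_fin mulr_ge0 ?expR_ge0//.
exact: powR_ge0.
Qed.

(* The integrand increases up to t = s, so the mass below x is at most
   x / (s - x) <= 8 times the mass of [x, s]. *)
Lemma Gamma_upperG s (x : R) : (0 < x)%R -> (9 * x <= 8 * s%:R)%R ->
  (Gamma s.+1%:R)%:E <= 9%:E * upperG s 1 x.
Proof.
move=> x0 xs; apply: (le_trans (Gamma_le s)).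
have xs' : (x <= s%:R)%R by lra.
have -> : `]0%R, +oo[%classic = `]0%R, x[%classic `|` `[x, +oo[%classic :> set R.
  by apply: itv_bndbnd_setU; rewrite bnd_simp// ltW.
rewrite ge0_integral_setU//; last 3 first.
- exact: mg.
- move=> t [|] /=; rewrite in_itv/= ?andbT => h; rewrite lee_fin gdens_ge0//.
    by case/andP: h => /ltW.
  by rewrite (le_trans _ h)// ltW.
- apply/disj_setPS => t [] /=; rewrite !in_itv/= andbT => /andP[_ tx] xt.
  by move: tx; rewrite ltNge xt.
set h := gdens s 1 x.
have h0 : (0 <= h)%R by rewrite gdens_ge0// ltW.
have lo : \int[mu]_(t in `]0%R, x[) (gdens s 1 t)%:E <= (h * x)%:E.
  apply: (@le_trans _ _ (\int[mu]_(t in `]0%R, x[) cst h%:E t)).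
    apply: ge0_le_integral => //.
    - by move=> t /=; rewrite in_itv/= => /andP[/ltW t0 _]; rewrite lee_fin gdens_ge0.
    - exact: mg.
    - move=> t /=; rewrite in_itv/= => /andP[/ltW t0 /ltW tx].
      by rewrite lee_fin gdens_incr.
  rewrite integral_cst//= lebesgue_measure_itv/= lte_fin x0 -EFinD -EFinM subr0//.
have hi : (h * (s%:R - x))%:E <= upperG s 1 x.
  apply: (@le_trans _ _ (\int[mu]_(t in `[x, s%:R]) (gdens s 1 t)%:E)); last first.
    apply: ge0_subset_integral => //.
    - exact: mg.
    - move=> t /=; rewrite in_itv/= andbT => xt; rewrite lee_fin gdens_ge0// (le_trans _ xt)//; exact: ltW.
    - by move=> t /=; rewrite !in_itv/= andbT => /andP[].
  apply: (@le_trans _ _ (\int[mu]_(t in `[x, s%:R]) cst h%:E t)).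
    rewrite integral_cst//= lebesgue_measure_itv/= lte_fin.
    case: ltP => [_|sx]; first by rewrite -EFinD -EFinM.
    by rewrite mule0 lee_fin (_ : s%:R - x = 0)%R ?mulr0//; lra.
  apply: ge0_le_integral => //.
  - exact: mg.
  - move=> t /=; rewrite in_itv/= => /andP[xt ts].
    by rewrite lee_fin gdens_incr// ltW.
apply: (@le_trans _ _ (8%:E * upperG s 1 x + upperG s 1 x)).
  apply: leeD => //; apply: (le_trans lo); apply: (@le_trans _ _ (8%:E * (h * (s%:R - x))%:E)).
    rewrite -EFinM lee_fin mulrCA ler_wpM2l//; lra.
  exact: lee_wpmul2l.
rewrite -[X in _ + X]mul1e -ge0_muleDl// ?lee_fin//.
by rewrite -EFinD (_ : 8 + 1 = 9)%R//; ring.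
Qed.

(** For s = 0 the density decreases from the start, but its tail beyond x is exactly e^(-x) times
    the full mass. *)
Lemma Gamma_upperG0 (x : R) : (0 < x)%R -> (x <= 4)%R ->
  (Gamma 1)%:E <= (expR 4)%:E * upperG 0 1 x.
Proof.
move=> x0 x4; rewrite (upperG_exp (ltW x0)) muleA -EFinM -expRD.
apply: (@le_trans _ _ (upperG 0 1 0%R)).
  apply: (le_trans (Gamma_le 0)); apply: ge0_subset_integral => //.
  - exact: mg.
  - by move=> t /=; rewrite in_itv/= andbT => t0; rewrite lee_fin gdens_ge0.
  - by move=> t /=; rewrite !in_itv/= !andbT => /ltW.
rewrite -[leLHS]mul1e; apply: lee_wpmul2r; first exact: upperG_ge0.
rewrite lee_fin -[leLHS]expR0 ler_expR; lra.
Qed.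
End IncompleteGamma.

(** * Lower bound for the norm from the half-strip *)

Section Strip.
Variables (R : realType) (N : nat).
Hypothesis N0 : (0 < N)%N.
Notation mu := (@lebesgue_measure R).

Definition strip : set (R * R) := @unitI R `*` `[(N%:R^-1 : R), +oo[.

Lemma strip_fund : strip `<=` fund_domain N.
Proof.
move=> [x y] [/=]; rewrite /unitI /= !in_itv/= andbT => /andP[x1 x2] yN.
have Nn : 0 < N%:R :> R by rewrite ltr0n.
have y0 : 0 < y by rewrite (lt_le_trans _ yN)// invr_gt0.
have z0 : upper (x +i* y) by [].
split => //=; first by rewrite ler_norml x1.
move=> g Gg; rewrite Im_moebius ?(Gamma0_det Gg)//= mul1r ler_pdivrMr ?sqC_gt0; last first.
  by rewrite autj_neq0// (Gamma0_det Gg).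
apply: ler_peMr; [exact: ltW|]; rewrite -[x +i* y]/(toC (x, y)) sqC_autj /=.
have [dg /dvdzP[q qE]] := Gg; have [q0|q0] := eqVneq q 0.
  have c0 : g 1 0 = 0 by rewrite qE q0 mul0r.
  move: dg; rewrite /SL2Z/= det2 c0 mulr0 subr0 => /int_mul_eq1 d1.
  by rewrite !mul0r add0r expr0n addr0; case: d1 => -[_ ->]; rewrite ?mulrN1z ?sqrrN expr1n.
apply: (@le_trans _ _ (((g 1 0)%:~R * y) ^+ 2)); last by rewrite lerDr sqr_ge0.
rewrite exprMn qE intrM exprMn.
have Ny : 1 <= N%:R * y by rewrite mulrC -ler_pdivrMr// div1r.
have q1 : 1 <= (q%:~R : R) ^+ 2.
  by rewrite -rmorphXn /= ler1z; move: q0; nia.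
rewrite -mulrA -exprMn -[leLHS]mulr1; apply: ler_pM => //.
by rewrite -[leLHS](expr1n _ 2) lerXn2r// nnegrE ?mulr_ge0// ltW.
Qed.

Local Open Scope ereal_scope.

Lemma qnorm_strip s (F : R[i] -> R[i]) c M : hasexp F c ->
  \sum_(n < M) (sqC (c n.+1))%:E * upperG s (4 * pi * n.+1%:R)%R (N%:R^-1)%R <= qnorm s.+2 N F.
Proof.
move=> Fc; have mF := hasexp_cmeas Fc.
pose B : set R := `[(N%:R^-1)%R, +oo[%classic.
pose f (p : R * R) : \bar R := (sqC (F (toC p)) * (p.2 ^+ s.+2 / p.2 ^+ 2))%:E.
have mB : measurable (B : set (measurableTypeR R)) by exact: measurable_itv.
have mS : measurable (strip : set (measurableTypeR R * measurableTypeR R)).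
  by apply: measurableX => //; exact: measurable_unitI.
have By y : B y -> (0 < y)%R.
  by rewrite /B /= in_itv/= andbT => h; rewrite (lt_le_trans _ h)// invr_gt0 ltr0n.
have mf : measurable_fun (fund_domain N) f.
  apply/measurable_EFinP; apply: (@fund_measurable R N); apply: measurable_funM.
    exact: measurable_sqC.
  by apply: measurable_funTS; exact: measurable_dens.
have f0 p : uhp p -> 0 <= f p.
  by move=> p0; rewrite lee_fin mulr_ge0 ?sqC_ge0// divr_ge0// exprn_ge0// ltW.
apply: (@le_trans _ _ (\int[@area R]_(p in strip) f p)); last first.
  apply: ge0_subset_integral => //; first exact: mfund.
  - by move=> p /fund_domain_uhp /f0.
  - exact: strip_fund.
pose fs := f \_ strip.
have fs0 p : 0 <= fs p.
  by apply: erestrict_ge0 => q /strip_fund /fund_domain_uhp /f0.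
have mfs : measurable_fun setT fs.
  apply/(measurable_restrictT _ _).1 => //.
  by apply: measurable_funS mf; [exact: mfund|exact: strip_fund].
have -> : \int[@area R]_(p in strip) f p = \int[mu]_y fubini_G mu fs y.
  by rewrite integral_mkcond; exact: (fubini_tonelli2 (m1 := mu) (m2 := mu) fs mfs fs0).
pose h (n : 'I_M) y := ((sqC (c n.+1))%:E * (gdens s (4 * pi * n.+1%:R)%R y)%:E).
have h0 n y : B y -> 0 <= h n y.
  by move=> /By y0; rewrite mule_ge0// lee_fin ?sqC_ge0// gdens_ge0// ltW.
have mh n : measurable_fun B (h n).
  apply: emeasurable_funM; first exact: measurable_cst.
  by apply/measurable_EFinP; apply: measurable_funTS; exact: measurable_gdens.
have -> : \sum_(n < M) (sqC (c n.+1))%:E * upperG s (4 * pi * n.+1%:R)%R (N%:R^-1)%R =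
    \int[mu]_(y in B) \sum_(n < M) h n y.
  rewrite ge0_integral_sum//; apply: eq_bigr => n _; rewrite /h ge0_integralZl//.
  - by apply/measurable_EFinP; apply: measurable_funTS; exact: measurable_gdens.
  - by move=> y /By y0; rewrite lee_fin gdens_ge0// ltW.
  - by rewrite lee_fin sqC_ge0.
rewrite integral_mkcond; apply: ge0_le_integral => //.
- by move=> y _; apply: erestrict_ge0 => u Bu; apply: sume_ge0 => n _; exact: h0.
- by apply/(measurable_restrictT _ _).1 => //; exact: emeasurable_sum.
- exact: measurable_fun_fubini_tonelli_G.
move=> y _; rewrite patchE /fubini_G; case: ifPn => [|_]; last by apply: integral_ge0.
rewrite inE => yB; have y0 := By y yB.
(* At fixed y the weight y^s is moved inside the square as the constant r, so that Bessel's
   inequality applies to r F. *)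
pose r := Num.sqrt (y ^+ s).
have rE : (r ^+ 2 = y ^+ s)%R by rewrite sqr_sqrtr// exprn_ge0// ltW.
have := bessel (hasexpZ r%:C Fc) y0 M.
have -> : \int[mu]_x fs (x, y) = \int[mu]_(x in @unitI R) (sqC (r%:C * F (x +i* y)))%:E.
  rewrite [RHS]integral_mkcond; apply: eq_integral => x _; rewrite /fs !patchE.
  have -> : ((x, y) \in strip) = (x \in @unitI R).
    apply/idP/idP => /set_mem; first by case=> xu _; apply/mem_set.
    by move=> xu; apply/mem_set; split.
  case: ifP => // _; rewrite /f sqCM sqC_real rE /toC /= mulrC; congr (_ * _)%:E.
  by rewrite -addn2 exprD mulfK// expf_neq0// gt_eqF.
apply: le_trans; rewrite /h sumEFin lee_fin; apply: ler_sum => n _.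
by rewrite /gdens sqCM sqC_real rE mulrA (mulrC (sqC _)).
Qed.
End Strip.

Lemma Re_sum (R : realType) (I : finType) (F : I -> R[i]) :
  complex.Re (\sum_i F i) = \sum_i complex.Re (F i).
Proof. by rewrite raddf_sum. Qed.

(** * Duality *)

Section LargeSieve.
Variables (R : realType) (s l N M : nat) (C : R).
Hypotheses (kl : s.+2 = (l + l)%N) (N0 : (0 < N)%N) (C0 : 0 < C).
Hypothesis GC : forall m, (0 < m <= M)%N ->
  ((Gamma s.+1%:R)%:E <= C%:E * upperG s 1 (4 * pi * m%:R / N%:R)%R)%E.
Notation k := (s.+2).

(** The value of omega_f <f, f>, common to all newforms of finite nonzero norm. *)
Let kap : R := Gamma s.+1%:R / (4 * pi) ^+ s.+1.
Let pi4 : 0 < 4 * pi :> R. Proof. by rewrite mulr_gt0// pi_gt0. Qed.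
Let kap0 : 0 <= kap. Proof. by rewrite divr_ge0 ?Gamma_ge0// exprn_ge0// ltW. Qed.
Let kE : (k%:R - 1 = s.+1%:R :> R). Proof. by rewrite -natr1 addrK. Qed.

Let sq_weight (m : nat) : (m%:R `^ ((k%:R - 1) / 2)) ^+ 2 = m%:R ^+ s.+1 :> R.
Proof.
rewrite -powR_mulrn ?powR_ge0// -powRrM divfK ?pnatr_eq0// kE powR_mulrn//.
Qed.

(** The factor m^(k-1) in the squared coefficients cancels against the scaling of the incomplete
    Gamma integral by (4 pi m)^(k-1); what is left has the same constant [kap] for every m. *)
Lemma coef_bound F (lam : nat -> R[i]) :
  hasexp F (fun n => lam n * (n%:R `^ ((k%:R - 1) / 2))%:C) ->
  ((kap * \sum_(m < M) sqC (lam m.+1))%:E <= C%:E * qnorm k N F)%E.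
Proof.
move=> Fl; have := qnorm_strip N0 s M Fl => h.
apply: (le_trans _ (lee_wpmul2l _ h)); last by rewrite lee_fin ltW.
have y0 : 0 < (N%:R^-1 : R) by rewrite invr_gt0 ltr0n.
rewrite ge0_sume_distrr; last first.
  by move=> m _; rewrite mule_ge0// ?lee_fin ?sqC_ge0// upperG_ge0// ltW.
rewrite mulr_sumr -sumEFin; apply: lee_sum => m _.
have b0 : 0 < 4 * pi * m.+1%:R :> R by rewrite mulr_gt0.
have := GC (m := m.+1); rewrite ltn_ord => /(_ isT).
rewrite (upperG_scale s b0 y0) => g.
rewrite sqCM sqC_real sq_weight.
have -> : (kap * sqC (lam m.+1))%:E =
    ((sqC (lam m.+1) * (4 * pi) ^- s.+1)%:E * (Gamma s.+1%:R)%:E)%E.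
  by rewrite -EFinM /kap; congr (_%:E); ring.
apply: (le_trans (lee_wpmul2l _ g)).
  by rewrite lee_fin mulr_ge0 ?sqC_ge0// invr_ge0 exprn_ge0// ltW.
rewrite !muleA -!EFinM le_eqVlt; apply/orP; left; apply/eqP; congr (_%:E * _)%E.
rewrite [(4 * pi * m.+1%:R) ^+ _]exprMn.
have : (4 * pi) ^+ s.+1 != 0 :> R by rewrite expf_neq0//; exact: lt0r_neq0.
move: ((4 * pi) ^+ s.+1) (m.+1%:R ^+ s.+1) => P Q P0; field; exact: P0.
Qed.

Section Dual.
Variables (n : nat) (phi : 'I_n -> R[i] -> R[i]) (a : nat -> R[i]).
Hypotheses (phiI : injective phi) (nphi : forall i, newforms k N (phi i)).
Hypothesis phi0 : forall i, complex.Re (petersson k N (phi i) (phi i)) != 0.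

Let w i := omega k N (phi i).
Let q i := complex.Re (petersson k N (phi i) (phi i)).
Let b i : R[i] := \sum_(m < M) a m.+1 * lambda k (phi i) m.+1.
Let e i : R[i] := (w i)%:C * conjc (b i).
Let lam m : R[i] := \sum_i e i * lambda k (phi i) m.
Let F z := \sum_i e i * phi i z.
Let S := \sum_i w i * sqC (b i).

Let q0 i : 0 < q i. Proof. by rewrite lt_neqAle eq_sym phi0 petersson_ge0. Qed.

Let wq i : w i * q i = kap.
Proof.
rewrite /w /omega -/(q i) kE subn1 /= /kap; field.
by rewrite (lt0r_neq0 (q0 i)) expf_neq0//; exact: lt0r_neq0.
Qed.

Let L i : L2 k N (phi i). Proof. exact: newform_L2 (nphi i) (phi0 i). Qed.

Let LF : L2 k N F.
Proof. by apply: L2_sum => i; exact: L2Z. Qed.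

Let hF : hasexp F (fun m => lam m * (m%:R `^ ((k%:R - 1) / 2))%:C).
Proof.
apply: eq_hasexp_coef (hasexp_bigsum _ (fun i _ => hasexpZ (e i) (newform_hasexp (nphi i)))) => m.
by rewrite /lam mulr_suml; apply: eq_bigr => i _; rewrite /coef mulrA.
Qed.

Let phiE i j : petersson k N (phi j) (phi i) = if j == i then (q i)%:C else 0.
Proof.
case: eqVneq => [->|ji].
  by have := petersson_real k N (phi i); rewrite /q; case: (petersson _ _ _ _) => x y /= ->.
apply: (newform_ortho kl N0) (nphi j) (nphi i) (L j) (L i) _ => h.
by move/eqP: ji; apply; exact: phiI.
Qed.

Let FF : complex.Re (petersson k N F F) = kap * S.
Proof.
rewrite {1}/F (petersson_suml (fun i => L2Z (e i) (L i)) LF) Re_sum mulr_sumr.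
apply: eq_bigr => i _; rewrite (peterssonZl _ (L i) LF) (petersson_conj LF (L i)).
rewrite {1}/F (petersson_suml (fun i => L2Z (e i) (L i)) (L i)).
have -> : \sum_j petersson k N (fun z => e j * phi j z) (phi i) = e i * (q i)%:C.
  rewrite (bigD1 i) //= (peterssonZl _ (L i) (L i)) phiE eqxx big1 ?addr0// => j ji.
  by rewrite (peterssonZl _ (L j) (L i)) phiE (negPf ji) mulr0.
rewrite -(wq i) /e; case: (b i) => x y; rewrite /sqC /=; ring.
Qed.

Let SE : S = complex.Re (\sum_(m < M) a m.+1 * lam m.+1).
Proof.
transitivity (complex.Re (\sum_i e i * b i)).
  rewrite raddf_sum /=; apply: eq_bigr => i _.
  by rewrite /e; case: (b i) => x y; rewrite /sqC /=; ring.
congr complex.Re; under eq_bigr do rewrite /b mulr_sumr.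
rewrite exchange_big /=; apply: eq_bigr => m _; rewrite /lam mulr_sumr.
by apply: eq_bigr => i _; rewrite mulrCA.
Qed.

Let w0 i : 0 <= w i.
Proof.
by rewrite /w /omega kE divr_ge0 ?Gamma_ge0// mulr_ge0 ?petersson_ge0// exprn_ge0// ltW.
Qed.

(* Duality: S = sum a lam <= (C sum |a|^2 + sum |lam|^2 / C) / 2, and the
   second sum is at most C S by the bound on the norm of F. *)
Lemma dual_bound : \sum_i omega k N (phi i) *
    sqC (\sum_(m < M) a m.+1 * lambda k (phi i) m.+1) <= C * \sum_(m < M) sqC (a m.+1).
Proof.
rewrite -/S; set A := \sum_(m < M) _; pose T := \sum_(m < M) sqC (lam m.+1).
have A0 : 0 <= A by apply: sumr_ge0 => m _; exact: sqC_ge0.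
(* Each weight times a positive norm equals [kap], so for [kap] = 0 all weights vanish; otherwise
   [kap] can be divided out. *)
have [k0|k0] := eqVneq kap 0.
  rewrite /S big1 ?mulr_ge0 ?(ltW C0)// => i _.
  have /eqP := wq i; rewrite k0 mulf_eq0 (gt_eqF (q0 i)) orbF => /eqP ->.
  by rewrite mul0r.
have kp : 0 < kap by rewrite lt_neqAle eq_sym k0.
have TS : T <= C * S.
  have := coef_bound hF; rewrite (qnorm_fin LF) FF -EFinM lee_fin.
  by rewrite mulrCA ler_pM2l.
have h : 2 * S <= C * A + C^-1 * T.
  rewrite SE raddf_sum /A /T /= !mulr_sumr -big_split /=; apply: ler_sum => m _.
  case: (a m.+1) (lam m.+1) => x y [u v]; rewrite /sqC /= -subr_ge0.
  have -> : C * (x ^+ 2 + y ^+ 2) + C^-1 * (u ^+ 2 + v ^+ 2) - 2 * (x * u - y * v) =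
      C^-1 * ((C * x - u) ^+ 2 + (C * y + v) ^+ 2) by field; rewrite lt0r_neq0.
  by rewrite mulr_ge0 ?invr_ge0 ?(ltW C0)// addr_ge0// sqr_ge0.
have : C^-1 * T <= S by rewrite mulrC ler_pdivrMr// mulrC.
lra.
Qed.
End Dual.

(** The sum is a supremum over finite sets of newforms, so the finite bound suffices. *)
Lemma newform_sum_le (a : nat -> R[i]) (X : R) : M = Num.truncn X ->
  (newform_sum k N X a <= (C * normsq X a)%:E)%E.
Proof.
move=> MX; apply: ge_ereal_sup => _ [B [finB Bn] <-].
(* The condition that m does not divide N is imposed by zeroing coefficients, which can only
   decrease the norm. *)
pose a' m : R[i] := if (m %| N)%N then 0 else a m.
pose t f := omega k N f * sqC (\sum_(m < M) a' m.+1 * lambda k f m.+1).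
have tE f : omega k N f * cabs (\sum_(1 <= m < (Num.truncn X).+1 | ~~ (m %| N)%N)
    a m * lambda k f m) ^+ 2 = t f.
  rewrite sqCE /t; congr (_ * sqC _); rewrite big_mkcond big_add1 /= -MX big_mkord.
  apply: eq_bigr => m _; rewrite /a'; case: (_ %| _)%N => //=; by rewrite mul0r.
rewrite fsbig_finite//; under eq_bigr do rewrite tE.
rewrite sumEFin lee_fin (bigID (fun f => complex.Re (petersson k N f f) != 0)).
rewrite [X in _ + X <= _]big1 ?addr0; last first.
  (* Here division by 0 gives [omega] the value 0. *)
  by move=> f /negPn /eqP f0; rewrite /t /omega f0 mulr0 invr0 mulr0 mul0r.
rewrite -big_filter; set r := seq.filter _ _.
have rP f : f \in r -> newforms k N f /\ complex.Re (petersson k N f f) != 0.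
  rewrite mem_filter => /andP[f0 fB]; split; last exact: f0.
  by apply: Bn; move: fB; rewrite in_fset_set// => /set_mem.
have ru : uniq r by rewrite filter_uniq// finmap.fset_uniq.
rewrite (big_nth (fun=> 0)) big_mkord.
have rI : injective (fun i : 'I_(size r) => nth (fun=> 0) r i).
  by move=> i j /eqP; rewrite nth_uniq// => /eqP /val_inj.
have r1 (i : 'I_(size r)) := rP _ (mem_nth (fun=> 0) (ltn_ord i)).
apply: (le_trans (dual_bound a' rI (fun i => (r1 i).1) (fun i => (r1 i).2))).
rewrite ler_pM2l// /normsq big_add1 /= -MX big_mkord; apply: ler_sum => m _.
by rewrite sqCE /a'; case: ifP => // _; rewrite sqC0 sqC_ge0.
Qed.
End LargeSieve.

(** * What the hypothesis on the level gives *)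

Section Thresholds.
Variables (R : realType) (N m : nat) (M alpha : R).
Hypotheses (N0 : (0 < N)%N) (m0 : (0 < m)%N) (mM : m%:R <= M) (a1 : alpha < 1).

Let x : R := 4 * pi * m%:R / N%:R.
Let Nr : 0 < N%:R :> R. Proof. by rewrite ltr0n. Qed.
Let pi0 : 0 < pi :> R. Proof. exact: pi_gt0. Qed.

Lemma threshold_gt0 : 0 < x.
Proof. by rewrite divr_gt0// mulr_gt0 ?ltr0n// mulr_gt0. Qed.

Let powR_alpha (k : nat) : (0 < k)%N -> (k%:R : R) `^ alpha <= k%:R.
Proof.
move=> k0; rewrite -[leRHS]powRr1 ?ler0n//; apply: ler_powR; last exact: ltW.
by rewrite ler1n.
Qed.

Let piM : 4 * pi * m%:R <= 2 * (2 * pi * M).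
Proof. by rewrite (_ : 2 * (2 * pi * M) = 4 * pi * M); [rewrite ler_pM2l// mulr_gt0|ring]. Qed.

(* e^(k/(k-3)) = e e^(3/(k-3)) >= (9/4) (1 + 3/(k-3)), as e >= (1 + 1/2)^2. *)
Lemma threshold k : (3 < k)%N ->
  2 * pi * M * expR (k%:R / (k%:R - 3)) <= N%:R * k%:R `^ alpha -> 9 * x <= 8 * (k - 2)%N%:R.
Proof.
move=> k3 h; have kr : 3 < k%:R :> R by rewrite ltr_nat.
have d0 : 0 < k%:R - 3 :> R by rewrite subr_gt0.
have kp : 0 < k%:R :> R by lra.
have E : 9 / 4 * (k%:R / (k%:R - 3)) <= expR (k%:R / (k%:R - 3)) :> R.
  have -> : (k%:R / (k%:R - 3) : R) = 1 + 3 / (k%:R - 3) by field; rewrite gt_eqF.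
  rewrite expRD; apply: ler_pM => //; [by rewrite addr_ge0// divr_ge0// ltW| |exact: expR_ge1Dx].
  have -> : expR 1 = expR 2^-1 * expR 2^-1 :> R by rewrite -expRD; congr expR; field.
  have : 1 + 2^-1 <= expR (2^-1) :> R by exact: expR_ge1Dx.
  by move: (expR _) => u; nra.
have pM : 0 < 2 * pi * M by rewrite mulr_gt0 ?mulr_gt0// (lt_le_trans _ mM)// ltr0n.
have h1 : 2 * pi * M * (9 / 4 * (k%:R / (k%:R - 3))) <= N%:R * k%:R.
  apply: (le_trans _ (le_trans h _)); first by rewrite ler_pM2l.
  by rewrite ler_pM2l// powR_alpha// (leq_trans _ k3).
have h2 : 2 * pi * M * 9 <= 4 * (N%:R * (k%:R - 3)).
  rewrite -(ler_pM2r (x := k%:R / (k%:R - 3)) _ _) ?divr_gt0//.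
  have -> : 4 * (N%:R * (k%:R - 3)) * (k%:R / (k%:R - 3)) = 4 * (N%:R * k%:R) :> R.
    by field; rewrite gt_eqF.
  by move: h1; lra.
have h3 : 9 * (4 * pi * m%:R) <= 8 * (k%:R - 3) * N%:R :> R.
  have -> : 8 * (k%:R - 3) * N%:R = 2 * (4 * (N%:R * (k%:R - 3))) :> R by ring.
  apply: (le_trans (y := 2 * (2 * pi * M * 9))); last by rewrite ler_pM2l.
  have -> : 2 * (2 * pi * M * 9) = 9 * (2 * (2 * pi * M)) by ring.
  by rewrite ler_pM2l.
have h4 : 9 * x <= 8 * (k%:R - 3) by rewrite /x mulrA ler_pdivrMr.
rewrite natrB; last by rewrite (leq_trans _ k3).
by move: h4; lra.
Qed.

(** Since 2^alpha <= 2, 4 pi m <= 2 (2 pi M) <= 4 N. *)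
Lemma threshold2 : 2 * pi * M <= N%:R * 2%:R `^ alpha -> x <= 4.
Proof.
move=> h; rewrite /x ler_pdivrMr//; have := @powR_alpha 2 isT.
have : N%:R * 2%:R `^ alpha <= N%:R * 2%:R :> R by rewrite ler_pM2l// powR_alpha.
by move: piM h; lra.
Qed.
End Thresholds.

Lemma le_bound (R : realType) (C A X : R) : 0 <= C -> 0 <= A -> 0 <= X -> C * A <= C * (1 + X) * A.
Proof. by move=> C0 A0 X0; rewrite ler_wpM2r// ler_peMr// lerDl. Qed.

Theorem theorem1p4 (R : realType) :
  exists C : R, 0 < C /\
  forall (k N : nat) (M alpha : R) (a : nat -> R[i]),
    ~~ odd k -> (0 < N)%N -> 1 < M -> 1 / 2 < alpha -> alpha < 1 ->
    ((2 < k)%N ->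
      2 * pi * M * expR (k%:R / (k%:R - 3)) <= N%:R * k%:R `^ alpha ->
      (newform_sum k N M a <=
        (C * (1 + M / (N%:R * k%:R `^ eta k alpha)) * normsq M a)%:E)%E)
    /\
    (k = 2%N ->
      2 * pi * M <= N%:R * k%:R `^ alpha ->
      (newform_sum k N M a <=
        (C * (1 + M * ln M / (N%:R * k%:R `^ eta k alpha)) * normsq M a)%:E)%E).
Proof.
have C0 : 0 < 9 + expR 4 :> R by rewrite addr_gt0// expR_gt0.
(* The 9 serves the even weights k >= 4, the e^4 serves k = 2. *)
exists (9 + expR 4); split=> // k N M alpha a evk N0 M1 _ a1.
have A0 : 0 <= normsq M a by apply: sumr_ge0 => m _; exact: sqr_ge0.
have M0 : 0 <= M by lra.
have D0 : 0 <= N%:R * k%:R `^ eta k alpha by rewrite mulr_ge0// powR_ge0.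
have trM m : (0 < m <= Num.truncn M)%N -> m%:R <= M.
  by move=> /andP[_ mM]; have /andP[h _] := truncn_itv M0; rewrite (le_trans _ h)// ler_nat.
have U s x : 0 < x -> (0 <= upperG s 1 x)%E by move=> x0; exact/upperG_ge0/ltW.
split => [k2 h|k2 h].
  have [s kE] : exists s, k = s.+2 by exists (k - 2)%N; lia.
  (* Parity excludes k = 3, so k - 3 is positive. *)
  have k3 : (3 < k)%N by move: evk k2; rewrite kE /= negbK; case: s kE => [|[]].
  have kl : k = (k./2 + k./2)%N by rewrite addnn halfK (negPf evk) subn0.
  apply: (@le_trans _ _ ((9 + expR 4) * normsq M a)%:E); last first.
    by rewrite lee_fin le_bound ?(ltW C0)// divr_ge0.
  rewrite {1}kE; apply: (newform_sum_le (l := k./2)) => //; first by rewrite -kE.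
  move=> m mM; have m0 : (0 < m)%N by case/andP: mM.
  have x0 := threshold_gt0 R N0 m0.
  have := threshold N0 m0 (trM m mM) a1 k3 h; rewrite kE subn2 /= => xs.
  apply: (le_trans (Gamma_upperG x0 xs)); apply: lee_wpmul2r; first exact: U.
  by rewrite lee_fin lerDl expR_ge0.
apply: (@le_trans _ _ ((9 + expR 4) * normsq M a)%:E); last first.
  by rewrite lee_fin le_bound ?(ltW C0)// divr_ge0// mulr_ge0// ln_ge0// ltW.
rewrite k2; apply: (newform_sum_le (l := 1)) => // m mM.
have m0 : (0 < m)%N by case/andP: mM.
have x0 := threshold_gt0 R N0 m0.
rewrite k2 in h; have x4 := threshold2 N0 (trM m mM) a1 h.
apply: (le_trans (Gamma_upperG0 x0 x4)); apply: lee_wpmul2r; first exact: U.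
by rewrite lee_fin lerDr.
Qed.
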